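(* Let $\mathcal{X}$ be a finite or countably infinite set. Let $0<\beta,\gamma<1$ be real numbers with $2\beta+\gamma<1$, let $f:\mathcal{X}\to(-\infty,\infty)$ be a bounded function, and let $(l_k)_{k\ge 1}$ be a nondecreasing unbounded sequence of integers with $1\le l_k\le k$ for all $k\ge1$ (so $l_1=1$ and $l_k\to\infty$). Let $\{X_n\}_{n=-\infty}^{\infty}$ be a stationary and ergodic time series taking values in $\mathcal{X}$, and let $\lambda_n$, $\tilde X^0_{-\infty}$, $f_n$, $F$, $K(\cdot)$, $p_k$ be the objects constructed from these data as described in the context. Then the following hold. (1) If $F(X^0_{-\infty})$ is almost surely continuous, then almost surely $$\lim_{n\to\infty} f_n = F(\tilde X^0_{-\infty})\quad\text{and}\quad \lim_{n\to\infty}\left|f_n-E\big(f(X_{\lambda_n+1})\,\big|\,X_0^{\lambda_n}\big)\right|=0 .$$ (2) The sequence $(l_k)$ may be chosen (independently of the distribution of the process) in such a way that, whenever the stationary and ergodic time series $\{X_n\}$ has finite entropy rate, the $\lambda_n$ grow no faster than a polynomial in $n$; that is, there is a polynomial $Q$ (which may depend on the distribution of the process) such that, almost surely, $\lambda_n\le Q(n)$ for all sufficiently large $n$. (3) If the stationary and ergodic time series $\{X_n\}$ is finitarily Markovian, then almost surely $$\lim_{n\to\infty}\frac{\lambda_n}{n}=\frac{1}{p_{K(\tilde X^0_{-\infty})-1}\big(\tilde X^0_{-K(\tilde X^0_{-\infty})+1}\big)}<\infty .$$ (4) If the stationary and ergodic time series $\{X_n\}$ is independent and identically distributed, then almost surely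 $\lambda_n=\lambda_{n-1}+1$ for all sufficiently large $n$.
   Context: **Notation.** For $m\le n$, $X_m^n=(X_m,\dots,X_n)$; for $m>n$, $X_m^n$ is the empty string (the same convention is used for other strings such as $x_m^n$, $\tilde X_m^n$). Two empty strings are considered equal. Write $p_k(x_{-k}^0)=P(X_{-k}^0=x_{-k}^0)$ for the probability of a string of length $k+1$, and $p_k(y|x_{-k}^0)=P(X_1=y\,|\,X_{-k}^0=x_{-k}^0)$. In particular $p_{-1}(\text{empty string})=1$ and $p_{-1}(y|\text{empty string})=P(X_1=y)$. Strings are concatenated by listing them, e.g. $(z_{-k-i+1}^{-k},x_{-k+1}^0,y)$, whose probability of occurrence as a block of length $k+i+1$ is $p_{k+i}(z_{-k-i+1}^{-k},x_{-k+1}^0,y)$. A maximum over an empty set is $0$. All random objects below are defined almost surely. **The stopping times $\zeta_n$.** Put $\zeta_0=0$ and for $n\ge1$ $$\zeta_n=\zeta_{n-1}+\min\{t>0:\ X_{\zeta_{n-1}-(l_n-1)+t}^{\zeta_{n-1}+t}=X_{\zeta_{n-1}-(l_n-1)}^{\zeta_{n-1}}\}.$$ **The process $\tilde X$.** Let $J(n)=\min\{j\ge1: l_{j+1}>n\}$ for $n\ge0$, and define $\tilde X_{-i}=X_{\zeta_{J(i)}-i}$ for $i\ge0$; $\tilde X^0_{-\infty}=(\dots,\tilde X_{-1},\tilde X_0)$. **Memory length; finitarily Markovian processes.** For a sample path $X^0_{-\infty}$, $K(X^0_{-\infty})$ is the smallest integer $0\le K<\infty$ such that for all $i\ge1$,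 all $y\in\mathcal X$ and all $z_{-K-i+1}^{-K}\in\mathcal X^i$, $$p_{K-1}(y|X^0_{-K+1})=p_{K+i-1}(y|z_{-K-i+1}^{-K},X^0_{-K+1})$$ provided $p_{K+i}(z_{-K-i+1}^{-K},X^0_{-K+1},y)>0$; and $K(X^0_{-\infty})=\infty$ if there is no such $K$. The quantity $K(\tilde X^0_{-\infty})$ is the same function (with the same probabilities $p_k$, those of the process $\{X_n\}$) evaluated at the path $\tilde X^0_{-\infty}$. The stationary time series $\{X_n\}$ is called finitarily Markovian if $K(X^0_{-\infty})<\infty$ almost surely (it need not be bounded). **The empirical statistics.** For $n\ge 1$ and $k\ge0$ let $$\mathcal L_{n,k}^{(1)}=\{x_{-k}^0\in\mathcal X^{k+1}:\ \exists\, k\le t\le\lceil n/2\rceil-1:\ X_{t-k}^t=x_{-k}^0\},$$ $$\mathcal L_{n,k}^{(2)}=\{x_{-k}^0\in\mathcal X^{k+1}:\ \#\{\lceil n/2\rceil+k\le t\le n:\ X_{t-k}^t=x_{-k}^0\}>n^{1-\gamma}\},$$ $$\mathcal L_k^n=\mathcal L_{n,k}^{(1)}\cap\mathcal L_{n,k}^{(2)}.$$ Define $$\hat\Delta_k^n=\max_{1\le i\le n}\ \max_{(z_{-k-i+1}^{-k},\tilde X_{-k+1}^0,x)\in\mathcal L_{k+i}^n}\ 1_{\{\zeta_{J(k)}\le\lceil n/2\rceil-1\}}\,\bigl|A-B\bigr|,$$ where the inner maximum is over $z_{-k-i+1}^{-k}\in\mathcal X^i$ and $x\in\mathcal X$ with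 the indicated membership, and $$A=\frac{\#\{\lceil n/2\rceil+k\le t\le n:\ X_{t-k}^t=(\tilde X_{-k+1}^0,x)\}}{\#\{\lceil n/2\rceil+k-1\le t\le n-1:\ X_{t-k+1}^t=\tilde X_{-k+1}^0\}},$$ $$B=\frac{\#\{\lceil n/2\rceil+k+i\le t\le n:\ X_{t-k-i}^t=(z_{-k-i+1}^{-k},\tilde X_{-k+1}^0,x)\}}{\#\{\lceil n/2\rceil+k+i-1\le t\le n-1:\ X_{t-k-i+1}^t=(z_{-k-i+1}^{-k},\tilde X_{-k+1}^0)\}}.$$ **The estimate $\chi_n$.** Put $\chi_0=0$, and for $n\ge1$ let $\chi_n$ be the smallest integer $0\le k<n$ such that $\hat\Delta_k^n\le n^{-\beta}$. **The stopping times $\lambda_n$.** Put $\lambda_0=\zeta_0=0$. For $n\ge1$, let $j\ge0$ be the index with $\zeta_j\le\lambda_{n-1}<\zeta_{j+1}$ and set $$\lambda_n=\min\{t>\lambda_{n-1}:\ X_{t-\chi_t+1}^t=X_{\zeta_j-\chi_t+1}^{\zeta_j}\}.$$ Each $\lambda_n$ is a stopping time with respect to the filtration generated by $X_0,X_1,\dots$; $E(\,\cdot\,|X_0^{\lambda_n})$ denotes conditional expectation given the observed data segment $X_0^{\lambda_n}=(X_0,\dots,X_{\lambda_n})$ (i.e. given the $\sigma$-field of events observable up to the stopping time $\lambda_n$). **The estimator.** $$f_n=\frac1n\sum_{j=0}^{n-1}f(X_{\lambda_j+1}),\qquad n\ge 1.$$ **The function $F$ and almost sure continuity.** Let $\mathcal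 X^{*-}=\{(\dots,x_{-1},x_0): x_i\in\mathcal X\text{ for all } i\le0\}$ and let $F:\mathcal X^{*-}\to(-\infty,\infty)$ be (a fixed version of) $F(x_{-\infty}^0)=E(f(X_1)\,|\,X_{-\infty}^0=x_{-\infty}^0)$. Equip $\mathcal X^{*-}$ with the metric $$d^*(x_{-\infty}^0,y_{-\infty}^0)=\sum_{i=0}^\infty 2^{-i-1}1_{\{x_{-i}\ne y_{-i}\}}.$$ $F(X_{-\infty}^0)$ is said to be almost surely continuous if there is a set $C\subseteq\mathcal X^{*-}$ which has probability one (i.e. $P(X^0_{-\infty}\in C)=1$) such that $F$ restricted to $C$ is continuous with respect to $d^*$. **Entropy rate.** $$H=\lim_{n\to\infty}\frac{-1}{n+1}\sum_{x_{-n}^0\in\mathcal X^{n+1}}p_n(x_{-n}^0)\log_2 p_n(x_{-n}^0),$$ with the convention $0\log_2 0=0$. *)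

(* Defs.v *)
From HB Require Import structures.
From mathcomp Require Export all_boot all_order all_algebra.
From mathcomp Require Export all_classical all_reals all_analysis.

Set Implicit Arguments.
Unset Strict Implicit.
Unset Printing Implicit Defensive.

Import Order.TTheory GRing.Theory Num.Theory.
Export numFieldNormedType.Exports.

Local Open Scope classical_set_scope.
Local Open Scope ring_scope.

(* [minN S] and [maxR S] are junk (0) when there is no minimum / maximum; for
   [maxR] this is also the convention that a maximum over an empty set is 0. *)
Definition minN (S : set nat) : nat :=
  xget 0%N [set n | S n /\ forall m, S m -> (n <= m)%N].

Definition maxR (R : realType) (S : set R) : R :=
  xget 0 [set m | S m /\ forall y, S y -> y <= m].

(* x_m^n in chronological order, empty when m > n. *)
Definition str (A : Type) (x : int -> A) (m n : int) : seq A :=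
  [seq x (m + i%:Z) | i <- iota 0 `|Num.max 0 (n - m + 1)|].

(* A left-infinite sequence (..., y_{-1}, y_0) is encoded as y : nat -> A, with
   y i standing for y_{-i}; [recent y k] is the string y_{-k+1}^0. *)
Definition recent (A : Type) (y : nat -> A) (k : nat) : seq A :=
  rev (mkseq y k).

Definition past (A : Type) (x : int -> A) : nat -> A := fun i => x (- i%:Z).

(* Product sigma-algebra on I -> A (A countable and discrete, I countable). *)
Definition cylinders (I A : Type) : set (set (I -> A)) :=
  <<s [set B | exists i a, B = [set x | x i = a]] >>.

(* Values at 0 are irrelevant: the sequence is (l_k), k >= 1. *)
Definition admissible (l : nat -> nat) : Prop :=
  [/\ forall k, (1 <= k)%N -> (1 <= l k <= k)%N,
      forall j k, (1 <= j <= k)%N -> (l j <= l k)%N &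
      forall M, exists2 k, (1 <= k)%N & (M < l k)%N].

Section Pathwise.
Context (R : realType) (A : countType) (l : nat -> nat) (beta gamma : R).
Context (x : int -> A).

Fixpoint zeta (n : nat) : nat :=
  if n is m.+1 then
    let z := (zeta m)%:Z in let c := (l n)%:Z - 1 in
    (zeta m + minN [set t | (0 < t)%N /\
       str x (z - c + t%:Z) (z + t%:Z) = str x (z - c) z])%N
  else 0%N.

Definition Jindex (n : nat) : nat := minN [set j | (1 <= j)%N /\ (n < l j.+1)%N].

Definition Xtilde : nat -> A := fun i => x ((zeta (Jindex i))%:Z - i%:Z).

(* #{a <= t <= b : X_{t-k+1}^t = s}, where k is the length of s. *)
Definition occ (a b : nat) (s : seq A) : nat :=
  count (fun t : nat => str x (t%:Z - (size s)%:Z + 1) t%:Z == s)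
        (index_iota a b.+1).

(* [uphalf n] is the ceiling of n / 2. *)
Definition Lset1 (n k : nat) : set (seq A) :=
  [set s | size s = k.+1 /\ exists2 t : nat, (k <= t <= (uphalf n).-1)%N &
     str x (t%:Z - k%:Z) t%:Z = s].

Definition Lset2 (n k : nat) : set (seq A) :=
  [set s | size s = k.+1 /\
     n%:R `^ (1 - gamma) < (occ (uphalf n + k) n s)%:R].

Definition Lset (n k : nat) : set (seq A) := Lset1 n k `&` Lset2 n k.

(* Frequency of y after s in the second half of the data.  With k the length
   of s, numerator and denominator count the times t with
   ceil(n/2) + k <= t <= n and ceil(n/2) + k - 1 <= t <= n - 1 respectively. *)
Definition freq (n : nat) (s : seq A) (y : A) : R :=
  (occ (uphalf n + size s) n (rcons s y))%:R /
  (occ (uphalf n + size s).-1 n.-1 s)%:R.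

Definition Delta (n k : nat) : R :=
  \big[Num.max/0]_(1 <= i < n.+1)
    maxR [set r | exists z y,
      [/\ size z = i, Lset n (k + i) (rcons (z ++ recent Xtilde k) y) &
          r = ((zeta (Jindex k) <= (uphalf n).-1)%N)%:R *
              `|freq n (recent Xtilde k) y
                - freq n (z ++ recent Xtilde k) y|] ].

Definition chi (n : nat) : nat :=
  if n is 0%N then 0%N
  else minN [set k | (k < n)%N /\ Delta n k <= n%:R `^ (- beta)].

Fixpoint lambda (n : nat) : nat :=
  if n is m.+1 then
    let j := minN [set j | (zeta j <= lambda m < zeta j.+1)%N] in
    minN [set t | (lambda m < t)%N /\
      str x (t%:Z - (chi t)%:Z + 1) t%:Z =
      str x ((zeta j)%:Z - (chi t)%:Z + 1) (zeta j)%:Z]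
  else 0%N.

Definition festim (f : A -> R) (n : nat) : R :=
  n%:R^-1 * \sum_(0 <= j < n) f (x (lambda j + 1)%N%:Z).

End Pathwise.

Section Metric.
Context (R : realType) (A : countType).

Definition dstar (x y : nat -> A) : R :=
  limn (fun n => \sum_(0 <= i < n) 2%:R^-1 ^+ i.+1 * (x i != y i)%:R : R).

Definition dstar_continuous_on (C : set (nat -> A)) (F : (nat -> A) -> R) :=
  forall x, C x -> forall e : R, 0 < e -> exists2 del : R, 0 < del &
    forall y, C y -> dstar x y < del -> `|F y - F x| < e.

End Metric.

Section Process.
Context (R : realType) (A : countType) (d : measure_display).
Context (Omega : measurableType d) (P : probability Omega R).
Context (X : int -> Omega -> A).

Definition path_of (w : Omega) : int -> A := fun n => X n w.

Definition process : Prop := forall n a, measurable [set w | X n w = a].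

Definition time_shift (x : int -> A) : int -> A := fun n => x (n + 1).

Definition stationary : Prop := forall B, cylinders B ->
  P (path_of @^-1` (time_shift @^-1` B)) = P (path_of @^-1` B).

Definition ergodic : Prop := forall B, cylinders B -> time_shift @^-1` B = B ->
  P (path_of @^-1` B) = 0%E \/ P (path_of @^-1` B) = 1%E.

Definition stationary_ergodic : Prop := [/\ process, stationary & ergodic].

Definition iid : Prop :=
  (forall (s : seq int) (E : int -> set A), uniq s ->
     P [set w | forall i, i \in s -> E i (X i w)]
     = (\prod_(i <- s) P [set w | E i (X i w)])%E) /\
  (forall (i j : int) (E : set A),
     P [set w | E (X i w)] = P [set w | E (X j w)]).

(* p_k(s) for a string s of length k + 1; the empty string has probability 1. *)
Definition pstr (s : seq A) : R :=
  fine (P [set w | str (path_of w) (1 - (size s)%:Z) 0 = s]).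

(* p_k(y | s) for a string s of length k + 1. *)
Definition pcond (y : A) (s : seq A) : R :=
  fine (P [set w | str (path_of w) (1 - (size s)%:Z) 0 = s /\ X 1 w = y]) / pstr s.

Definition memory_ok (y : nat -> A) (K : nat) : Prop :=
  forall i, (1 <= i)%N -> forall (a : A) (z : seq A), size z = i ->
    0 < pstr (rcons (z ++ recent y K) a) ->
    pcond a (recent y K) = pcond a (z ++ recent y K).

(* [None] stands for an infinite memory length. *)
Definition memory_length (y : nat -> A) : option nat :=
  if `[< exists K, memory_ok y K >] then Some (minN (memory_ok y)) else None.

Definition finitarily_markovian : Prop :=
  {ae P, forall w, memory_length (past (path_of w)) <> None}.

Definition log2 (t : R) : R := ln t / ln 2%:R.

Definition entropy_rate : \bar R :=
  limn (fun n => ((n.+1%:R^-1)%:E *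
    \esum_(s in [set s : seq A | size s = n.+1]) (- (pstr s * log2 (pstr s)))%:E)%E).

(* G is a version of E(Y | S). *)
Definition cond_expectation (S : set (set Omega)) (Y G : Omega -> R) : Prop :=
  [/\ forall B : set R, measurable B -> S (G @^-1` B),
      P.-integrable setT (EFin \o G) &
      forall E, S E ->
        (\int[P]_(w in E) (G w)%:E = \int[P]_(w in E) (Y w)%:E)%E].

(* F is a version of E(f(X_1) | X_{-oo}^0 = . ). *)
Definition regression_version (f : A -> R) (F : (nat -> A) -> R) : Prop :=
  (forall B : set R, measurable B -> cylinders (F @^-1` B)) /\
  cond_expectation
    (preimage_set_system setT (fun w => past (path_of w)) (@cylinders nat A))
    (fun w => f (X 1 w)) (fun w => F (past (path_of w))).

Definition as_continuous (F : (nat -> A) -> R) : Prop :=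
  exists C : set (nat -> A),
    [/\ cylinders C, P [set w | C (past (path_of w))] = 1%E &
        dstar_continuous_on C F].

(* The sigma-algebra of X_0^{T}, T a random time: the segment is a random
   element of the countable discrete space of strings.  Its length is T + 1, so
   that when T is a stopping time this is the sigma-algebra of the events
   observable up to T. *)
Definition segment_events (T : Omega -> nat) : set (set Omega) :=
  preimage_set_system setT (fun w => str (path_of w) 0 (T w)%:Z)
    [set: set (seq A)].

End Process.

(* Main.v *)
(** The passage from a time 0 to the first recurrence of the block of length k ending there
preserves a stationary law; hence so does x |-> T^{zeta_n} x, and the limit path Xtilde has the
law of the past.  At each time lambda_n the data end with the last chi letters of Xtilde.  For
almost every path the empirical frequencies are good enough (ergodic theorem, and an exponential
supermartingale bound with a union bound over the windows of the first half of the data) for chi_n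
to converge to the least K such that the last K letters of Xtilde form a memory word, or to
infinity if there is none.  So the conditional mean of f(X_{lambda_n+1}) given the data tends to
F(Xtilde), either by the memory property or by continuity of F, while the average of the
martingale differences f(X_{lambda_n+1}) - E(f(X_{lambda_n+1}) | X_0^{lambda_n}) tends to 0.

If K is finite, then the lambda_n are eventually the successive visits to the memory word, and the
ergodic theorem gives lambda_n / n -> 1 / p; for an i.i.d. process the memory word is empty.

For (2), lambda_n <= zeta_n, and l_n is chosen so slow that 2^(l_n^4) <= n.  A finite block entropy
then makes the block of length l_n at the end of Xtilde at least as likely as n^-2 for large n, so
that by Kac's inequality its return time is eventually at most n^4, and zeta_n = O(n^5). *)

(* The words compared in [Delta] are random and, over an infinite alphabet, unlimited in number. But
   a word enters the comparison only if it occurs in the first half of the data, so it is named by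
   its position and length there: of order n^3 windows suffice, and the second half, where the word
   is counted, lies in the future of that choice. The number of occurrences is random too; hence the
   exponential bound carries a predictable compensator instead of a fixed number of terms, and the
   demand for more than n^(1-gamma) occurrences turns a deviation n^(-beta)/2 into an exponent of
   order n^(1-gamma-2 beta). This is where 2 beta + gamma < 1 enters.

   When [chi] stays bounded, the data never come close to Xtilde in the metric, so continuity of F
   alone gives nothing there; the memory property takes its place.

   On exceptional paths the minima that define [zeta] and [lambda] are over empty sets, and [minN]
   returns 0. The stopping-time property is proved between [good] paths only, and the martingale and
   conditioning arguments are arranged around this. *)
From HB Require Import structures.
Require Import Defs.
From mathcomp Require Import all_boot all_order all_algebra.
From mathcomp Require Import all_classical all_reals all_analysis.
From mathcomp Require Import zify ring lra.
From mathcomp Require Import measurable_realfun.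

Set Implicit Arguments.
Unset Strict Implicit.
Unset Printing Implicit Defensive.

Import Order.TTheory GRing.Theory Num.Theory.

Local Open Scope classical_set_scope.
Local Open Scope ring_scope.

(** * Strings and recurrence times *)

Section Strings.
Context (A : Type).
Implicit Types (x : int -> A) (y : nat -> A).

(** The path read backwards from time t. Every comparison of strings becomes an equality of
    [recent (pa x t) k], that is, of last k letters, which removes the arithmetic of endpoints. *)
Definition pa x (t : int) : nat -> A := fun i => x (t - i%:Z).

Lemma str_recent x (t : int) (k : nat) :
  str x (t - k%:Z + 1) t = recent (pa x t) k.
Proof.
rewrite /str /recent.
have -> : absz (Num.max 0 (t - (t - k%:Z + 1) + 1)) = k by lia.
apply: (@eq_from_nth _ (x 0)); first by rewrite size_map size_iota size_rev size_mkseq.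
move=> i; rewrite size_map size_iota => ik.
rewrite (nth_map 0%N) ?size_iota // nth_iota // nth_rev ?size_mkseq // nth_mkseq; last by lia.
by rewrite /pa; congr x; lia.
Qed.

Lemma str_recentS x (t : int) (k : nat) :
  str x (t - k%:Z) t = recent (pa x t) k.+1.
Proof. by rewrite -str_recent; congr str; lia. Qed.

Lemma str_recent0 x (t : nat) : str x 0 t%:Z = recent (pa x t%:Z) t.+1.
Proof. by rewrite -str_recentS subrr. Qed.

Lemma str_recent1 x (k : nat) : str x (1 - k%:Z) 0 = recent (pa x 0) k.
Proof. by rewrite -str_recent; congr str; lia. Qed.

Lemma pastE x : past x = pa x 0.
Proof. by apply/funext => i; rewrite /past /pa sub0r. Qed.

Lemma size_recent y k : size (recent y k) = k.
Proof. by rewrite size_rev size_mkseq. Qed.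

Lemma recentS y k : recent y k.+1 = y k :: recent y k.
Proof. by rewrite /recent mkseqS rev_rcons. Qed.

Lemma recent0 y : recent y 0 = [::].
Proof. by []. Qed.

Lemma recent_eqP y y' k :
  recent y k = recent y' k <-> forall i, (i < k)%N -> y i = y' i.
Proof.
split; last first.
  by move=> h; rewrite /recent; congr rev; apply/eq_in_map => i; rewrite mem_iota => /h.
elim: k => [//|k ih]; rewrite !recentS => -[e /ih h] i.
by rewrite ltnS leq_eqVlt => /orP[/eqP->|/h].
Qed.

Lemma recent_leq y y' k k' : (k' <= k)%N -> recent y k = recent y' k ->
  recent y k' = recent y' k'.
Proof.
by move=> kk /recent_eqP h; apply/recent_eqP => i ik; apply: h; apply: leq_trans ik kk.
Qed.

Lemma recentD y k i : exists2 z, size z = i & recent y (k + i) = z ++ recent y k.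
Proof.
elim: i => [|i [z sz e]]; first by exists [::]; rewrite ?addn0.
by exists (y (k + i)%N :: z); rewrite /= ?sz // addnS recentS e.
Qed.

Lemma recent_suffix y k i z s : recent y (k + i) = z ++ s -> size z = i ->
  s = recent y k.
Proof.
have [z' sz' ->] := recentD y k i => e sz; have := congr1 (drop i) e.
by rewrite !drop_size_cat.
Qed.

Lemma recent_pa_rcons x (t : int) k :
  recent (pa x (t + 1)) k.+1 = rcons (recent (pa x t) k) (x (t + 1)).
Proof.
rewrite /recent /mkseq /= rev_cons /pa subr0; congr rcons; congr rev.
have -> : iota 1 k = map (addn 1) (iota 0 k) by rewrite -iotaDl.
rewrite -map_comp; apply/eq_map => i /=.
by congr x; lia.
Qed.

End Strings.

Section MinN.

Lemma minN_spec (S : set nat) : (exists n, S n) ->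
  S (minN S) /\ forall m, S m -> (minN S <= m)%N.
Proof.
move=> [n Sn]; rewrite /minN; case: xgetP => [y _ //|] h.
have [m [Sm mm]] : exists m, S m /\ forall k, S k -> (m <= k)%N.
  have [m /asboolP Sm hm] := ex_minnP (ex_intro (fun n => `[<S n>]) n (asboolT Sn)).
  by exists m; split=> // k /asboolT; exact: hm.
by case: (h m).
Qed.

Lemma minN_eq (S : set nat) n : S n -> (forall m, S m -> (n <= m)%N) -> minN S = n.
Proof.
move=> Sn h; have [h1 h2] := minN_spec (ex_intro _ n Sn).
by apply/eqP; rewrite eqn_leq h2 // h.
Qed.

Lemma minN_none (S : set nat) : ~ (exists n, S n) -> minN S = 0%N.
Proof. by move=> h; rewrite /minN; case: xgetP => // y _ [Sy _]; case: h; exists y. Qed.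

Lemma minN_ext (S S' : set nat) : (forall n, S n <-> S' n) -> minN S = minN S'.
Proof. by move=> h; congr minN; apply/seteqP; split=> n /h. Qed.

End MinN.

(** * The stopping times on a single path *)

Section Pathwise.
Context (R : realType) (A : countType) (l : nat -> nat) (beta gamma : R).
Hypothesis adm : admissible l.
Implicit Types (x : int -> A).

Notation zeta := (zeta l).
Notation J := (Jindex l).
Notation Xt := (Xtilde l).
Notation chi := (chi l beta gamma).
Notation Delta := (Delta l gamma).
Notation lambda := (lambda l beta gamma).

Lemma adm_le n : (l n.+1 <= n.+1)%N.
Proof. by have [h _ _] := adm; have /andP[] := h n.+1 isT. Qed.

Lemma adm_mono j k : (j <= k)%N -> (l j.+1 <= l k.+1)%N.
Proof. by have [_ h _] := adm => jk; apply: h. Qed.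

Lemma J_spec k : [/\ (1 <= J k)%N, (k < l (J k).+1)%N &
  forall j, (1 <= j)%N -> (k < l j.+1)%N -> (J k <= j)%N].
Proof.
have [_ _ h] := adm.
have : exists j, (1 <= j)%N /\ (k < l j.+1)%N.
  have [j j1 kj] := h k; exists j; split=> //; case: j j1 kj => // j _ kj.
  by apply: leq_trans kj _; apply: adm_mono.
by move=> /minN_spec[[h1 h2] h3]; split=> // j h4 h5; apply: h3.
Qed.

(** Forced by l_{J+1} <= J+1. It ensures that the letters of [Xt] are read at nonnegative times. *)
Lemma J_ge k : (k <= J k)%N.
Proof. by have [_ h _] := J_spec k; have := leq_trans h (adm_le _). Qed.

Lemma J_mono k k' : (k <= k')%N -> (J k <= J k')%N.
Proof.
move=> kk; have [h1 h2 _] := J_spec k'; have [_ _ h] := J_spec k.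
by apply: h => //; apply: leq_ltn_trans kk h2.
Qed.

Definition returns (k : nat) x (z : nat) : Prop :=
  exists t : nat, (0 < t)%N /\ recent (pa x (z + t)%N) k = recent (pa x z) k.

Definition ret (k : nat) x (z : nat) : nat :=
  minN [set t : nat | (0 < t)%N /\ recent (pa x (z + t)%N) k = recent (pa x z) k].

Lemma zetaS x n : zeta x n.+1 = (zeta x n + ret (l n.+1) x (zeta x n))%N.
Proof.
rewrite /=; congr addn; apply: minN_ext => t /=; rewrite -!str_recent.
have -> : (zeta x n)%:Z - ((l n.+1)%:Z - 1) + t%:Z =
  (zeta x n + t)%N%:Z - (l n.+1)%:Z + 1 by lia.
by have -> : (zeta x n)%:Z - ((l n.+1)%:Z - 1) =
  (zeta x n)%:Z - (l n.+1)%:Z + 1 by lia.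
Qed.

(** All minima that define [zeta] are over nonempty sets. Elsewhere [zeta] may stall, at a value
    that depends on the whole future. *)
Definition good x : Prop := forall n, returns (l n.+1) x (zeta x n).

Section GoodPath.
Variable x : int -> A.
Hypothesis gx : good x.

Lemma ret_spec n : let r := ret (l n.+1) x (zeta x n) in
  [/\ (0 < r)%N, recent (pa x (zeta x n + r)%N) (l n.+1) = recent (pa x (zeta x n)) (l n.+1)
   & forall t, (0 < t)%N -> recent (pa x (zeta x n + t)%N) (l n.+1) = recent (pa x (zeta x n)) (l n.+1) -> (r <= t)%N].
Proof. by have [[h1 h2] h3] := minN_spec (gx n); split=> // t t0 e; apply: h3. Qed.

Lemma zeta_lt n : (zeta x n < zeta x n.+1)%N.
Proof. by rewrite zetaS -addn1 leq_add2l; have [] := ret_spec n. Qed.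

Lemma zeta_mono m n : (m <= n)%N -> (zeta x m <= zeta x n)%N.
Proof.
elim: n => [|n ih]; first by rewrite leqn0 => /eqP->.
rewrite leq_eqVlt => /orP[/eqP-> //|/ih h].
exact: leq_trans h (ltnW (zeta_lt n)).
Qed.

Lemma zeta_inj_lt m n : (zeta x m < zeta x n)%N -> (m < n)%N.
Proof. by apply: contraTT; rewrite -!leqNgt; exact: zeta_mono. Qed.

Lemma zeta_ge n : (n <= zeta x n)%N.
Proof. by elim: n => // n ih; apply: leq_trans (zeta_lt n). Qed.

Lemma zeta_match n i : (i < l n.+1)%N ->
  x ((zeta x n.+1)%:Z - i%:Z) = x ((zeta x n)%:Z - i%:Z).
Proof. by rewrite zetaS; have [_ /recent_eqP h _] := ret_spec n; exact: h. Qed.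

(** Letter i is frozen from stage [J i] on: each later jump repeats a block of length greater than
    i. *)
Lemma zeta_Xt_ge m i : (J i <= m)%N -> x ((zeta x m)%:Z - i%:Z) = Xt x i.
Proof.
elim: m => [|m ih]; first by have [] := J_spec i; case: (J i).
rewrite leq_eqVlt => /orP[/eqP<- //|]; rewrite ltnS => h.
rewrite zeta_match ?ih //; have [_ h2 _] := J_spec i.
by apply: leq_trans h2 _; exact: adm_mono.
Qed.

(** [J i] is at least 1 by definition, so [zeta_Xt_ge] misses stage 0; there the first jump repeats
    the letter in question. *)
Lemma zeta_Xt m i : (i < l m.+1)%N -> x ((zeta x m)%:Z - i%:Z) = Xt x i.
Proof.
move=> im; case: (posnP m) => [m0|m0]; last first.
  by apply: zeta_Xt_ge; have [_ _ h] := J_spec i; exact: h.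
rewrite -zeta_match // zeta_Xt_ge // m0; have [_ _ h] := J_spec i.
by apply: h => //; apply: leq_trans im _; rewrite m0; exact: adm_mono.
Qed.

End GoodPath.

Lemma Delta_zero x n k : ~~ (zeta x (J k) <= (uphalf n).-1)%N -> Delta x n k = 0.
Proof.
move=> h; rewrite /Defs.Delta.
apply: (big_ind (fun v => v = 0)) => //; first by move=> ? ? -> ->; rewrite maxxx.
move=> i _; rewrite /maxR; case: xgetP => // r _ /= [[z [y [_ _ ->]]] _].
by rewrite (negbTE h) mul0r.
Qed.

(** A word of n + 2 letters or more does not fit into the first half of the data, so the maximum is
    over empty sets. This makes the set whose minimum is [chi] nonempty. *)
Lemma Delta_last x n : Delta x n.+1 n = 0.
Proof.
rewrite /Defs.Delta big_seq; apply: (big_ind (fun v => v = 0)) => //.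
  by move=> ? ? -> ->; rewrite maxxx.
move=> i; rewrite mem_index_iota => /andP[i1 _].
rewrite /maxR; case: xgetP => // r _ /= [[z [y [_ [[_ [t h _]] _] _]]] _].
by exfalso; move: h i1; lia.
Qed.

Lemma chi_spec x n : [/\ (chi x n.+1 < n.+1)%N, Delta x n.+1 (chi x n.+1) <= n.+1%:R `^ (- beta)
  & forall k, (k < chi x n.+1)%N -> n.+1%:R `^ (- beta) < Delta x n.+1 k].
Proof.
have : exists k, (k < n.+1)%N /\ Delta x n.+1 k <= n.+1%:R `^ (- beta).
  by exists n; rewrite Delta_last powR_ge0 ltnSn.
move=> /minN_spec; rewrite -/(chi x n.+1) => -[[h1 h2] h3]; split=> // k kc.
rewrite ltNge; apply/negP => h4.
have /h3 : (k < n.+1)%N /\ Delta x n.+1 k <= n.+1%:R `^ (- beta).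
  by split=> //; apply: ltn_trans kc h1.
by rewrite leqNgt -/(chi x n.+1) kc.
Qed.

(** Below [chi] the value of [Delta] exceeds a nonnegative threshold, so its indicator is 1. Hence
    the letters of [Xt] that [chi] at time n refers to are known by half of that time. *)
Lemma chi_zeta x n k : (k < chi x n)%N -> (zeta x (J k) <= (uphalf n).-1)%N.
Proof.
case: n => [//|n] /(let: And3 _ _ h := chi_spec x n in h k) h.
rewrite leqNgt; apply/negP; rewrite ltnNge => /Delta_zero e; move: h.
by rewrite e ltNge powR_ge0.
Qed.

(** The test in the definition of [lambda], with the block ending at [zeta x j] replaced by the end
    of [Xt]; [lambda_spec] shows that on good paths the replacement changes nothing. *)
Definition active x (t : nat) : Prop :=
  recent (pa x t) (chi x t) = recent (Xt x) (chi x t).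

Section GoodPath2.
Variable x : int -> A.
Hypothesis gx : good x.

Lemma uphalf_pred_lt n : (0 < n)%N -> ((uphalf n).-1 < n)%N.
Proof. by lia. Qed.

(** [chi_zeta] places the recurrence that fixes letter i strictly before t, so its index is at most
    j, and the block ending at [zeta x j] already carries the tested letters of [Xt]. *)
Lemma chi_J (t j : nat) i : (i < chi x t)%N -> (t <= zeta x j.+1)%N -> (J i <= j)%N.
Proof.
move=> ic tz; have t0 : (0 < t)%N by case: t ic {tz}.
have h := chi_zeta ic; apply: (zeta_inj_lt gx (m := J i) (n := j.+1)).
exact: leq_ltn_trans h (leq_trans (uphalf_pred_lt t0) tz).
Qed.

Lemma zeta_active j : active x (zeta x j.+1).
Proof.
apply/recent_eqP => i /(chi_J (j := j)) /(_ (leqnn _)) h.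
by rewrite /pa zeta_Xt_ge // leqW.
Qed.

Lemma zeta_bracket (m : nat) : exists2 j, (zeta x j <= m < zeta x j.+1)%N &
  minN [set j | (zeta x j <= m < zeta x j.+1)%N] = j.
Proof.
have : exists j, (zeta x j <= m < zeta x j.+1)%N.
  have h : exists j, (m < zeta x j)%N by exists m.+1; apply: zeta_ge.
  have := ex_minnP h; case: ex_minnP => -[|j] // mj hmin _.
  exists j; rewrite mj andbT leqNgt; apply/negP => /hmin.
  by rewrite ltnn.
move=> [j hj]; exists j => //; apply: minN_eq => // k.
move/andP: hj => [h1 h2] /andP[h3 h4].
by have := zeta_inj_lt gx (m := j) (n := k.+1) (leq_ltn_trans h1 h4).
Qed.

(** The time [zeta x j.+1] is active, so the search ends there at the latest, and in that range the
    comparison block agrees with [Xt]. The index j thus disappears: the [lambda] are the successive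
    active times after 0. *)
Lemma lambda_spec n : [/\ (lambda x n < lambda x n.+1)%N, active x (lambda x n.+1) &
  forall t, (lambda x n < t < lambda x n.+1)%N -> ~ active x t].
Proof.
have [j /andP[h1 h2] e] := zeta_bracket (lambda x n).
have eqv t : (t <= zeta x j.+1)%N ->
    str x (t%:Z - (chi x t)%:Z + 1) t%:Z =
      str x ((zeta x j)%:Z - (chi x t)%:Z + 1) (zeta x j)%:Z <-> active x t.
  move=> tz; rewrite !str_recent /active.
  suff -> : recent (pa x (zeta x j)) (chi x t) = recent (Xt x) (chi x t) by [].
  apply/recent_eqP => i ic; apply: zeta_Xt => //.
  have := chi_J ic tz; have [_ h _] := J_spec i => /adm_mono.
  exact: leq_trans.
have := minN_spec (S := [set t : nat | (lambda x n < t)%N /\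
      str x (t%:Z - (chi x t)%:Z + 1) t%:Z =
      str x ((zeta x j)%:Z - (chi x t)%:Z + 1) (zeta x j)%:Z]).
case; first by exists (zeta x j.+1); split => //; apply/eqv => //; exact: zeta_active.
have -> : minN [set t : nat | (lambda x n < t)%N /\
      str x (t%:Z - (chi x t)%:Z + 1) t%:Z =
      str x ((zeta x j)%:Z - (chi x t)%:Z + 1) (zeta x j)%:Z] = lambda x n.+1.
  by rewrite /= -/(zeta x) e.
move=> [a1 a2] a3.
have le : (lambda x n.+1 <= zeta x j.+1)%N.
  by apply: a3; split=> //; apply/eqv => //; exact: zeta_active.
split=> //; first by apply/eqv.
move=> t /andP[b1 b2] h.
have h3 : (lambda x n.+1 <= t)%N.
  by apply: a3; split=> //; apply/eqv => //; apply: ltnW (leq_trans b2 le).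
by move: b2; rewrite ltnNge h3.
Qed.

Lemma lambda_lt m n : (m < n)%N -> (lambda x m < lambda x n)%N.
Proof.
elim: n => // n ih; rewrite ltnS leq_eqVlt => /orP[/eqP->|/ih h].
  by have [] := lambda_spec n.
by apply: ltn_trans h _; have [] := lambda_spec n.
Qed.

Lemma lambda_ge n : (n <= lambda x n)%N.
Proof. by elim: n => // n ih; have [h _ _] := lambda_spec n; apply: leq_ltn_trans h. Qed.

(** By induction, [zeta x n.+1] is an active time beyond [lambda x n]. *)
Lemma lambda_le_zeta n : (lambda x n <= zeta x n)%N.
Proof.
elim: n => // n ih; have [h1 h2 h3] := lambda_spec n.
rewrite leqNgt; apply/negP => h; apply: (h3 (zeta x n.+1)); last exact: zeta_active.
by rewrite h andbT; apply: leq_ltn_trans ih (zeta_lt gx n).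
Qed.

End GoodPath2.
End Pathwise.

(** * Dependence on the observed data only *)

Section Locality.
Context (R : realType) (A : countType) (l : nat -> nat) (beta gamma : R).
Hypothesis adm : admissible l.
Implicit Types (x : int -> A).

Notation zeta := (zeta l).
Notation J := (Jindex l).
Notation Xt := (Xtilde l).
Notation chi := (chi l beta gamma).
Notation Delta := (Delta l gamma).
Notation lambda := (lambda l beta gamma).
Notation active := (active l beta gamma).

Definition agree x x' (n : nat) := forall i : nat, (i <= n)%N -> x i%:Z = x' i%:Z.

Lemma agree_sym x x' n : agree x x' n -> agree x' x n.
Proof. by move=> h i /h. Qed.

Lemma agree_leq x x' n m : (m <= n)%N -> agree x x' n -> agree x x' m.
Proof. by move=> mn h i im; apply: h; apply: leq_trans im mn. Qed.

Lemma agree_pa x x' (n t i : nat) : agree x x' n -> (i <= t <= n)%N ->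
  pa x t i = pa x' t i.
Proof.
move=> h /andP[it tn]; rewrite /pa subzn //; apply: h; exact: leq_trans (leq_subr _ _) tn.
Qed.

Lemma agree_recent x x' (n t k : nat) : agree x x' n -> (t <= n)%N -> (k <= t.+1)%N ->
  recent (pa x t) k = recent (pa x' t) k.
Proof.
move=> h tn kt; apply/recent_eqP => i ik; apply: agree_pa h _.
by rewrite tn andbT -ltnS; apply: leq_trans ik kt.
Qed.

Lemma agree_recentP x x' (n : nat) :
  agree x x' n <-> recent (pa x n) n.+1 = recent (pa x' n) n.+1.
Proof.
split=> [h|/recent_eqP h i iN]; first exact: agree_recent h _ _.
by have := h (n - i)%N; rewrite /pa ltnS leq_subr => /(_ isT); rewrite subzn ?leq_subr // subKn.
Qed.

Lemma occ_agree x x' n a b s : agree x x' n -> (b <= n)%N ->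
  (size s <= a.+1)%N -> occ x a b s = occ x' a b s.
Proof.
move=> h bn sa; apply: eq_in_count => t; rewrite mem_index_iota => /andP[at_ tb].
by rewrite !str_recent (agree_recent h) //; [move: tb bn; lia|move: at_ sa; lia].
Qed.

Lemma freq_agree x x' n s y : agree x x' n ->
  freq R x n s y = freq R x' n s y.
Proof.
by move=> h; rewrite /freq !(occ_agree h) ?size_rcons //; lia.
Qed.

Lemma Lset_agree x x' n k s : agree x x' n -> Lset gamma x n k s -> Lset gamma x' n k s.
Proof.
move=> h [[sk [t /andP[kt tn] e]] [_ h2]]; split; split=> //.
  exists t; first by rewrite kt.
  by rewrite -e !str_recentS; apply/esym; apply: (agree_recent h) => //; lia.
by rewrite -(occ_agree h) // sk; lia.
Qed.

(** Stated for arbitrary paths, with the stopping time and the letters of [Xt] compared by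
    hypothesis: this is the form from which measurability of [Delta] follows. *)
Lemma Delta_ext x x' n k : agree x x' n ->
  (zeta x (J k) <= (uphalf n).-1)%N = (zeta x' (J k) <= (uphalf n).-1)%N ->
  recent (Xt x) k = recent (Xt x') k -> Delta x n k = Delta x' n k.
Proof.
move=> h e1 e2; rewrite /Defs.Delta; apply: eq_bigr => i _.
rewrite e1 e2; congr maxR; apply/seteqP; split=> r /= [z [y [sz hL ->]]];
  exists z, y; split => //.
- exact: Lset_agree h hL.
- by rewrite !(freq_agree _ _ h).
- exact: Lset_agree (agree_sym h) hL.
- by rewrite !(freq_agree _ _ h).
Qed.

Section TwoPaths.
Variables (x x' : int -> A).
Hypotheses (gx : good l x) (gx' : good l x').

(** The block tested at [zeta x j] has length at most j + 1, hence starts at a nonnegative time, and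
    no time beyond its first return is inspected. *)
Lemma zeta_agree n j : agree x x' n -> (zeta x j <= n)%N -> zeta x' j = zeta x j.
Proof.
move=> h; elim: j => // j ih jn.
have zn : (zeta x j < n)%N := leq_trans (zeta_lt gx j) jn.
have e := ih (ltnW zn); rewrite !zetaS e; congr addn.
have [r0 r1 r2] := ret_spec gx j.
rewrite zetaS in jn.
have lz : (l j.+1 <= (zeta x j).+1)%N.
  by apply: leq_trans (adm_le adm j) _; rewrite ltnS; exact: zeta_ge.
apply: minN_eq => /=.
  split=> //; rewrite -!(agree_recent h) //; [exact: ltnW|].
  by apply: leq_trans lz _; rewrite ltnS leq_addr.
move=> t [t0 et]; case: (leqP (ret (l j.+1) x (zeta x j)) t) => // tr.
have tn : (zeta x j + t <= n)%N by apply: leq_trans jn; rewrite leq_add2l ltnW.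
suff : (ret (l j.+1) x (zeta x j) <= t)%N by rewrite leqNgt tr.
apply: r2 => //; rewrite !(agree_recent h) //; first exact: ltnW.
by apply: leq_trans lz _; rewrite ltnS leq_addr.
Qed.

End TwoPaths.

Lemma zeta_agree_le x x' n j m : good l x -> good l x' -> agree x x' n -> (m <= n)%N ->
  (zeta x j <= m)%N = (zeta x' j <= m)%N.
Proof.
move=> gx gx' h mn; apply/idP/idP => hh.
  by rewrite (zeta_agree gx h) //; apply: leq_trans hh mn.
by rewrite (zeta_agree gx' (agree_sym h)) //; apply: leq_trans hh mn.
Qed.

Section TwoPaths2.
Variables (x x' : int -> A).
Hypotheses (gx : good l x) (gx' : good l x').

Lemma Xt_agree n k : agree x x' n -> (zeta x (J k) <= n)%N ->
  forall i, (i <= k)%N -> Xt x i = Xt x' i.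
Proof.
move=> h zn i ik.
have zin : (zeta x (J i) <= n)%N.
  by apply: leq_trans zn; apply: zeta_mono => //; apply: J_mono.
rewrite /Xtilde (zeta_agree gx h zin).
apply: (agree_pa (n := n) h); rewrite zin andbT.
exact: leq_trans (J_ge adm i) (zeta_ge gx _).
Qed.

Lemma Delta_agree n k : agree x x' n -> Delta x n k = Delta x' n k.
Proof.
move=> h; have hn : ((uphalf n).-1 <= n)%N by lia.
have e := zeta_agree_le (J k) gx gx' h hn.
case: (boolP (zeta x (J k) <= (uphalf n).-1)%N) => hz; last first.
  by rewrite !Delta_zero // -e.
apply: Delta_ext => //; apply/recent_eqP => i ik.
exact: (Xt_agree h (leq_trans hz hn) (ltnW ik)).
Qed.

Lemma chi_agree n : agree x x' n -> chi x n = chi x' n.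
Proof.
case: n => // n h; rewrite /Defs.chi; apply: minN_ext => k /=.
by rewrite (Delta_agree _ h).
Qed.

(** By [chi_zeta] the test involves only letters of [Xt] that are known by time t. *)
Lemma active_agree t : agree x x' t -> active x t -> active x' t.
Proof.
move=> h; rewrite /active -(chi_agree h) => /recent_eqP e.
apply/recent_eqP => i ic.
have zt : (zeta x (J i) <= t)%N by have := chi_zeta ic; lia.
rewrite -(Xt_agree h zt (leqnn _)) -e //.
apply/esym/(agree_pa h); rewrite leqnn andbT.
exact: leq_trans (J_ge adm i) (leq_trans (zeta_ge gx _) zt).
Qed.

End TwoPaths2.

(** The stopping-time property: up to time t the two paths have the same active times. *)
Lemma lambda_agree x x' j t : good l x -> good l x' -> agree x x' t ->
  lambda x j = t -> lambda x' j = t.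
Proof.
move=> gx gx'; elim: j t => [t _ <- //|j ih] t h e.
have [a1 a2 a3] := lambda_spec beta gamma adm gx j.
have [b1 b2 b3] := lambda_spec beta gamma adm gx' j.
have ltt : (lambda x j < t)%N by rewrite -e.
have el := ih _ (agree_leq (ltnW ltt) h) erefl.
have le : (lambda x' j.+1 <= t)%N.
  rewrite leqNgt; apply/negP => lt; apply: (b3 t); first by rewrite el ltt lt.
  by apply: (active_agree gx gx' h); rewrite -e.
apply/eqP; rewrite eqn_leq le /= leqNgt; apply/negP => lt.
apply: (a3 (lambda x' j.+1)); first by rewrite -el b1 e.
by apply: (active_agree gx' gx _ b2); apply: agree_leq le (agree_sym h).
Qed.

End Locality.

(** * Measurability on path space *)

(* [pathT a0] is [I -> A]; the point a0 only serves to make it a pointed type. *)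
Definition pathT (I A : Type) (a0 : A) : Type := I -> A.
Arguments pathT : clear implicits.

Section PathType.
Context (I A : Type) (a0 : A).

HB.instance Definition _ := gen_eqMixin (pathT I A a0).
HB.instance Definition _ := gen_choiceMixin (pathT I A a0).
HB.instance Definition _ := isPointed.Build (pathT I A a0) (fun=> a0).

Lemma cylinders0 : @cylinders I A set0.
Proof. exact: sigma_algebra0. Qed.

Lemma cylindersC (B : set (I -> A)) : cylinders B -> cylinders (~` B).
Proof. by move=> h; rewrite -setTD; exact: sigma_algebraCD. Qed.

Lemma cylindersU (F : (set (I -> A)) ^nat) :
  (forall i, cylinders (F i)) -> cylinders (\bigcup_i F i).
Proof. exact: sigma_algebra_bigcup. Qed.

HB.instance Definition _ := @isMeasurable.Build
  (sigma_display [set B : set (I -> A) | exists i a, B = [set x | x i = a]])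
  (pathT I A a0) (@cylinders I A) cylinders0 cylindersC cylindersU.

End PathType.

Section DiscretelyMeasurable.
Context d (T : measurableType d).

(* All statistics of a path take countably many values, so they satisfy this strong form of
   measurability, which needs no sigma-algebra on V and is stable under arbitrary maps. *)
Definition dm (V : Type) (v : T -> V) := forall B : set V, measurable (v @^-1` B).

Lemma dm_cst (V : Type) (c : V) : dm (fun=> c).
Proof.
move=> B; case: (pselect (B c)) => h.
  by rewrite (_ : _ @^-1` _ = setT) //; apply/seteqP; split.
by rewrite (_ : _ @^-1` _ = set0) //; apply/seteqP; split.
Qed.

Lemma dm_comp (V W : Type) (g : V -> W) (v : T -> V) : dm v -> dm (fun x => g (v x)).
Proof. by move=> h B; exact: (h (g @^-1` B)). Qed.

Lemma dm_ext (V : Type) (v v' : T -> V) : (forall x, v x = v' x) -> dm v -> dm v'.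
Proof. by move=> /funext ->. Qed.

Lemma dm_fibers (V : countType) (v : T -> V) :
  (forall c, measurable (v @^-1` [set c])) -> dm v.
Proof.
move=> h B; have -> : v @^-1` B = \bigcup_k
    (if unpickle k is Some c then if `[<B c>] then v @^-1` [set c] else set0 else set0).
  apply/seteqP; split=> x /=.
    by move=> Bx; exists (pickle (v x)) => //; rewrite pickleK asboolT.
  by case=> k _; case: unpickle => // c; case: asboolP => //= Bc ->.
apply: bigcupT_measurable => k; case: unpickle => [c|]; last exact: measurable0.
by case: ifP => _; [exact: h|exact: measurable0].
Qed.

(** Evaluation at a random index with countably many values, by cutting along the fibres of [u];
    this is how the path read at a time such as [zeta] is treated. *)
Lemma dm_bind (C : countType) (V : Type) (u : T -> C) (v : C -> T -> V) :
  dm u -> (forall c, dm (v c)) -> dm (fun x => v (u x) x).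
Proof.
move=> hu hv B; have -> : (fun x => v (u x) x) @^-1` B = \bigcup_k
    (if unpickle k is Some c then (u @^-1` [set c]) `&` (v c @^-1` B) else set0).
  apply/seteqP; split=> x /=.
    by move=> Bx; exists (pickle (u x)) => //; rewrite pickleK.
  by case=> k _; case: unpickle => // c [/= <-].
apply: bigcupT_measurable => k; case: unpickle => [c|]; last exact: measurable0.
by apply: measurableI; [exact: hu|exact: hv].
Qed.

Lemma dm_comp2 (C : countType) (V W : Type) (g : C -> V -> W) (u : T -> C) (v : T -> V) :
  dm u -> dm v -> dm (fun x => g (u x) (v x)).
Proof.
move=> hu hv; apply: (@dm_bind C W u (fun c x => g c (v x))) => // c.
exact: dm_comp.
Qed.

(** For statistics of finite data it is enough to know on which data they depend. *)
Lemma dm_factor (U V : Type) (u : T -> U) (v : T -> V) : dm u ->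
  (forall x x', u x = u x' -> v x = v x') -> dm v.
Proof.
move=> hu h B; rewrite (_ : v @^-1` B = u @^-1` (u @` (v @^-1` B))); first exact: hu.
apply/seteqP; split=> x /= hx; first by exists x.
by case: hx => x' Bx' /h e; rewrite -e.
Qed.

Lemma dm_Prop (P : T -> Prop) : measurable [set x | P x] <-> dm P.
Proof.
split=> h; last by rewrite (_ : mkset P = P @^-1` [set True]) //;
  apply/seteqP; split=> x /=; [move=> Px; apply/propext|move=> ->].
apply: (@dm_ext _ (fun x => is_true `[<P x>])).
  by move=> x; apply/propext; split => /asboolP.
apply: dm_comp; apply: dm_fibers => -[].
  by rewrite (_ : _ @^-1` _ = [set x | P x]) //; apply/seteqP; split=> x /= /asboolP.
rewrite (_ : _ @^-1` _ = ~` [set x | P x]); first exact: measurableC.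
by apply/seteqP; split=> x /= => [/asboolP//|/asboolF].
Qed.

Lemma dm_measurable (P : T -> Prop) : dm P -> measurable [set x | P x].
Proof. by move/dm_Prop. Qed.

Lemma dm_all (P : nat -> T -> Prop) : (forall n, dm (P n)) -> dm (fun x => forall n, P n x).
Proof.
move=> h; apply/dm_Prop; rewrite (_ : mkset _ = \bigcap_n [set x | P n x]).
  by apply: bigcapT_measurable => n; exact/dm_Prop.
by apply/seteqP; split=> [x hx n _|x hx n]; exact: hx.
Qed.

Lemma dm_and (P Q : T -> Prop) : dm P -> dm Q -> dm (fun x => P x /\ Q x).
Proof. by move=> /dm_Prop hP /dm_Prop hQ; apply/dm_Prop; exact: measurableI. Qed.

Lemma dm_imp (P Q : T -> Prop) : dm P -> dm Q -> dm (fun x => P x -> Q x).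
Proof.
move=> /dm_Prop hP /dm_Prop hQ; apply/dm_Prop.
rewrite (_ : mkset _ = ~` [set x | P x] `|` [set x | Q x]).
  by apply: measurableU => //; exact: measurableC.
apply/seteqP; split=> x /=; last by case.
by move=> h; case: (pselect (P x)) => [/h|]; [right|left].
Qed.

Lemma dm_not (P : T -> Prop) : dm P -> dm (fun x => ~ P x).
Proof. by move=> hP; apply: dm_imp => //; exact: dm_cst. Qed.

Lemma dm_ex (P : nat -> T -> Prop) : (forall n, dm (P n)) -> dm (fun x => exists n, P n x).
Proof.
move=> h; apply/dm_Prop; rewrite (_ : mkset _ = \bigcup_n [set x | P n x]).
  by apply: bigcupT_measurable => n; exact/dm_Prop.
by apply/seteqP; split=> x /= [n]; [exists n|exists n].
Qed.

Lemma dm_minN (S : T -> set nat) : (forall n, dm (fun x => S x n)) ->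
  dm (fun x => minN (S x)).
Proof.
move=> h; apply: dm_fibers => m.
(* The second alternative is the default value 0 of [minN] on the empty set. *)
rewrite (_ : _ @^-1` _ = [set x | (S x m /\ forall k, (k < m)%N -> ~ S x k) \/
   (m = 0%N /\ forall k, ~ S x k)]).
  apply: (@measurableU _ _ [set x | _] [set x | _]); apply: dm_measurable.
    apply: dm_and => //; apply: dm_all => k; apply: dm_imp; first exact: dm_cst.
    exact: dm_not.
  by apply: dm_and; [exact: dm_cst|apply: dm_all => k; exact: dm_not].
apply/seteqP; split=> x /=.
  case: (pselect (exists n, S x n)) => hx e.
    have [h1 h2] := minN_spec hx; left; rewrite -e; split=> // k km /h2.
    by rewrite leqNgt km.
  by right; rewrite -e minN_none //; split=> // k Sk; apply: hx; exists k.
case=> [[h1 h2]|[-> h2]]; last by apply: minN_none => -[n /h2].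
by apply: minN_eq => // k Sk; rewrite leqNgt; apply/negP => /h2.
Qed.

Lemma dm_measurable_fun d' (V : measurableType d') (v : T -> V) D : dm v -> measurable_fun D v.
Proof. by move=> h mD B mB; apply: measurableI => //; exact: h. Qed.

End DiscretelyMeasurable.

Section PathMeasurable.
Context (A : countType) (a0 : A).
Notation path := (pathT int A a0).

Lemma dm_coord (I : Type) (i : I) : dm (fun x : pathT I A a0 => x i).
Proof. by apply: dm_fibers => a; apply: sub_sigma_algebra; exists i, a. Qed.

Lemma dm_recent d (S : measurableType d) (y : S -> nat -> A) k :
  (forall i, dm (fun x => y x i)) -> dm (fun x => recent (y x) k).
Proof.
move=> h; elim: k => [|k ih]; first exact: dm_cst.
apply: (@dm_ext _ _ _ (fun x => y x k :: recent (y x) k)).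
  by move=> x; rewrite recentS.
exact: dm_comp2.
Qed.

Lemma dm_recent_pa (t : int) k : dm (fun x : path => recent (pa x t) k).
Proof. by apply: dm_recent => // i; exact: dm_coord. Qed.

Definition shiftz (n : int) (x : int -> A) : int -> A := fun i => x (i + n).

Lemma measurable_shiftz (n : int) : measurable_fun setT (shiftz n : path -> path).
Proof.
apply: (@measurability _ _ path path _ _ [set B : set (int -> A) | exists i a, B = [set x | x i = a]]) => // _ [_ [i [a ->]] <-].
rewrite setTI.
exact: (dm_coord (i + n) [set a]).
Qed.

Lemma dm_shiftz (V : Type) (v : path -> V) n : dm v -> dm (fun x : path => v (shiftz n x)).
Proof. by move=> h B; have := measurable_shiftz n measurableT (h B); rewrite setTI. Qed.

Lemma pa_shiftz x (n t : int) : pa (shiftz n x) t = pa x (t + n).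
Proof. by apply/funext => i; rewrite /pa /shiftz; congr x; lia. Qed.

Lemma shiftzD m n x : shiftz m (shiftz n x) = shiftz (m + n) x.
Proof. by apply/funext => i; rewrite /shiftz; congr x; lia. Qed.

Lemma shiftz0 x : shiftz 0 x = x.
Proof. by apply/funext => i; rewrite /shiftz addr0. Qed.

Section Stopping.
Context (R : realType) (l : nat -> nat) (beta gamma : R).

Lemma dm_ret k z : dm (fun x : path => ret k x z).
Proof.
apply: dm_minN => t /=; apply: dm_and; first exact: dm_cst.
by apply: (@dm_comp2 _ _ _ _ _ (fun u v => u = v)); exact: dm_recent_pa.
Qed.

Lemma dm_zeta n : dm (fun x : path => zeta l x n).
Proof.
elim: n => [|n ih]; first exact: dm_cst.
apply: (@dm_ext _ _ _ (fun x : path => (zeta l x n + ret (l n.+1) x (zeta l x n))%N)).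
  by move=> x; rewrite zetaS.
apply: (@dm_bind _ _ _ _ (fun x : path => zeta l x n) (fun z (x : path) => (z + ret (l n.+1) x z)%N)) => // z.
by apply: dm_comp; exact: dm_ret.
Qed.

Lemma dm_Xtilde i : dm (fun x : path => Xtilde l x i).
Proof.
apply: (@dm_bind _ _ _ _ (fun x : path => zeta l x (Jindex l i)) (fun z (x : path) => x (z%:Z - i%:Z))); first exact: dm_zeta.
by move=> z; exact: dm_coord.
Qed.

Lemma dm_Delta n k : dm (fun x : path => Delta l gamma x n k).
Proof.
pose u (x : path) := (recent (pa x n) n.+1,
  ((zeta l x (Jindex l k) <= (uphalf n).-1)%N, recent (Xtilde l x) k)).
apply: (@dm_factor _ _ _ _ u).
  apply: dm_comp2; first exact: dm_recent_pa.
  apply: dm_comp2; last by apply: dm_recent => // i; exact: dm_Xtilde.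
  apply: (@dm_comp _ _ _ _ (fun z : nat => (z <= (uphalf n).-1)%N)); exact: dm_zeta.
by move=> x x' [/agree_recentP h1 h2 h3]; exact: Delta_ext.
Qed.

Lemma dm_chi n : dm (fun x : path => chi l beta gamma x n).
Proof.
case: n => [|n]; first exact: dm_cst.
apply: dm_minN => k /=; apply: dm_and; first exact: dm_cst.
by apply: (@dm_comp _ _ _ _ (fun v => is_true (v <= n.+1%:R `^ (- beta)))); exact: dm_Delta.
Qed.

Lemma dm_lambda n : dm (fun x : path => lambda l beta gamma x n).
Proof.
elim: n => [|n ih]; first exact: dm_cst.
rewrite /=.
apply: (@dm_bind _ _ _ _ (fun x : path => lambda l beta gamma x n) (fun m (x : path) =>
  let j := minN [set j | (zeta l x j <= m < zeta l x j.+1)%N] in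
    minN [set t | (m < t)%N /\
      str x (t%:Z - (chi l beta gamma x t)%:Z + 1) t%:Z =
      str x ((zeta l x j)%:Z - (chi l beta gamma x t)%:Z + 1) (zeta l x j)%:Z])) => // m.
apply: (@dm_bind _ _ _ _ (fun x : path => minN [set j | (zeta l x j <= m < zeta l x j.+1)%N])
  (fun j (x : path) => minN [set t | (m < t)%N /\
      str x (t%:Z - (chi l beta gamma x t)%:Z + 1) t%:Z =
      str x ((zeta l x j)%:Z - (chi l beta gamma x t)%:Z + 1) (zeta l x j)%:Z])).
  apply: dm_minN => j; apply: (@dm_comp2 _ _ _ _ _ (fun a b => is_true (a <= m < b)%N));
  exact: dm_zeta.
move=> j; apply: dm_minN => t; apply: dm_and; first exact: dm_cst.
apply: (@dm_bind _ _ _ _ (fun x : path => chi l beta gamma x t) (fun c (x : path) =>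
  str x (t%:Z - c%:Z + 1) t%:Z = str x ((zeta l x j)%:Z - c%:Z + 1) (zeta l x j)%:Z)).
  exact: dm_chi.
move=> c; apply: (@dm_bind _ _ _ _ (fun x : path => zeta l x j) (fun z (x : path) =>
  str x (t%:Z - c%:Z + 1) t%:Z = str x (z%:Z - c%:Z + 1) z%:Z)).
  exact: dm_zeta.
move=> z; apply: (@dm_ext _ _ _ (fun x : path => recent (pa x t) c = recent (pa x z) c)).
  by move=> x; rewrite !str_recent.
by apply: (@dm_comp2 _ _ _ _ _ (fun u v => u = v)); exact: dm_recent_pa.
Qed.

End Stopping.
End PathMeasurable.

(** * Almost sure statements and a quantitative Borel-Cantelli lemma *)

Section ProbabilityGeneral.
Context d (T : measurableType d) (R : realType) (mu : probability T R).

Lemma le_mu (B C : set T) : measurable B -> measurable C -> B `<=` C -> (mu B <= mu C)%E.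
Proof. by move=> mB mC h; apply: le_measure => //; rewrite inE. Qed.

Lemma ae_null (N : set T) (Q : T -> Prop) : measurable N -> mu N = 0%E ->
  (forall x, ~ N x -> Q x) -> {ae mu, forall x, Q x}.
Proof.
move=> mN N0 h; exists N; split=> // x /= nQ; apply: contrapT => nN; apply: nQ; exact: h.
Qed.

Lemma ae_null_inv (Q : T -> Prop) : {ae mu, forall x, Q x} ->
  exists N : set T, [/\ measurable N, mu N = 0%E & forall x, ~ N x -> Q x].
Proof.
move=> [N [mN N0 h]]; exists N; split=> // x nN; apply: contrapT => nQ; exact: nN (h _ nQ).
Qed.

Lemma ae_imp (Q Q' : T -> Prop) : (forall x, Q x -> Q' x) ->
  {ae mu, forall x, Q x} -> {ae mu, forall x, Q' x}.
Proof.
by move=> h /ae_null_inv[N [mN N0 hN]]; apply: (ae_null mN N0) => x /hN /h.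
Qed.

Lemma ae_and (Q Q' : T -> Prop) :
  {ae mu, forall x, Q x} -> {ae mu, forall x, Q' x} -> {ae mu, forall x, Q x /\ Q' x}.
Proof.
by move=> h1 h2; exact: (filterI h1 h2).
Qed.

Lemma ae_countable (C : countType) (Q : C -> T -> Prop) :
  (forall c, {ae mu, forall x, Q c x}) -> {ae mu, forall x, forall c, Q c x}.
Proof.
move=> h; have : {ae mu, forall x, forall n, if unpickle n is Some c then Q c x else True}.
  apply: ae_foralln => n; case: unpickle => [c|]; first exact: h.
  by apply: (@ae_null set0).
by apply: ae_imp => x hx c; have := hx (pickle c); rewrite pickleK.
Qed.

Lemma ae_nonempty (Q : T -> Prop) : {ae mu, forall x, Q x} -> exists x, Q x.
Proof.
move=> /ae_null_inv[N [mN N0 hN]]; apply: contrapT => h.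
have NT : N = setT.
  by apply/seteqP; split=> // x _; apply: contrapT => /hN ?; apply: h; exists x.
by move: N0; rewrite NT probability_setT => /eqP; rewrite onee_eq0.
Qed.

Lemma ae_prob1 (B : set T) : measurable B -> {ae mu, forall x, B x} <-> mu B = 1%E.
Proof.
move=> mB; split.
  move=> /ae_null_inv[N [mN N0 hN]]; apply/eqP; rewrite eq_le probability_le1 //=.
  have : (mu (~` N) <= mu B)%E by apply: le_mu; [exact: measurableC|by []|exact: hN].
  by rewrite probability_setC // N0 sube0.
move=> h; apply: (@ae_null (~` B)); first exact: measurableC.
  by rewrite probability_setC // h subee.
by move=> x /contrapT.
Qed.

Lemma sum_inv_sq (N : nat) : \sum_(0 <= n < N) (n.+1%:R ^+ 2)^-1 <= 2 :> R.
Proof.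
(* The sharper bound telescopes, since (r + 1)^-2 <= 1/r - 1/(r + 1). *)
suff h : \sum_(0 <= n < N.+1) (n.+1%:R ^+ 2)^-1 <= 2 - N.+1%:R^-1 :> R.
  apply: (@le_trans _ _ (\sum_(0 <= n < N.+1) (n.+1%:R ^+ 2)^-1)).
    by rewrite [leRHS]big_nat_recr //= lerDl invr_ge0 sqr_ge0.
  by apply: le_trans h _; rewrite gerBl invr_ge0.
elim: N => [|N ih]; first by rewrite big_nat1 expr1n invr1; lra.
rewrite big_nat_recr //=; apply: le_trans (lerD ih (lexx _)) _.
have h1 : (0 : R) < N.+1%:R by rewrite ltr0n.
have -> : N.+2%:R = N.+1%:R + 1 :> R by rewrite -natr1.
move: (N.+1%:R : R) h1 => r r0.
have e : r^-1 - (r + 1)^-1 = (r * (r + 1))^-1 by field; apply/andP; split; lra.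
suff : ((r + 1) ^+ 2)^-1 <= (r * (r + 1))^-1 by move: e; lra.
rewrite lef_pV2 ?posrE; [|by nra|by nra]; nra.
Qed.

Lemma Borel_Cantelli_sq (F : (set T)^nat) (C : R) : (forall n, measurable (F n)) ->
  (forall n, (mu (F n) <= (C / n.+1%:R ^+ 2)%:E)%E) ->
  {ae mu, forall x, exists N, forall n, (N <= n)%N -> ~ F n x}.
Proof.
move=> mF h; have hC n : 0 <= C / n.+1%:R ^+ 2.
  by rewrite -lee_fin; apply: le_trans (h n).
have C0 : 0 <= C by have := hC 0%N; rewrite expr1n divr1.
apply: (@ae_null (lim_sup_set F)) => [| |x].
- apply: bigcapT_measurable => n; apply: bigcup_measurable => *; exact: mF.
- apply: lim_sup_set_cvg0 => //.
  apply: (@le_lt_trans _ _ (C * 2)%:E); last exact: ltry.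
  apply: lime_le; first by apply: is_cvg_nneseries => *; exact: measure_ge0.
  apply: nearW => N.
  apply: (@le_trans _ _ (\sum_(0 <= n < N) (C / n.+1%:R ^+ 2)%:E)%E).
    by apply: lee_sum => i _; exact: h.
  rewrite sumEFin lee_fin -mulr_sumr; apply: ler_wpM2l => //; exact: sum_inv_sq.
- move=> hx; apply: contrapT => hn; apply: hx => N _ /=.
  apply: contrapT => hN; apply: hn; exists N => n Nn Fn; apply: hN; by exists n.
Qed.

Lemma mu_fin (B : set T) : measurable B -> mu B = (fine (mu B))%:E.
Proof. by move=> mB; rewrite fineK // fin_num_measure. Qed.

Lemma mu_fine_ge0 (B : set T) : 0 <= fine (mu B).
Proof. exact: fine_ge0 (measure_ge0 _ _). Qed.

End ProbabilityGeneral.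

Lemma ae_preserving d d' (T : measurableType d) (T' : measurableType d') (R : realType)
  (mu : probability T R) (nu : probability T' R) (g : T -> T') (Q : T' -> Prop) :
  (forall B, measurable B -> measurable (g @^-1` B) /\ mu (g @^-1` B) = nu B) ->
  {ae nu, forall x, Q x} -> {ae mu, forall x, Q (g x)}.
Proof.
move=> h /ae_null_inv[N [mN N0 hN]]; have [m1 m2] := h _ mN.
by apply: (ae_null m1); [rewrite m2|move=> x /hN].
Qed.

(** * Stationarity, Kac's inequality and the law of Xtilde *)

Lemma measureU_null d (T : measurableType d) (R : realType) (mu : probability T R) (N E : set T) :
  measurable N -> measurable E -> mu N = 0%E -> (mu (N `|` E) <= mu E)%E.
Proof.
move=> mN mE N0; apply: le_trans (measureU2 _ mN mE) _.
by move: N0; rewrite -[X in (_ <= X)%E]add0e /= => ->.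
Qed.

Lemma mu_bigcup d (T : measurableType d) (R : realType) (mu : probability T R) (F : (set T)^nat) :
  (forall t, measurable (F t)) -> trivIset setT F ->
  mu (\bigcup_t F t) = (\sum_(0 <= t <oo) mu (F t))%E.
Proof.
move=> mF tF; have := measure_semi_sigma_additive (s := mu) _ mF tF (bigcupT_measurable _ mF).
by move/cvg_lim => <-.
Qed.

Lemma mu_ae_eq d (T : measurableType d) (R : realType) (mu : probability T R) (B C : set T) :
  measurable B -> measurable C -> {ae mu, forall x, B x <-> C x} -> mu B = mu C.
Proof.
move=> mB mC /ae_null_inv[N [mN N0 hN]].
have h (D E : set T) : measurable D -> measurable E -> (forall x, ~ N x -> D x -> E x) ->
    (mu D <= mu E)%E.
  move=> mD mE hDE; apply: (@le_trans _ _ (mu (N `|` E))).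
    apply: le_mu => //; first exact: measurableU.
    by move=> x Dx; case: (pselect (N x)) => [|/hDE]; [left|right; auto].
  exact: measureU_null.
by apply/eqP; rewrite eq_le !h // => x /hN hx /hx.
Qed.

Section StationaryPaths.
Context (A : countType) (a0 : A) (R : realType).
Notation path := (pathT int A a0).
Context (mu : probability path R).
Hypothesis stat : forall B : set path, measurable B -> mu (shiftz 1 @^-1` B) = mu B.

Lemma measurable_shiftP (n : int) (B : set path) : measurable B ->
  measurable (shiftz n @^-1` B : set path).
Proof. by move=> mB; have := measurable_shiftz (a0 := a0) n measurableT mB; rewrite setTI. Qed.

Lemma shiftz_preimageD m n (B : set path) :
  shiftz n @^-1` (shiftz m @^-1` B) = shiftz (m + n) @^-1` B.
Proof. by apply/seteqP; split=> x /=; rewrite shiftzD. Qed.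

Lemma stat_nat (n : nat) (B : set path) : measurable B -> mu (shiftz n%:Z @^-1` B) = mu B.
Proof.
move=> mB; elim: n => [|n ih].
  by congr (mu _); apply/seteqP; split=> x /=; rewrite shiftz0.
rewrite -ih -(stat (measurable_shiftP n mB)) shiftz_preimageD.
by have -> : n.+1%:Z = n%:Z + 1 by lia.
Qed.

Lemma stat_int (n : int) (B : set path) : measurable B -> mu (shiftz n @^-1` B) = mu B.
Proof.
case: n => n mB; first exact: stat_nat.
rewrite -(stat_nat n.+1 (measurable_shiftP _ mB)) shiftz_preimageD.
congr (mu _); apply/seteqP; split=> x /=; by rewrite NegzE addNr shiftz0.
Qed.

(** The m shifted copies have equal measure by stationarity and are disjoint, so their total mass is
    at most 1. *)
Lemma disjoint_shifts (N : set path) (m : nat) : measurable N ->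
  (forall i j : nat, (i < j < m)%N -> forall x, N (shiftz i x) -> ~ N (shiftz j x)) ->
  (m%:R%:E * mu N <= 1)%E.
Proof.
move=> mN h.
pose F (i : nat) : set path := if (i < m)%N then shiftz i @^-1` N else set0.
have mF i : measurable (F i) by rewrite /F; case: ifP => // _; exact: measurable_shiftP.
have tF : trivIset setT F.
  have key i j x : (i < j)%N -> F i x -> F j x -> False.
    rewrite /F => ij; case: ifP => // im; case: ifP => // jm /= h1.
    by apply: h h1; rewrite ij.
  apply/trivIsetP => i j _ _ ij; apply/seteqP; split=> x //= -[fi fj].
  by move: ij; rewrite neq_ltn => /orP[/key|/key]; [apply; [exact: fi|exact: fj]|apply; [exact: fj|exact: fi]].
have : (mu (\big[setU/set0]_(i < m) F i) <= 1)%E.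
  by apply: probability_le1; apply: bigsetU_measurable => i _; exact: mF.
have [v e] : exists v, mu N = v%:E by exists (fine (mu N)); exact: mu_fin.
rewrite measure_bigsetU // (eq_bigr (fun=> v%:E)); last first.
  by move=> i _; rewrite -e; have := stat_nat i mN; rewrite /F ltn_ord.
by rewrite e sumEFin sumr_const card_ord -EFinM mulr_natl.
Qed.

Lemma dm_recent_eq t k s : dm (fun x : path => recent (pa x t) k = s).
Proof. by apply: (@dm_comp _ _ _ _ (fun u => u = s)); exact: dm_recent_pa. Qed.

Definition block (s : seq A) (t : int) : set path := [set x | recent (pa x t) (size s) = s].

Lemma measurable_block s t : measurable (block s t).
Proof.
by apply: dm_measurable; exact: dm_recent_eq.
Qed.

(* Kac's inequality. *)
Lemma first_return_tail (s : seq A) (m : nat) :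
  (m.+1%:R%:E * mu [set x | recent (pa x 0) (size s) = s /\
     forall t : nat, (0 < t <= m)%N -> recent (pa x t) (size s) <> s] <= 1)%E.
Proof.
apply: disjoint_shifts.
  apply: dm_measurable; apply: dm_and; first exact: dm_recent_eq.
  apply: dm_all => t; apply: dm_imp; first exact: dm_cst.
  apply: dm_not; exact: dm_recent_eq.
move=> i j /andP[ij jm] x /= [_ h] [e _]; apply: (h (j - i)%N); first by rewrite subn_gt0 ij /=; lia.
by rewrite -[RHS]e !pa_shiftz; congr (recent (pa x _) _); lia.
Qed.

(** The paths on which the block s never returns satisfy Kac's inequality for every m, hence form a
    null set. *)
Lemma recurrence (k : nat) : {ae mu, forall x, returns k x 0}.
Proof.
suff : {ae mu, forall x, forall s : seq A, recent (pa x 0) k = s -> returns k x 0}.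
  by apply: ae_imp => x h; apply: (h _ erefl).
apply: ae_countable => s.
case: (eqVneq (size s) k) => sk; last first.
  by apply: (@ae_null _ _ _ _ set0) => // x _ e; move: sk; rewrite -e size_recent eqxx.
have mN : measurable [set x : path | recent (pa x 0) (size s) = s /\ ~ returns k x 0].
  apply: dm_measurable; apply: dm_and; first exact: dm_recent_eq.
  apply: dm_not; apply: dm_ex => t; apply: dm_and; first exact: dm_cst.
  apply: (@dm_comp2 _ _ _ _ _ (fun u v => u = v)); exact: dm_recent_pa.
apply: (@ae_null _ _ _ _ _ _ mN).
  apply/eqP; rewrite eq_le measure_ge0 andbT.
  rewrite (mu_fin _ mN) lee_fin; apply/ler_addgt0Pr => e e0; rewrite add0r.
  set v := fine _; pose m := Num.bound e^-1.
  have hm : e^-1 < m.+1%:R.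
    apply: lt_trans (archi_boundP _) _; first by rewrite invr_ge0 ltW.
    by rewrite ltr_nat.
  have h : (m.+1%:R%:E * v%:E <= 1)%E.
    apply: le_trans (first_return_tail s m); apply: lee_pmul => //.
      by rewrite lee_fin fine_ge0.
    rewrite /v -(mu_fin _ mN); apply: le_mu => //.
      apply: dm_measurable; apply: dm_and; first exact: dm_recent_eq.
      apply: dm_all => t; apply: dm_imp; first exact: dm_cst.
      apply: dm_not; exact: dm_recent_eq.
    move=> x /= [h1 h2]; split=> // t /andP[t0 _] et; apply: h2; exists t; split=> //.
    by rewrite add0n -sk et h1.
  move: h; rewrite -EFinM lee_fin => h.
  have m0 : (0 : R) < m.+1%:R by rewrite ltr0n.
  rewrite -(ler_pM2l m0); apply: le_trans h _.
  by rewrite -ler_pdivrMr // div1r ltW.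
move=> x /= h e; apply: contrapT => nr; apply: h; split=> //; by rewrite sk.
Qed.

Definition return_map (k : nat) (x : path) : path := shiftz (ret k x 0) x.

Lemma measurable_time_shift (z : path -> nat) (B : set path) : dm z -> measurable B ->
  measurable [set x : path | B (shiftz (z x) x)].
Proof.
move=> hz mB; apply: dm_measurable.
apply: (@dm_bind _ _ _ _ z (fun n (x : path) => B (shiftz n x))) => // n.
apply/(dm_Prop (fun x : path => B (shiftz n x))); exact: measurable_shiftP.
Qed.

(** A point reached after r + 1 steps sees its last earlier visit exactly r + 1 steps back. Up to
    the null set without return, the preimage of a set is therefore covered by shifts of pieces of
    that set which are disjoint before being shifted. *)
Lemma return_map_preserves k (B : set path) : measurable B ->
  measurable (return_map k @^-1` B) /\ mu (return_map k @^-1` B) = mu B.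
Proof.
have mR (C : set path) : measurable C -> measurable (return_map k @^-1` C).
  by move=> mC; apply: (@measurable_time_shift (fun x => ret k x 0)) => //; exact: dm_ret.
move=> mB; split; first exact: mR.
(* One inequality, applied to a set and to its complement, gives equality because the total mass is
   1. *)
suff h (C : set path) : measurable C -> (mu (return_map k @^-1` C) <= mu C)%E.
  apply/eqP; rewrite eq_le h //=.
  have := h _ (measurableC mB); rewrite -preimage_setC !probability_setC //; last exact: mR.
  rewrite (mu_fin _ mB) (mu_fin _ (mR _ mB)) -!EFinB !lee_fin; lra.
move=> {}mB; rename C into B'; rename mB into mC.
(* y in D t iff the last visit before time 0 of the current block is at time -t-1 *)
pose D (t : nat) : set path := [set y | recent (pa y (- t.+1%:Z)) k = recent (pa y 0) k /\
  forall j : nat, (j < t)%N -> recent (pa y (- j.+1%:Z)) k <> recent (pa y 0) k].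
have dE (t t' : int) : dm (fun x : path => recent (pa x t) k = recent (pa x t') k).
  apply: (@dm_comp2 _ _ _ _ _ (fun u v => u = v)); exact: dm_recent_pa.
have mD t : measurable (D t).
  apply: dm_measurable; apply: dm_and => //.
  by apply: dm_all => j; apply: dm_imp; [exact: dm_cst|apply: dm_not].
have tD : trivIset setT (fun t => D t `&` B').
  have key i j y : (i < j)%N -> D i y -> D j y -> False.
    by move=> ij [e _] [_ h]; exact: h ij e.
  apply/trivIsetP => i j _ _ ij; apply/seteqP; split=> x //= -[[fi _] [fj _]].
  by move: ij; rewrite neq_ltn => /orP[/key|/key]; [apply; [exact: fi|exact: fj]|apply; [exact: fj|exact: fi]].
have [N [mN N0 hN]] := ae_null_inv (recurrence k).
have mU : measurable (\bigcup_t (D t `&` B')).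
  by apply: bigcupT_measurable => t; exact: measurableI.
have mF (t : nat) : measurable (shiftz t.+1%:Z @^-1` (D t `&` B') : set path).
  by apply: measurable_shiftP; exact: measurableI.
pose F (t : nat) : set path := shiftz t.+1%:Z @^-1` (D t `&` B').
have mUF : measurable (\bigcup_t F t) by exact: bigcupT_measurable.
apply: (@le_trans _ _ (mu (N `|` \bigcup_t F t))).
  apply: le_mu; [exact: mR|exact: measurableU|].
  move=> x /= Bx; case: (pselect (N x)) => [Nx|/hN rx]; [by left|right].
  have [[r0 re] rmin] := minN_spec rx; rewrite -/(ret k x 0) in r0 re rmin.
  move: Bx; rewrite /return_map; case: (ret k x 0) r0 re rmin => // r _ re rmin Bx.
  exists r => //=; split=> //; split.
    by rewrite !pa_shiftz addNr add0r; move: re; rewrite add0n => ->.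
  move=> j jr; rewrite !pa_shiftz add0r => e.
  (* A visit strictly in between would be a return earlier than the first one. *)
  have : (r.+1 <= r.+1 - j.+1)%N; last by lia.
  apply: rmin; rewrite /= subn_gt0 ltnS jr; split=> //.
  rewrite add0n; apply: etrans re; rewrite add0n -e; congr (recent (pa x _) _); lia.
apply: (le_trans (measureU_null mN mUF N0)).
apply: (@le_trans _ _ (\sum_(0 <= t <oo) mu (F t))%E).
  exact: measure_sigma_subadditive.
rewrite (eq_eseriesr (g := fun t => mu (D t `&` B'))); last first.
  by move=> t _; apply: (stat_nat t.+1); exact: measurableI.
rewrite -mu_bigcup //; last by move=> t; exact: measurableI.
by apply: le_mu => // x [t _ []].
Qed.

Section Zeta.
Context (l : nat -> nat).

Definition zeta_map n (x : path) : path := shiftz (zeta l x n) x.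

Lemma ret_shiftz k (x : path) (z : nat) : ret k (shiftz z x) 0 = ret k x z.
Proof.
apply: minN_ext => t /=; rewrite add0n !pa_shiftz add0r.
by have -> : t%:Z + z%:Z = (z + t)%N%:Z by lia.
Qed.

Lemma returns_shiftz k (x : path) (z : nat) : returns k (shiftz z x) 0 <-> returns k x z.
Proof.
by split=> -[t [t0 h]]; exists t; split=> //; move: h; rewrite add0n !pa_shiftz add0r;
  have -> : t%:Z + z%:Z = (z + t)%N%:Z by lia.
Qed.

Lemma zeta_map_preserves n (B : set path) : measurable B ->
  measurable (zeta_map n @^-1` B) /\ mu (zeta_map n @^-1` B) = mu B.
Proof.
move=> mB; split; first by apply: measurable_time_shift => //; exact: dm_zeta.
elim: n B mB => [|n ih] B mB.
  by congr (mu _); apply/seteqP; split=> x /=; rewrite /zeta_map /= shiftz0.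
have [m1 <-] := return_map_preserves (l n.+1) mB.
rewrite -(ih _ m1); congr (mu _); rewrite -comp_preimage.
suff -> : zeta_map n.+1 = return_map (l n.+1) \o zeta_map n by [].
apply/funext => x; rewrite /= /return_map /zeta_map ret_shiftz shiftzD zetaS.
by congr (shiftz _ x); lia.
Qed.

Lemma ae_good : {ae mu, forall x, good l x}.
Proof.
apply: ae_foralln => n; apply: (@ae_imp _ _ _ _ (fun x => returns (l n.+1) (zeta_map n x) 0)).
  by move=> x /returns_shiftz.
by apply: ae_preserving (recurrence _); exact: zeta_map_preserves.
Qed.

Hypothesis adm : admissible l.

(** The last k letters of Xtilde are those seen at the stopping time of index [J k], and the path
    seen from there has law [mu]. *)
Lemma Xtilde_block k (s : seq A) :
  mu [set x | recent (Xtilde l x) k = s] = mu [set x | recent (pa x 0) k = s].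
Proof.
have mB : measurable [set x : path | recent (pa x 0) k = s].
  by apply: dm_measurable; exact: dm_recent_eq.
have mC : measurable [set x : path | recent (Xtilde l x) k = s].
  apply: dm_measurable; apply: (@dm_comp _ _ _ _ (fun u => u = s)).
  by apply: dm_recent => i; exact: dm_Xtilde.
have [m1 <-] := zeta_map_preserves (Jindex l k) mB.
have [N [mN N0 hN]] := ae_null_inv ae_good.
have key x : good l x -> recent (pa (zeta_map (Jindex l k) x) 0) k = recent (Xtilde l x) k.
  move=> gx; rewrite /zeta_map pa_shiftz add0r; apply/recent_eqP => i ik.
  by apply: zeta_Xt_ge => //; apply: J_mono => //; exact: ltnW.
apply: mu_ae_eq => //; apply: ae_imp ae_good => x gx /=; by rewrite key.
Qed.

Lemma Xtilde_law (B : set (pathT nat A a0)) : measurable B ->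
  [/\ measurable (Xtilde l @^-1` B : set path), measurable ((fun x => pa x 0) @^-1` B : set path) &
  mu (Xtilde l @^-1` B) = mu ((fun x => pa x 0) @^-1` B)].
Proof.
have mf (u : path -> nat -> A) : (forall i, dm (fun x => u x i)) ->
    measurable_fun setT (u : path -> pathT nat A a0).
  move=> h; apply: (@measurability _ _ path (pathT nat A a0) _ _
    [set B : set (nat -> A) | exists i a, B = [set x | x i = a]]) => // _ [_ [i [a ->]] <-].
  by rewrite setTI; exact: (h i [set a]).
have m1 : measurable_fun setT (Xtilde l : path -> pathT nat A a0).
  by apply: mf => i; exact: dm_Xtilde.
have m2 : measurable_fun setT ((fun x => pa x 0) : path -> pathT nat A a0).
  by apply: mf => i; exact: dm_coord.
move=> mB; split; [by have := m1 measurableT _ mB; rewrite setTI|by have := m2 measurableT _ mB; rewrite setTI|].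
pose G := [set B : set (pathT nat A a0) | B = set0 \/ exists k s, B = [set y | recent y k = s]].
apply: (@g_sigma_algebra_measure_unique _ R (pathT nat A a0) G _ (fun=> setT) _ _
   (measure_function_pushforward__canonical__measure_function_Measure mu m1)
   (measure_function_pushforward__canonical__measure_function_Measure mu m2)) => //.
- move=> _ [->|[k [s ->]]] //; apply: dm_measurable.
  apply: (@dm_comp _ _ _ _ (fun u => u = s)).
  by apply: dm_recent => // i; exact: dm_coord.
- by move=> _; right; exists 0%N, [::]; apply/seteqP; split.
- by rewrite bigcup_const.
(* Two strings ending at time 0 are compatible only if one is a suffix of the other: the events are
   nested or disjoint, so they form a pi-system. *)
- move=> _ _ [->|[k [s ->]]] [->|[k' [s' ->]]]; rewrite ?set0I ?setI0; try by left.
  case: (pselect (exists y, recent y k = s /\ recent y k' = s')); last first.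
    move=> h; left; apply/seteqP; split=> y //= [e e']; apply: h; by exists y.
  move=> [y0 [e e']]; right; exists (maxn k k'), (recent y0 (maxn k k')).
  rewrite -e -e'; apply/seteqP; split=> y /=.
    by move=> [h h']; case: (leqP k k') => kk.
  by move=> h; split; apply: recent_leq h; lia.
- move=> _ [->|[k [s ->]]]; first by rewrite !measure0.
  exact: Xtilde_block.
- by move=> _; rewrite [X in (X < _)%E](_ : _ = 1%E) ?ltry //; exact: probability_setT.
- move: B mB; apply: smallest_sub; first exact: smallest_sigma_algebra.
  have [un unK] : exists un : nat -> option (seq A), forall s, exists n, un n = Some s.
    by exists unpickle => s; exists (pickle s); rewrite pickleK.
  move=> _ [i [a ->]].
  (* Fixing the letter at index i leaves countably many strings for the letters after it. *)
  rewrite (_ : mkset _ = \bigcup_n (if un n is Some s then [set y | recent y i.+1 = a :: s] else set0)).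
    apply: sigma_algebra_bigcup => n; apply: sub_sigma_algebra.
    by case: (un n) => [s|]; [right; exists i.+1, (a :: s)|left].
  apply/seteqP; split=> y /=.
    by move=> <-; have [n e] := unK (recent y i); exists n => //; rewrite e /= recentS.
  by case=> n _; case: (un n) => //= s; rewrite recentS => -[].
Qed.

End Zeta.
End StationaryPaths.

(** * The ergodic theorem *)

Section Ergodic.
Context (A : countType) (a0 : A) (R : realType).
Notation path := (pathT int A a0).
Context (mu : probability path R).
Hypothesis stat : forall B : set path, measurable B -> mu (shiftz 1 @^-1` B) = mu B.
Hypothesis erg : forall B : set path, measurable B -> shiftz 1 @^-1` B = B ->
  mu B = 0%E \/ mu B = 1%E.

Definition visits (B : set path) (x : path) (n : nat) : nat :=
  count (fun t : nat => `[< B (shiftz t x) >]) (iota 0 n).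

Lemma visitsD B x m n : visits B x (m + n) = (visits B x m + visits B (shiftz m x) n)%N.
Proof.
rewrite /visits iotaD count_cat add0n; congr addn.
rewrite -[X in iota X]addn0 iotaDl count_map; apply: eq_count => t /=.
by rewrite shiftzD; have -> : t%:Z + m%:Z = (m + t)%N%:Z by lia.
Qed.

Lemma visits1 B x : visits B x 1 = `[< B x >] :> nat.
Proof. by rewrite /visits /= shiftz0 addn0. Qed.

Lemma visits_le B x n : (visits B x n <= n)%N.
Proof. by rewrite -[leqRHS](size_iota 0 n) count_size. Qed.

Lemma visitsS B x n : visits B x n.+1 = (visits B x n + `[< B (shiftz n x) >])%N.
Proof. by rewrite -addn1 visitsD visits1. Qed.

Lemma visitsC B x n : visits (~` B) x n = (n - visits B x n)%N.
Proof.
elim: n => // n ih; rewrite !visitsS ih; have := visits_le B x n.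
by rewrite asbool_neg; case: asboolP => _; rewrite ?addn0 ?addn1 /=; lia.
Qed.

Lemma dm_visits B n : measurable B -> dm (fun x : path => visits B x n).
Proof.
move=> mB; elim: n => [|n ih]; first exact: dm_cst.
apply: (@dm_ext _ _ _ (fun x : path => (visits B x n + `[< B (shiftz n x) >])%N)).
  by move=> x; rewrite visitsS.
apply: (@dm_comp2 _ _ _ _ _ (fun u (v : Prop) => u + `[< v >])%N _ (fun x : path => B (shiftz n x))) => //.
apply/dm_Prop; exact: measurable_shiftP.
Qed.

Lemma expected_visits B n : measurable B ->
  (\int[mu]_x ((visits B x n)%:R : R)%:E = (n%:R * fine (mu B))%:E)%E.
Proof.
move=> mB; rewrite (eq_integral (fun x : path => \sum_(t < n) (\1_(shiftz t%:Z @^-1` B : set path) x)%:E)%E); last first.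
  move=> x _; rewrite sumEFin; congr EFin; elim: n => [|n ih]; first by rewrite big_ord0.
  rewrite visitsS natrD ih big_ord_recr /=; congr (_ + _).
rewrite ge0_integral_sum //; last first.
  move=> t; apply: dm_measurable_fun; apply: (@dm_comp _ _ _ _ EFin).
  apply: (@dm_ext _ _ _ (fun x : path => if `[< B (shiftz t x) >] then 1 else 0)).
    by move=> x; rewrite indicE; case: asboolP => h; [rewrite mem_set|rewrite memNset].
  apply: (@dm_comp _ _ _ _ (fun v : Prop => if `[< v >] then (1 : R) else 0)).
  apply/dm_Prop; exact: measurable_shiftP.
rewrite (eq_bigr (fun=> (fine (mu B))%:E)); last first.
  move=> t _; rewrite integral_indic ?setIT //; last exact: measurable_shiftP.
  rewrite -mu_fin //; exact: stat_nat.
by rewrite sumEFin sumr_const card_ord mulr_natl.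
Qed.

Lemma visits_lower_bound B n (c : R) : measurable B ->
  (forall x, c <= (visits B x n)%:R) -> c <= n%:R * fine (mu B).
Proof.
move=> mB h; case: (leP c 0) => c0.
  by apply: le_trans c0 _; rewrite mulr_ge0 // mu_fine_ge0.
rewrite -lee_fin -expected_visits //.
have -> : c%:E = (\int[mu]_x c%:E)%E by rewrite integral_cst // -[LHS]mule1; congr (_ * _)%E; exact/esym/probability_setT.
apply: ge0_le_integral => //.
- by move=> x _; rewrite lee_fin ltW.
- by apply: (@dm_measurable_fun _ _ _ (\bar R)); apply: (@dm_comp _ _ _ _ (fun k : nat => (k%:R : R)%:E)); exact: dm_visits.
- by move=> x _; rewrite lee_fin.
Qed.

(* The block argument of Katznelson and Weiss. *)
Lemma maximal_ergodic B (c : R) : measurable B -> 0 <= c <= 1 ->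
  {ae mu, forall x, exists2 n, (0 < n)%N & c * n%:R < (visits B x n)%:R} ->
  c <= fine (mu B).
Proof.
move=> mB /andP[c0 c1] hae.
(* Starting points from which no block of length at most m has a frequency of visits above c. *)
pose Bad (m : nat) := [set x : path | forall n, (0 < n <= m)%N -> (visits B x n)%:R <= c * n%:R].
have mBad m : measurable (Bad m).
  apply: dm_measurable; apply: dm_all => n; apply: dm_imp; first exact: dm_cst.
  by apply: (@dm_comp _ _ _ _ (fun k : nat => is_true (k%:R <= c * n%:R))); exact: dm_visits.
have Bad0 : mu (Bad m) @[m --> \oo] --> 0%E.
  have e0 : mu (\bigcap_n Bad n) = 0%E.
    have [N [mN N0 hN]] := ae_null_inv hae.
    apply/eqP; rewrite eq_le measure_ge0 andbT -N0; apply: le_mu => //.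
      exact: bigcapT_measurable.
    move=> x hx; apply: contrapT => /hN[n n0]; rewrite ltNge => /negP; apply.
    by apply: (hx n I); rewrite n0 leqnn.
  rewrite -[X in _ --> X]e0; apply: nonincreasing_cvg_mu => //.
  - by apply: (le_lt_trans (probability_le1 mu (mBad _))); exact: ltry.
  - exact: bigcapT_measurable.
  - move=> m n mn; apply/subsetPset => x hx k /andP[k0 km]; apply: hx.
    by rewrite k0 (leq_trans km).
apply/ler_addgt0Pr => e e0.
have [m hm] : exists m, fine (mu (Bad m)) < e.
  move/fine_cvgP : Bad0 => [_ /cvgrPdist_lt /(_ e e0)[m _ /(_ m (leqnn m))]].
  by rewrite /= sub0r normrN ger0_norm ?mu_fine_ge0 //; exists m.
(* Bad points are counted as visits: a block of length 1 at a bad point then has frequency 1, which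
   is at least c. *)
pose B' := B `|` Bad m.
have mB' : measurable B' by exact: measurableU.
(* Cut the first L times greedily into blocks of frequency at least c; only a remainder of length at
   most m is lost. *)
have key L : forall x, c * (L%:R - m%:R) <= (visits B' x L)%:R.
  have [n leL] := ubnP L; elim: n L leL => // n ih L leL x.
  case: (leqP L m) => Lm.
    by apply: (@le_trans _ _ 0) => //; rewrite mulr_ge0_le0 // subr_le0 ler_nat.
  case: (pselect (Bad m x)) => hx.
    case: L leL Lm => // L leL Lm; rewrite -add1n visitsD visits1 asboolT; last by right.
    have := ih L leL (shiftz 1 x); rewrite add1n -[L.+1%:R]natr1 natrD => h.
    by rewrite /=; nra.
  have [k [/andP[k0 km] hk]] : exists k, (0 < k <= m)%N /\ c * k%:R < (visits B x k)%:R.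
    apply: contrapT => hn; apply: hx => k km; rewrite leNgt; apply/negP => h.
    by apply: hn; exists k.
  have kL : (k <= L)%N := leq_trans km (ltnW Lm).
  rewrite -[in visits _ _ _](subnKC kL) visitsD natrD.
  have := ih (L - k)%N (_ : _ < n)%N (shiftz k x); rewrite natrB // => h.
  have : (visits B x k)%:R <= (visits B' x k)%:R :> R.
    by rewrite ler_nat; apply: sub_count => t /asboolP ?; apply/asboolP; left.
  have {}h := h (leq_ltn_trans (leq_sub2l L k0) _).
  have {}h : c * (L%:R - k%:R - m%:R) <= (visits B' (shiftz k x) (L - k))%:R.
    by apply: h; lia.
  by nra.
have hB' : fine (mu B') <= fine (mu B) + fine (mu (Bad m)).
  rewrite -lee_fin EFinD -!mu_fin //; exact: measureU2.
suff : c <= fine (mu B') by lra.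
apply/ler_addgt0Pr => e' e'0.
pose L := Num.bound (c * m%:R / e').
have L0 : (0 : R) < L%:R.
  by apply: le_lt_trans (archi_boundP _); rewrite ?divr_ge0 ?mulr_ge0 // ltW.
have hL : c * m%:R <= e' * L%:R.
  have h0 : 0 <= c * m%:R / e' by rewrite divr_ge0 ?mulr_ge0 // ltW.
  by have := archi_boundP h0; rewrite ltr_pdivrMr // => /ltW; rewrite [leRHS]mulrC.
have := visits_lower_bound mB' (key L).
move=> h; rewrite -(ler_pM2l L0); nra.
Qed.

(** Upper frequency strictly above c. The slack may depend on the path, which makes the set exactly
    shift invariant, as [erg] demands. *)
Definition often_above B (c : R) := [set x : path | exists q : nat, forall N : nat,
  exists n : nat, (N <= n)%N /\ (c + q.+1%:R^-1) * n%:R < (visits B x n)%:R].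

Lemma measurable_often_above B c : measurable B -> measurable (often_above B c).
Proof.
move=> mB; apply: dm_measurable; apply: dm_ex => q; apply: dm_all => N.
apply: dm_ex => n; apply: dm_and; first exact: dm_cst.
apply: (@dm_comp _ _ _ _ (fun k : nat => is_true ((c + q.+1%:R^-1) * n%:R < k%:R))).
exact: dm_visits.
Qed.

Lemma often_above_shift B c : shiftz 1 @^-1` (often_above B c) = often_above B c.
Proof.
have key x y : (forall n, `|(visits B x n)%:R - (visits B y n)%:R| <= 1 :> R) ->
    often_above B c x -> often_above B c y.
  (* The counts differ by at most 1. The slack is halved, and for n >= 2q + 2 the other half times n
     is at least 1. *)
  move=> hxy [q hq]; exists q.*2.+1 => N.
  have q0 : (0 : R) < q.+1%:R^-1 by rewrite invr_gt0.
  have [n [Nn hn]] := hq (maxn N (q.*2.+2)); exists n.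
  split; first by apply: leq_trans Nn; exact: leq_maxl.
  have e : (q.*2.+2%:R)^-1 = q.+1%:R^-1 / 2 :> R.
    by rewrite -doubleS -muln2 natrM invfM.
  have h1 : (q.*2.+2)%:R <= n%:R :> R by rewrite ler_nat; apply: leq_trans Nn; exact: leq_maxr.
  have h2 : 1 <= q.+1%:R^-1 / 2 * n%:R :> R.
    by rewrite -e mulrC -ler_pdivrMr // div1r invrK.
  have := hxy n; rewrite ler_norml => /andP[h3 h4].
  rewrite e; move: (q.+1%:R^-1 : R) (n%:R : R) hn h2 h3 h4 => v k; lra.
have d1 x n : `|(visits B (shiftz 1 x) n)%:R - (visits B x n)%:R| <= 1 :> R.
  have := visitsS B x n; rewrite -[in LHS]add1n visitsD visits1 => /(congr1 (fun k => k%:R : R)).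
  move: `[< B x >] `[< B (shiftz n x) >] => b1 b2; rewrite !natrD ler_norml.
  by case: b1; case: b2 => /=; lra.
apply/seteqP; split=> x /=; apply: key => n; [exact: d1|by rewrite distrC; exact: d1].
Qed.

Lemma often_above_null B (c : R) : measurable B -> fine (mu B) < c -> 0 <= c <= 1 ->
  mu (often_above B c) = 0%E.
Proof.
move=> mB Bc c01; have mO := measurable_often_above c mB.
case: (erg mO (often_above_shift _ _)) => // h1.
have /ae_prob1 hae := h1; have {}hae := hae mO.
suff : c <= fine (mu B) by rewrite leNgt Bc.
apply: maximal_ergodic => //; apply: ae_imp hae => x [q /(_ 1%N)[n [n1 hn]]].
exists n => //; apply: le_lt_trans hn; apply: ler_wpM2r => //.
by rewrite lerDl invr_ge0.
Qed.

Lemma ergodic_upper B (e : R) : measurable B -> 0 < e ->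
  {ae mu, forall x, exists N, forall n, (N <= n)%N ->
    (visits B x n)%:R <= (fine (mu B) + e) * n%:R}.
Proof.
move=> mB e0; pose c := fine (mu B) + e / 2.
have p0 : 0 <= fine (mu B) by exact: mu_fine_ge0.
case: (leP 1 c) => c1.
  apply: (@ae_null _ _ _ _ set0) => // x _; exists 0%N => n _.
  apply: (@le_trans _ _ n%:R); first by rewrite ler_nat visits_le.
  by rewrite ler_peMl //; rewrite /c in c1; lra.
have c0 : 0 <= c by rewrite /c; lra.
have hn : mu (often_above B c) = 0%E.
  by apply: often_above_null => //; rewrite ?c0 ?(ltW c1) // /c; lra.
apply: (ae_null (measurable_often_above c mB) hn) => x hx; apply: contrapT => hN.
apply: hx; exists (Num.bound (e / 2)^-1) => N; apply: contrapT => hn'; apply: hN.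
exists N => n Nn; rewrite leNgt; apply/negP => h; apply: hn'; exists n; split=> //.
apply: le_lt_trans h; apply: ler_wpM2r => //.
have : (Num.bound (e / 2)^-1).+1%:R^-1 <= e / 2.
  rewrite invf_ple ?posrE ?divr_gt0 //; apply: le_trans (ltW (archi_boundP _)) _.
    by rewrite invr_ge0 ltW // divr_gt0.
  by rewrite ler_nat.
by rewrite /c; move: (_.+1%:R^-1) => v; lra.
Qed.

(** The lower bound is the upper bound for the complement. *)
Lemma ergodic_theorem B : measurable B ->
  {ae mu, forall x, (fun n => (visits B x n)%:R / n%:R : R) @ \oo --> fine (mu B)}.
Proof.
move=> mB.
have h1 : {ae mu, forall x, forall q : nat, exists N, forall n, (N <= n)%N ->
    (visits B x n)%:R <= (fine (mu B) + q.+1%:R^-1) * n%:R}.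
  by apply: ae_foralln => q; apply: ergodic_upper => //; rewrite invr_gt0.
have h2 : {ae mu, forall x, forall q : nat, exists N, forall n, (N <= n)%N ->
    (visits (~` B) x n)%:R <= (fine (mu (~` B)) + q.+1%:R^-1) * n%:R}.
  by apply: ae_foralln => q; apply: ergodic_upper; [exact: measurableC|rewrite invr_gt0].
apply: ae_imp (ae_and h1 h2) => x [hx1 hx2]; apply/cvgrPdist_le => e e0.
pose q := Num.bound e^-1.
have qe : q.+1%:R^-1 <= e.
  rewrite invf_ple ?posrE //; apply: le_trans (ltW (archi_boundP _)) _.
    by rewrite invr_ge0 ltW.
  by rewrite ler_nat.
have [N1 hN1] := hx1 q; have [N2 hN2] := hx2 q.
exists (maxn 1 (maxn N1 N2)) => // n /=; rewrite !geq_max => /and3P[n1 n2 n3].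
have n0 : (0 : R) < n%:R by rewrite ltr0n.
have u := hN1 n n2; have := hN2 n n3.
rewrite visitsC natrB ?visits_le // probability_setC //.
rewrite (mu_fin mu mB) -EFinB /= => v.
have e2 : (visits B x n)%:R = (visits B x n)%:R / n%:R * n%:R :> R by rewrite divfK // gt_eqF.
have kn := ler_wpM2r (ltW n0) qe.
rewrite ler_norml; apply/andP; split; rewrite -(ler_pM2r n0) mulrBl -e2;
move: (q.+1%:R^-1 : R) (fine (mu B)) (n%:R : R) u v kn => k p N u v kn; lra.
Qed.

End Ergodic.

(** * Empirical frequencies and the estimate chi *)

Section Frequencies.
Context (A : countType) (a0 : A) (R : realType).
Notation path := (pathT int A a0).
Context (mu : probability path R).
Hypothesis stat : forall B : set path, measurable B -> mu (shiftz 1 @^-1` B) = mu B.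
Hypothesis erg : forall B : set path, measurable B -> shiftz 1 @^-1` B = B ->
  mu B = 0%E \/ mu B = 1%E.

Notation blk := (@block A a0).

Definition pm (s : seq A) : R := fine (mu (blk s 0)).

Lemma pm_ge0 s : 0 <= pm s. Proof. exact: mu_fine_ge0. Qed.

Lemma pm_le1 s : pm s <= 1.
Proof. by rewrite -lee_fin -mu_fin ?probability_le1 //; exact: measurable_block. Qed.

Lemma pmE s : mu (blk s 0) = (pm s)%:E.
Proof. by rewrite -mu_fin //; exact: measurable_block. Qed.

Lemma block_shift s (t n : int) : blk s (t + n) = shiftz n @^-1` (blk s t).
Proof. by apply/seteqP; split=> x /=; rewrite /block /= pa_shiftz. Qed.

Lemma pmE_at s (t : int) : mu (blk s t) = (pm s)%:E.
Proof.
rewrite -[t]add0r block_shift -pmE; apply: stat_int => //; exact: measurable_block.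
Qed.

Lemma pm_nil : pm [::] = 1.
Proof.
rewrite /pm (_ : blk _ _ = setT); first by rewrite probability_setT.
by apply/seteqP; split.
Qed.

Definition typical (x : path) : Prop := forall s : seq A,
  (fun n => (visits (blk s 0) x n)%:R / n%:R : R) @ \oo --> pm s.

Lemma ae_typical : {ae mu, forall x, typical x}.
Proof.
apply: ae_countable => s; apply: ergodic_theorem => //; exact: measurable_block.
Qed.

Lemma occ_visits (x : path) a b s : (a <= b.+1)%N ->
  (occ x a b s + visits (blk s 0) x a)%N = visits (blk s 0) x b.+1.
Proof.
move=> ab; rewrite addnC -[in RHS](subnKC ab) /visits iotaD count_cat add0n; congr addn.
rewrite /occ /index_iota; apply: eq_in_count => t _; rewrite str_recent.
by rewrite /block /= pa_shiftz add0r; apply/eqP/asboolP.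
Qed.

Section OneTypicalPath.
Variable x : path.
Hypothesis tx : typical x.

(** The additive N absorbs short time spans, so the estimate is available at every m; [occ_cvg]
    subtracts two instances of it. *)
Lemma visits_approx s (e : R) : 0 < e -> exists N : nat, forall m,
  `|(visits (blk s 0) x m)%:R - pm s * m%:R| <= e * m%:R + N%:R.
Proof.
move=> e0; move: (@tx s) => /cvgrPdist_le/(_ e e0)[N _ hN]; exists N => m.
have v0 : (visits (blk s 0) x m)%:R <= m%:R :> R by rewrite ler_nat visits_le.
case: (leqP N m) => Nm.
  case: m Nm v0 => [|m] Nm v0.
    by rewrite /visits /= mulr0 subrr normr0 mulr0 add0r.
  have m0 : (0 : R) < m.+1%:R by rewrite ltr0n.
  have := hN m.+1 Nm; rewrite /= distrC => h.
  apply: (@le_trans _ _ (e * m.+1%:R)); last by rewrite lerDl.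
  rewrite -(ler_pM2r m0) in h; apply: le_trans h.
  set v := (visits _ _ _)%:R; have -> : v - pm s * m.+1%:R = (v / m.+1%:R - pm s) * m.+1%:R.
    by rewrite mulrBl divfK ?gt_eqF.
  by rewrite normrM (gtr0_norm m0).
have Nm' : m%:R <= N%:R :> R by rewrite ler_nat ltnW.
have e1 : 0 <= e * m%:R by rewrite mulr_ge0 // ltW.
have := pm_le1 s; have := pm_ge0 s => p0 p1.
have h1 : 0 <= pm s * m%:R by rewrite mulr_ge0.
have h2 : pm s * m%:R <= m%:R by rewrite ler_piMl.
have h3 : 0 <= (visits (blk s 0) x m)%:R :> R by [].
by rewrite ler_norml; apply/andP; split; lra.
Qed.

(** All counting windows of the estimator are [n/2, n] up to a displacement bounded by c, so one
    statement serves them all. The factor 1/2 appears because a count over half of the data is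
    divided by n. *)
Lemma occ_cvg s (a b : nat -> nat) (c : nat) :
  (forall n, (c <= n)%N -> [/\ (a n <= (b n).+1)%N, ((a n).*2 <= n + c)%N,
     (n <= (a n).*2 + c)%N, (b n <= n + c)%N & (n <= b n + c)%N]) ->
  (fun n => (occ x (a n) (b n) s)%:R / n%:R : R) @ \oo --> pm s / 2.
Proof.
move=> hab; apply/cvgrPdist_le => e e0.
have e8 : 0 < e / 8 by rewrite divr_gt0.
have [N hN] := visits_approx s e8.
(* Twice the additive error of [visits_approx], plus the effect of the displaced endpoints. *)
pose M : R := 2 * N%:R + (2 * c%:R + 1) * (1 + e).
have M0 : 0 <= M by rewrite addr_ge0 ?mulr_ge0 // ?addr_ge0 // ?mulr_ge0 // ltW.
have hb : 0 <= M / (e / 2) by rewrite divr_ge0 // divr_ge0 // ltW.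
exists (maxn c (Num.bound (M / (e / 2))).+1) => // n /=; rewrite geq_max => /andP[cn nb].
have n0 : (0 : R) < n%:R by rewrite ltr0n; apply: leq_trans nb.
have nM : M <= e / 2 * n%:R.
  rewrite mulrC -ler_pdivrMr ?divr_gt0 //; apply: ltW (lt_le_trans (archi_boundP hb) _).
  by rewrite ler_nat ltnW.
have [a1 a2 a3 a4 a5] := hab n cn.
have /(congr1 (fun k => k%:R : R)) := occ_visits x s a1; rewrite natrD => eo.
have va := hN (a n); have vb := hN (b n).+1.
rewrite -(ler_pM2r n0) -[X in _ * X <= _](gtr0_norm n0) -normrM mulrBl divfK ?gt_eqF //.
move: a1 a2 a3 a4 a5; rewrite -!(ler_nat R) -!muln2 !natrD !natrM -[(b n).+1%:R]natr1 => a1 a2 a3 a4 a5.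
move: va vb eo; rewrite -[(b n).+1%:R]natr1 !ler_norml => /andP[va1 va2] /andP[vb1 vb2] eo.
have p0 := pm_ge0 s; have p1 := pm_le1 s.
have c0 : (0 : R) <= c%:R by [].
have d1 : - (pm s * (2 * c%:R + 1)) <= pm s * ((b n)%:R + 1 - (a n)%:R) - pm s * n%:R / 2.
  have : 0 <= pm s * ((2 * c%:R + 1) + ((b n)%:R + 1 - (a n)%:R) - n%:R / 2).
    by apply: mulr_ge0 => //; lra.
  by lra.
have d2 : pm s * ((b n)%:R + 1 - (a n)%:R) - pm s * n%:R / 2 <= pm s * (2 * c%:R + 1).
  have : 0 <= pm s * ((2 * c%:R + 1) - ((b n)%:R + 1 - (a n)%:R) + n%:R / 2).
    by apply: mulr_ge0 => //; lra.
  by lra.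
have d3 : pm s * (2 * c%:R + 1) <= 2 * c%:R + 1 by rewrite ler_piMl //; lra.
have d4 : e / 8 * (a n)%:R <= e / 8 * ((n%:R + c%:R) / 2) by rewrite ler_wpM2l //; lra.
have d5 : e / 8 * ((b n)%:R + 1) <= e / 8 * (n%:R + c%:R + 1) by rewrite ler_wpM2l //; lra.
have d6 : 0 <= e * c%:R by rewrite mulr_ge0 // ltW.
have d7 : 0 <= e * n%:R by rewrite mulr_ge0 // ltW.
move: nM; rewrite /M => nM.
by apply/andP; split; lra.
Qed.

Lemma freq_cvg s y : 0 < pm s ->
  (fun n => freq R x n s y) @ \oo --> pm (rcons s y) / pm s.
Proof.
move=> p0.
have h1 : (fun n => (occ x (uphalf n + size s) n (rcons s y))%:R / n%:R : R) @ \oo -->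
    pm (rcons s y) / 2.
  apply: (@occ_cvg _ (fun n => uphalf n + size s)%N id ((size s).*2 + 1)%N) => n hn.
  by split; lia.
have h2 : (fun n => (occ x (uphalf n + size s).-1 n.-1 s)%:R / n%:R : R) @ \oo -->
    pm s / 2.
  apply: (@occ_cvg _ (fun n => (uphalf n + size s).-1)%N predn ((size s).*2 + 2)%N) => n hn.
  by split; lia.
have p2 : pm s / 2 != 0 by rewrite gt_eqF // divr_gt0.
have h3 : (fun n => ((occ x (uphalf n + size s) n (rcons s y))%:R / n%:R) *
    ((occ x (uphalf n + size s).-1 n.-1 s)%:R / n%:R)^-1 : R) @ \oo -->
    pm (rcons s y) / 2 * (pm s / 2)^-1.
  by apply: cvgM => //; exact: cvgV.
have <- : pm (rcons s y) / 2 * (pm s / 2)^-1 = pm (rcons s y) / pm s.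
  by field; rewrite gt_eqF.
apply: cvg_trans h3; apply: near_eq_cvg; exists 1%N => // n /= n1.
rewrite /freq /=; have n0 : n%:R != 0 :> R by rewrite pnatr_eq0 -lt0n.
(* A vanishing denominator gives 0 on both sides by the convention that 0 has inverse 0. *)
case: (eqVneq ((occ x (uphalf n + size s).-1 n.-1 s)%:R : R) 0) => [->|d0].
  by rewrite mul0r invr0 !mulr0.
by field; rewrite n0 d0.
Qed.

Lemma visit_after s (k : nat) : 0 < pm s ->
  exists2 t : nat, (k <= t)%N & recent (pa x t) (size s) = s.
Proof.
move=> p0; apply: contrapT => hn.
have hV n : (visits (blk s 0) x n <= k)%N.
  case: (leqP n k) => nk; first exact: leq_trans (visits_le _ _ _) nk.
  rewrite -(subnKC (ltnW nk)) visitsD (_ : visits _ (shiftz k x) _ = 0%N) ?addn0 ?visits_le //.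
  apply/eqP; rewrite -leqn0 leqNgt -has_count; apply/hasPn => t _; apply/asboolPn.
  rewrite /block /= !pa_shiftz add0r => e; apply: hn; exists (k + t)%N; first exact: leq_addr.
  by rewrite addnC.
have := visits_approx s (divr_gt0 p0 (ltr0Sn R 3)) => -[N hN].
have := archi_boundP (x := (k%:R + N%:R) / (pm s / 2)).
set m := Num.bound _ => hm.
have {}hm : k%:R + N%:R < pm s / 2 * m%:R.
  by rewrite mulrC -ltr_pdivrMr ?divr_gt0 // hm // divr_ge0 ?divr_ge0 // ?addr_ge0 // ltW.
have := hN m; have := hV m; rewrite -(ler_nat R) ler_norml => h1 /andP[h2 h3].
have : 0 <= pm s * m%:R by rewrite mulr_ge0 // ltW.
by lra.
Qed.

Lemma powR_large (g M : R) : 0 < g -> exists N : nat, forall n, (N <= n)%N -> M < n%:R `^ g.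
Proof.
move=> g0; pose M' := Num.max M 1.
have M1 : 0 < M' by rewrite lt_max ltr01 orbT.
have h : 0 <= M' `^ g^-1 by exact: powR_ge0.
exists (Num.bound (M' `^ g^-1)) => n hn.
apply: (@le_lt_trans _ _ M'); first by rewrite le_max lexx.
have -> : M' = (M' `^ g^-1) `^ g by rewrite -powRrM mulVf ?gt_eqF // powRr1 // ltW.
apply: gt0_ltr_powR => //; rewrite ?nnegrE //.
by apply: lt_le_trans (archi_boundP h) _; rewrite ler_nat.
Qed.

(** One occurrence settles the first half of the data; in the second half linear growth of the count
    beats n^(1-gamma). *)
Lemma Lset_eventually (gamma : R) s : 0 < gamma -> (0 < size s)%N -> 0 < pm s ->
  exists N : nat, forall n, (N <= n)%N -> Lset gamma x n (size s).-1 s.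
Proof.
move=> g0 s0 p0; have [t kt et] := visit_after (size s) p0.
have := @occ_cvg s (fun n => uphalf n + (size s).-1)%N id ((size s).*2 + 1)%N.
have hab (n : nat) : ((size s).*2 + 1 <= n)%N -> [/\ (uphalf n + (size s).-1 <= n.+1)%N,
    ((uphalf n + (size s).-1).*2 <= n + ((size s).*2 + 1))%N,
    (n <= (uphalf n + (size s).-1).*2 + ((size s).*2 + 1))%N,
    (n <= n + ((size s).*2 + 1))%N & (n <= n + ((size s).*2 + 1))%N].
  by move=> hn; split; lia.
move=> /(_ hab) /cvgrPdist_le/(_ (pm s / 4)) [|N1 _ hN1]; first by rewrite divr_gt0.
have [N2 hN2] := @powR_large gamma (4 / pm s) g0.
exists (maxn (maxn 1 N1) (maxn N2 (t.+1).*2)) => n.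
rewrite !geq_max => /andP[/andP[n1 nN1] /andP[nN2 nt]].
have es : (size s).-1.+1 = size s by rewrite prednK.
split; split => //.
  exists t; first by lia.
  by rewrite str_recentS es.
have n0 : (0 : R) < n%:R by rewrite ltr0n.
have := hN1 n nN1; rewrite /= ler_norml => /andP[_ h].
have {}h : pm s / 4 * n%:R <= (occ x (uphalf n + (size s).-1) n s)%:R.
  by rewrite -ler_pdivlMr //; lra.
apply: lt_le_trans h; have ng := powR_gt0 gamma n0.
have e : n%:R `^ (1 - gamma) * n%:R `^ gamma = n%:R :> R.
  by rewrite -powRD ?subrK ?powRr1 ?ltW // gt_eqF //= implybT.
rewrite -(ltr_pM2r ng) e; have := hN2 n nN2; rewrite ltr_pdivrMr // => h.
have : 4 * n%:R < n%:R `^ gamma * pm s * n%:R by rewrite ltr_pM2r.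
by move: (n%:R `^ gamma) => v; lra.
Qed.

End OneTypicalPath.
End Frequencies.

(** * Bounds for the maxima in [Delta] *)

Section MaxR.
Context (R : realType).

Lemma seq_bounded_max (L : seq R) (S : set R) : (forall y, S y -> y \in L) ->
  (exists r, S r) -> exists m, S m /\ forall y, S y -> y <= m.
Proof.
elim: L S => [|a L ih] S hL [r Sr]; first by have := hL r Sr.
case: (pselect (exists r, S r /\ a < r)) => [[r' [Sr' ar']]|h].
  have [||m [[Sm am] hm]] := ih [set r | S r /\ a < r].
  - by move=> y [/hL]; rewrite inE => /orP[/eqP->|//]; rewrite ltxx.
  - by exists r'.
  exists m; split=> // y Sy; case: (leP y a) => ya; last exact: hm.
  exact: le_trans ya (ltW am).
case: (pselect (S a)) => Sa.
  exists a; split=> // y Sy; rewrite leNgt; apply/negP => ay; apply: h; by exists y.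
apply: ih; last by exists r.
by move=> y Sy; have := hL y Sy; rewrite inE => /orP[/eqP e|//]; case: Sa; rewrite -e.
Qed.

(** The list makes S finite, which excludes the default value 0 of [maxR]. *)
Lemma maxR_ge (L : seq R) (S : set R) r : (forall y, S y -> y \in L) -> S r -> r <= maxR S.
Proof.
move=> hL Sr; have [m [Sm hm]] := seq_bounded_max hL (ex_intro _ r Sr).
rewrite /maxR; case: xgetP => [m' _ [_ h]|h]; first exact: h.
by case: (h m); split.
Qed.

Lemma maxR_le (S : set R) c : 0 <= c -> (forall r, S r -> r <= c) -> maxR S <= c.
Proof. by move=> c0 h; rewrite /maxR; case: xgetP => // m _ [/h]. Qed.

End MaxR.

Section DeltaBounds.
Context (A : countType) (R : realType) (l : nat -> nat) (gamma : R).
Implicit Types (x : int -> A).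

Lemma Delta_le x n k c : 0 <= c ->
  (forall z y, (0 < size z)%N -> Lset gamma x n (k + size z) (rcons (z ++ recent (Xtilde l x) k) y) ->
     `|freq R x n (recent (Xtilde l x) k) y - freq R x n (z ++ recent (Xtilde l x) k) y| <= c) ->
  Delta l gamma x n k <= c.
Proof.
move=> c0 h; rewrite /Delta big_seq; apply: (big_ind (fun v => v <= c)) => //.
  by move=> a b ha hb; rewrite ge_max ha hb.
move=> i; rewrite mem_index_iota => /andP[i0 _]; apply: maxR_le => // r /= [z [y [sz hL ->]]].
apply: le_trans (h z y _ _); rewrite ?sz //.
by case: (_ <= _)%N; rewrite ?mul1r ?mul0r.
Qed.

Lemma Delta_ge x n k z y : (0 < size z <= n)%N ->
  Lset gamma x n (k + size z) (rcons (z ++ recent (Xtilde l x) k) y) ->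
  (zeta l x (Jindex l k) <= (uphalf n).-1)%N ->
  `|freq R x n (recent (Xtilde l x) k) y - freq R x n (z ++ recent (Xtilde l x) k) y|
    <= Delta l gamma x n k.
Proof.
move=> /andP[z0 zn] hL hz; set w := recent _ _.
pose S (i : nat) := [set r : R | exists z y, [/\ size z = i,
  Lset gamma x n (k + i) (rcons (z ++ w) y) &
  r = ((zeta l x (Jindex l k) <= (uphalf n).-1)%N)%:R *
              `|freq R x n w y - freq R x n (z ++ w) y|]].
apply: (@le_trans _ _ (maxR (S (size z)))).
  (* The words in the maximum occur in the data, so the values can be listed by time of occurrence;
     [G] splits the word read there into its prefix and its last letter. *)
  pose F (u : seq A) (y : A) : R := ((zeta l x (Jindex l k) <= (uphalf n).-1)%N)%:R *
              `|freq R x n w y - freq R x n u y|.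
  pose G (s : seq A) : R := if s is a :: s' then F (belast a s') (last a s') else 0.
  apply: (@maxR_ge _ [seq G (str x (t%:Z - (k + size z)%N%:Z) t%:Z) | t : nat <- iota 0 n.+1]).
    move=> r [z' [y' [sz' [[_ [t ht et]] _] ->]]]; apply/mapP; exists t.
      by rewrite mem_iota; lia.
    rewrite et /G; case e: (rcons _ _) => [|a s]; first by case: (z' ++ w) e.
    have [e1 e2] : z' ++ w = belast a s /\ y' = last a s.
      by move: e; rewrite lastI => /rcons_inj[-> ->].
    by rewrite /F e1 e2.
  by exists z, y; rewrite hz mul1r.
rewrite /Delta -/w; apply: (@le_bigmax_seq _ _ _ _ _ (size z) xpredT (fun i => maxR (S i))) => //.
by rewrite mem_index_iota z0 ltnS.
Qed.

(** It lets the concentration bound for the longer word be paired with the one for w itself, whose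
    frequency is the first one in [Delta]. *)
Lemma Lset_suffix x n (z w : seq A) y : Lset gamma x n (size (z ++ w)) (rcons (z ++ w) y) ->
  Lset gamma x n (size w) (rcons w y).
Proof.
have key (t : nat) : str x (t%:Z - (size (z ++ w))%:Z) t%:Z = rcons (z ++ w) y ->
    str x (t%:Z - (size w)%:Z) t%:Z = rcons w y.
  rewrite !str_recentS size_cat rcons_cat.
  have -> : (size z + size w).+1 = ((size w).+1 + size z)%N by lia.
  by move=> /recent_suffix/(_ erefl).
move=> [[_ [t /andP[t1 t2] et]] [_ h2]]; split; split; rewrite ?size_rcons //.
  by exists t; [rewrite t2 andbT; apply: leq_trans t1; rewrite size_cat leq_addl|exact: key].
apply: lt_le_trans h2 _; rewrite ler_nat /occ !size_rcons.
apply: (@leq_trans (count (fun t : nat => str x (t%:Z - (size w).+1%:Z + 1) t%:Z == rcons w y)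
   (index_iota (uphalf n + size (z ++ w)) n.+1))).
  apply: sub_count => t' /= /eqP; rewrite !str_recent -!str_recentS => /key ->; exact: eqxx.
rewrite /index_iota size_cat.
case: (leqP (uphalf n + (size z + size w)) n.+1) => h; last first.
  by rewrite (_ : (n.+1 - _)%N = 0%N) //; lia.
have -> : (n.+1 - (uphalf n + size w))%N =
   (size z + (n.+1 - (uphalf n + (size z + size w))))%N by lia.
rewrite iotaD count_cat; apply: leq_trans (leq_addl _ _).
by have -> : (uphalf n + size w + size z)%N = (uphalf n + (size z + size w))%N by lia.
Qed.

End DeltaBounds.

(** * Memory words and the limit of [chi] *)

Section Memory.
Context (A : countType) (a0 : A) (R : realType).
Notation path := (pathT int A a0).
Context (mu : probability path R).
Hypothesis stat : forall B : set path, measurable B -> mu (shiftz 1 @^-1` B) = mu B.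
Notation pm := (pm mu).

(** The condition in the definition of the memory length, as a property of a word rather than of a
    path. *)
Definition memory_word (w : seq A) : Prop := forall (z : seq A) (y : A), (0 < size z)%N ->
  0 < pm (rcons (z ++ w) y) -> pm (rcons w y) / pm w = pm (rcons (z ++ w) y) / pm (z ++ w).

Lemma pm_suffix z w : pm (z ++ w) <= pm w.
Proof.
rewrite -lee_fin -!pmE; apply: le_mu; try exact: measurable_block.
by move=> x; rewrite /block /= size_cat addnC => /recent_suffix/(_ erefl).
Qed.

Lemma pm_rcons_le w y : pm (rcons w y) <= pm w.
Proof.
rewrite -lee_fin -pmE -(pmE_at stat w (-1)); apply: le_mu; try exact: measurable_block.
move=> x; rewrite /block /= size_rcons -[0 : int](addNr 1) recent_pa_rcons => e.
by have [-> _] := rcons_inj e.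
Qed.

Section Estimates.
Context (l : nat -> nat) (beta gamma : R).
Hypotheses (beta0 : 0 < beta) (gamma0 : 0 < gamma).

(** The reference value is the conditional probability given w alone, for all z, the empty one
    included; the two frequencies in [Delta] are then within n^(-beta) of each other, whence the
    factor 1/2. The uniformity in z and w is beyond the ergodic theorem, which treats one word at a
    time. *)
Definition concentrated (x : path) : Prop := exists N : nat, forall n, (N <= n)%N ->
  forall (z w : seq A) y, memory_word w ->
  Lset gamma x n (size (z ++ w)) (rcons (z ++ w) y) ->
  `|freq R x n (z ++ w) y - pm (rcons w y) / pm w| <= n%:R `^ (- beta) / 2.

Variable x : path.
Hypotheses (tx : typical mu x).

Lemma powR_small (b e : R) : 0 < b -> 0 < e ->
  exists N : nat, forall n, (N <= n)%N -> n%:R `^ (- b) < e.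
Proof.
move=> b0 e0; have [N hN] := powR_large e^-1 b0; exists (maxn 1 N) => n.
rewrite geq_max => /andP[n1 nN].
by rewrite powRN invf_plt ?posrE ?hN // powR_gt0 // ltr0n.
Qed.

(** A word that is not a memory word has an extension with a different conditional probability; the
    two frequencies converge to these distinct limits. *)
Lemma Delta_eventually_large k : ~ memory_word (recent (Xtilde l x) k) ->
  exists N : nat, forall n, (N <= n)%N -> n%:R `^ (- beta) < Delta l gamma x n k.
Proof.
set w := recent _ _ => h.
have [z [y [z0 p0 ne]]] : exists z y, [/\ (0 < size z)%N, 0 < pm (rcons (z ++ w) y) &
    pm (rcons w y) / pm w != pm (rcons (z ++ w) y) / pm (z ++ w)].
  apply: contrapT => hn; apply: h => z y z0 p0; apply: contrapT => ne; apply: hn.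
  by exists z, y; split=> //; apply/eqP.
set d := `|pm (rcons w y) / pm w - pm (rcons (z ++ w) y) / pm (z ++ w)|.
have d0 : 0 < d by rewrite normr_gt0 subr_eq0.
have pzw : 0 < pm (z ++ w) by apply: lt_le_trans p0 _; exact: pm_rcons_le.
have pw : 0 < pm w by apply: lt_le_trans pzw _; exact: pm_suffix.
have d4 : 0 < d / 4 by rewrite divr_gt0.
have /cvgrPdist_lt/(_ _ d4)[N1 _ h1] := @freq_cvg _ _ _ _ x tx w y pw.
have /cvgrPdist_lt/(_ _ d4)[N2 _ h2] := @freq_cvg _ _ _ _ x tx (z ++ w) y pzw.
have [N3 h3] := powR_small beta0 (divr_gt0 d0 (ltr0Sn _ 1)).
have [|N4 h4] := Lset_eventually tx gamma0 _ p0; first by rewrite size_rcons.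
(* The last entry makes the indicator in [Delta] equal to 1. *)
exists (maxn (maxn N1 N2) (maxn (maxn N3 N4) (maxn (size z) (zeta l x (Jindex l k)).+1.*2))) => n.
rewrite !geq_max => /andP[/andP[n1 n2] /andP[/andP[n3 n4] /andP[nz nzeta]]].
apply: lt_le_trans (h3 n n3) _.
apply: le_trans (@Delta_ge _ _ _ _ x n k z y _ _ _); last by lia.
- rewrite -/w; have := h1 n n1; have := h2 n n2; rewrite /= /d.
  move: (pm _ / pm _) (pm _ / pm _) (freq _ _ _ _ _) (freq _ _ _ _ _) => a b c e hb hc.
  have := ler_distD c a b; have := ler_distD e c b; rewrite distrC in hb.
  by move: hb hc; lra.
- by rewrite z0 nz.
- have := h4 n n4; rewrite size_rcons /= size_cat addnC.
  by rewrite -/w {1}/w size_recent.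
Qed.

Lemma Delta_eventually_small k : concentrated x -> memory_word (recent (Xtilde l x) k) ->
  exists N : nat, forall n, (N <= n)%N -> Delta l gamma x n k <= n%:R `^ (- beta).
Proof.
move=> [N hN] mw; exists N => n nN; apply: Delta_le; first exact: powR_ge0.
move=> z y z0; set w := recent _ _ in mw *.
have -> : (k + size z)%N = size (z ++ w) by rewrite size_cat size_recent addnC.
move=> hL; have h1 := hN n nN z w y mw hL.
have h2 := hN n nN [::] w y mw (Lset_suffix hL).
rewrite /= in h2; move: (pm _ / pm _) (freq _ _ _ _ _) (freq _ _ _ _ _) h1 h2 => a b c.
by rewrite !ler_norml => /andP[? ?] /andP[? ?]; apply/andP; split; lra.
Qed.

Lemma chi_eventually_ge K : (forall k, (k < K)%N -> ~ memory_word (recent (Xtilde l x) k)) ->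
  exists N : nat, forall n, (N <= n)%N -> (K <= chi l beta gamma x n)%N.
Proof.
elim: K => [|K ih] h; first by exists 0%N.
have [|N1 h1] := ih; first by move=> k kK; apply: h; exact: leqW.
have [N2 h2] := Delta_eventually_large (h K (ltnSn K)).
exists (maxn 1 (maxn N1 N2)) => n; rewrite !geq_max => /and3P[n1 nN1 nN2].
have := h1 n nN1; rewrite leq_eqVlt => /orP[/eqP e|//].
case: n n1 nN1 nN2 e => // n _ nN1 nN2 e; have [_ h3 _] := chi_spec l beta gamma x n.
by have := lt_le_trans (h2 _ nN2) (le_trans _ h3); rewrite e lexx ltxx => /(_ isT).
Qed.

Lemma chi_eventually_eq K : concentrated x -> memory_word (recent (Xtilde l x) K) ->
  (forall k, (k < K)%N -> ~ memory_word (recent (Xtilde l x) k)) ->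
  exists N : nat, forall n, (N <= n)%N -> chi l beta gamma x n = K.
Proof.
move=> cx mK hK; have [N1 h1] := chi_eventually_ge hK.
have [N2 h2] := Delta_eventually_small cx mK.
exists (maxn 1 (maxn N1 N2)) => n; rewrite !geq_max => /and3P[n1 nN1 nN2].
apply/eqP; rewrite eqn_leq h1 // andbT leqNgt; apply/negP => hlt.
case: n n1 nN1 nN2 hlt => // n _ nN1 nN2 hlt; have [_ _ h3] := chi_spec l beta gamma x n.
by have := h3 _ hlt; rewrite ltNge h2.
Qed.

End Estimates.
End Memory.

(** * An exponential inequality *)

Section BoundedDiscrete.
Context d (T : measurableType d) (R : realType) (mu : probability T R).

Lemma dm_integrable (v : T -> R) (D : set T) (M : R) : dm v ->
  (forall x, `|v x| <= M) -> measurable D -> mu.-integrable D (EFin \o v).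
Proof.
move=> hv hM mD; apply: measurable_bounded_integrable => //.
- by apply: (le_lt_trans (probability_le1 mu mD)); exact: ltry.
- exact: (dm_measurable_fun (V := measurableTypeR R)).
- exists M; split; first exact: num_real.
  by move=> y My x _; apply: le_trans (hM x) (ltW My).
Qed.

Lemma integral_fibers (C : countType) (Y : T -> C) (u : T -> \bar R) : dm Y ->
  measurable_fun setT u -> (forall x, (0 <= u x)%E) ->
  (\int[mu]_x u x = \sum_(0 <= k <oo) \int[mu]_(x in [set x | pickle (Y x) = k]) u x)%E.
Proof.
move=> hY mu_ u0; pose F k := [set x | pickle (Y x) = k].
have UF : \bigcup_k F k = setT by apply/seteqP; split=> // x _; exists (pickle (Y x)).
rewrite -[in LHS]UF ge0_integral_bigcup //.
- by move=> k; exact: (hY [set c | pickle c = k]).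
- by rewrite UF.
- by apply/trivIsetP => i j _ _ ij; apply/seteqP; split=> x //= -[e1 e2]; move: ij; rewrite -e1 -e2 eqxx.
Qed.

(** Conditioning on a countably valued Y is replaced by comparing integrals over each of its
    fibres. *)
Lemma le_Rintegral_fibers (C : countType) (Y : T -> C) (u v : T -> R) (M : R) : dm Y ->
  dm u -> dm v -> (forall x, 0 <= u x <= M) -> (forall x, 0 <= v x <= M) ->
  (forall x0, \int[mu]_(x in [set x | Y x = Y x0]) u x <=
     \int[mu]_(x in [set x | Y x = Y x0]) v x) ->
  \int[mu]_x u x <= \int[mu]_x v x.
Proof.
move=> hY hu hv u0 v0 h.
have nb (w : T -> R) : (forall x, 0 <= w x <= M) -> forall x, `|w x| <= M.
  by move=> hw x; have /andP[w0 wM] := hw x; rewrite ger0_norm.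
have fin (w : T -> R) : dm w -> (forall x, 0 <= w x <= M) -> forall D, measurable D ->
    (\int[mu]_(x in D) (w x)%:E)%E \is a fin_num.
  move=> hw w0 D mD; apply: integrable_fin_num => //.
  exact: (dm_integrable hw (nb _ w0) mD).
rewrite /Rintegral fine_le //; try exact: fin.
have mf (w : T -> R) : dm w -> measurable_fun setT (fun x => (w x)%:E).
  by move=> hw; apply: (dm_measurable_fun (V := \bar R)); exact: (@dm_comp _ _ _ _ EFin).
rewrite (integral_fibers hY (mf u hu)); last by move=> x; rewrite lee_fin; have /andP[] := u0 x.
rewrite (integral_fibers hY (mf v hv)); last by move=> x; rewrite lee_fin; have /andP[] := v0 x.
apply: lee_nneseries => [k _ _|k _].
  by apply: integral_ge0 => x _; rewrite lee_fin; have /andP[] := u0 x.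
case: (pselect (exists x0, pickle (Y x0) = k)) => [[x0 e]|hn]; last first.
  rewrite (_ : [set x | _] = set0) ?integral_set0 //.
  by apply/seteqP; split=> x //= e; apply: hn; exists x.
have -> : [set x | pickle (Y x) = k] = [set x | Y x = Y x0].
  apply/seteqP; split=> x /=; rewrite -e; last by move=> ->.
  exact: (pcan_inj pickleK).
have mD : measurable [set x | Y x = Y x0] by exact: (hY [set Y x0]).
have := h x0; rewrite /Rintegral -lee_fin !fineK //; exact: fin.
Qed.

End BoundedDiscrete.

(** From exp(-y) >= 1 - y comes exp(y) <= 1/(1 - y), and the quadratic times 1 - y exceeds 1 by y^2
    (1 - 2y). *)
Lemma expR_quadratic (R : realType) (y : R) : y <= 1 / 2 -> expR y <= 1 + y + 2 * y ^+ 2.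
Proof.
move=> y2; have h := expR_ge1Dx (- y).
have e0 := expR_gt0 y.
have e1 : expR y * expR (- y) = 1 by rewrite -expRD subrr expR0.
have h2 : expR y * (1 - y) <= 1 by apply: le_trans (ler_wpM2l (ltW e0) h) _; rewrite e1.
have h3 : 1 <= (1 + y + 2 * y ^+ 2) * (1 - y).
  rewrite -subr_ge0; have -> : (1 + y + 2 * y ^+ 2) * (1 - y) - 1 = y ^+ 2 * (1 - 2 * y) by ring.
  by rewrite mulr_ge0 ?sqr_ge0 //; lra.
have y1 : 0 < 1 - y by lra.
by rewrite -(ler_pM2r y1); apply: le_trans h2 h3.
Qed.

Section Supermartingale.
Context (A : countType) (a0 : A) (R : realType).
Notation path := (pathT int A a0).
Context (mu : probability path R).

Definition hist (t : nat) (x : path) : seq A := recent (pa x t) t.+1.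

Lemma dm_hist t : dm (hist t).
Proof. exact: dm_recent_pa. Qed.

Lemma hist_agree t x x' : hist t x = hist t x' <-> agree x x' t.
Proof. by split=> /agree_recentP. Qed.

Lemma hist_leq s t x x' : (s <= t)%N -> hist t x = hist t x' -> hist s x = hist s x'.
Proof. by move=> st /hist_agree h; apply/hist_agree; exact: agree_leq h. Qed.

Variables (psi : nat -> path -> A -> R) (V : nat -> path -> R).
Hypothesis adapted : forall t x x', hist t x = hist t x' ->
  psi t x = psi t x' /\ V t x = V t x'.
Hypothesis bounded : forall t x a, `|psi t x a| <= V t x.
Hypothesis small : forall t x, V t x <= 1 / 2.
Hypothesis centered : forall (t : nat) x0,
  \int[mu]_(x in [set x | hist t x = hist t x0]) psi t x0 (x (t%:Z + 1)) = 0.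

(** The logarithm of the supermartingale. An increment is a function of the past applied to the next
    letter; having mean 0, its exponential has conditional mean at most 1 + 2 V^2, and exp(-2 V^2)
    compensates. Both [psi] and [V] may vanish at some times, so a random set of active times is
    allowed. *)
Definition comp_sum (n : nat) (x : path) : R :=
  \sum_(t < n) (psi t x (x (t%:Z + 1)) - 2 * V t x ^+ 2).

Lemma comp_sum_adapted n x x' : hist n x = hist n x' -> comp_sum n x = comp_sum n x'.
Proof.
move=> h; apply: eq_bigr => t _.
have [-> ->] := adapted (hist_leq (ltnW (ltn_ord t)) h).
move/hist_agree: h => /(_ t.+1 (ltn_ord t)) e.
have -> : t%:Z + 1 = t.+1%:Z by rewrite -addn1 PoszD.
by rewrite e.
Qed.

Lemma dm_comp_sum n : dm (comp_sum n).
Proof. by apply: (@dm_factor _ _ _ _ (hist n)); [exact: dm_hist|exact: comp_sum_adapted]. Qed.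

Lemma V_ge0 t x : 0 <= V t x.
Proof. by apply: le_trans (bounded t x (x 0)). Qed.

Lemma comp_sum_le n x : comp_sum n x <= n%:R.
Proof.
rewrite -[n%:R]mulr1 -[n in n%:R]card_ord mulr_natl -sumr_const; apply: ler_sum => t _.
have := bounded t x (x (t%:Z + 1)); have := small t x; have := sqr_ge0 (V t x).
by rewrite ler_norml => ? ? /andP[]; lra.
Qed.

Lemma expR_comp_sum_step n :
  \int[mu]_x expR (comp_sum n.+1 x) <= \int[mu]_x expR (comp_sum n x).
Proof.
have b k x : (k <= n.+1)%N -> 0 <= expR (comp_sum k x) <= expR n.+1%:R.
  move=> kn; rewrite expR_ge0 ler_expR; apply: le_trans (comp_sum_le _ _) _; by rewrite ler_nat.
have dE k : dm (fun x => expR (comp_sum k x)) by apply: dm_comp; exact: dm_comp_sum.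
apply: (@le_Rintegral_fibers _ _ _ _ _ (hist n) _ _ (expR n.+1%:R)) => //.
- exact: dm_hist.
- by move=> x; apply: b.
- by move=> x; apply: b.
move=> x0; pose D : set path := [set x | hist n x = hist n x0]; rewrite -/D.
have mD : measurable D by exact: (dm_hist n [set hist n x0]).
pose v := V n x0; pose K := expR (comp_sum n x0) * expR (- (2 * v ^+ 2)).
have v0 : 0 <= v by exact: V_ge0.
have K0 : 0 <= K by rewrite mulr_ge0 ?expR_ge0.
have dpsi : dm (fun x : path => psi n x0 (x (n%:Z + 1))).
  apply: (@dm_comp _ _ _ _ (psi n x0)); exact: dm_coord.
have bpsi (x : path) : `|psi n x0 (x (n%:Z + 1))| <= 1.
  by apply: le_trans (bounded _ _ _) _; apply: le_trans (small _ _) _; lra.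
have ipsi := dm_integrable mu dpsi bpsi mD.
have icst c : mu.-integrable D (EFin \o (fun=> c : R)).
  by apply: (@dm_integrable _ _ _ _ (fun=> c) _ `|c|) => //; exact: dm_cst.
have iK : mu.-integrable D (EFin \o (fun x : path => K * psi n x0 (x (n%:Z + 1)))).
  apply: (@dm_integrable _ _ _ _ _ _ K) => //.
    by apply: (@dm_comp _ _ _ _ (fun r => K * r)).
  by move=> x; rewrite normrM ger0_norm // -[leRHS]mulr1 ler_wpM2l.
(* On one fibre of the history exp(psi) is at most 1 + psi + 2 v^2, and psi integrates to 0. *)
apply: (@le_trans _ _ (\int[mu]_(x in D) (K * (1 + 2 * v ^+ 2) + K * psi n x0 (x (n%:Z + 1))))).
  apply: le_Rintegral => //.
  - apply: (@dm_integrable _ _ _ _ _ _ (expR n.+1%:R)) => //.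
    by move=> x; have /andP[? ?] := b n.+1 x (leqnn _); rewrite ger0_norm.
  - apply: (@dm_integrable _ _ _ _ _ _ (K * (1 + 2 * v ^+ 2) + K)) => //.
      by apply: (@dm_comp _ _ _ _ (fun r => K * (1 + 2 * v ^+ 2) + K * r)).
    move=> x; apply: le_trans (ler_normD _ _) _; apply: lerD.
      by rewrite ger0_norm // mulr_ge0 // addr_ge0 // mulr_ge0 // sqr_ge0.
    by rewrite normrM ger0_norm // -[leRHS]mulr1 ler_wpM2l.
  - move=> x hx; rewrite /comp_sum big_ord_recr /= -/(comp_sum n x) (comp_sum_adapted hx).
    have [-> ->] := adapted hx; rewrite -/v expRD expRD -mulrDr.
    set P := psi n x0 _; have -> : expR (comp_sum n x0) * (expR P * expR (- (2 * v ^+ 2))) = K * expR P.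
      by rewrite /K; ring.
    rewrite ler_wpM2l // /P {P}.
    have hb := bounded n x0 (x (n%:Z + 1)); have hs := small n x0.
    have p2 : psi n x0 (x (n%:Z + 1)) ^+ 2 <= v ^+ 2.
      by rewrite -real_normK ?num_real // ler_sqr ?nnegrE //.
    apply: le_trans (expR_quadratic _) _; last by lra.
    by apply: le_trans (ler_norm _) (le_trans hb hs).
have c0 := centered n x0; rewrite -/D in c0.
have cZ : \int[mu]_(x in D) (K * psi n x0 (x (n%:Z + 1))) = 0.
  by rewrite RintegralZl // c0 mulr0.
rewrite RintegralD // cZ addr0 Rintegral_cst //.
rewrite (_ : \int[mu]_(x in D) _ = expR (comp_sum n x0) * fine (mu D)); last first.
  rewrite -Rintegral_cst //; apply: eq_Rintegral => x; rewrite inE => hx.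
  by rewrite (comp_sum_adapted hx).
rewrite ler_wpM2r ?mu_fine_ge0 // /K -mulrA -[leRHS]mulr1 ler_wpM2l ?expR_ge0 //.
apply: le_trans (ler_wpM2l (expR_ge0 _) (expR_ge1Dx _)) _.
by rewrite -expRD addNr expR0.
Qed.

Lemma expR_comp_sum n : \int[mu]_x expR (comp_sum n x) <= 1.
Proof.
elim: n => [|n ih]; last exact: le_trans (expR_comp_sum_step n) ih.
have -> : \int[mu]_x expR (comp_sum 0 x) = \int[mu]_x (fun=> 1) x.
  by apply: eq_Rintegral => x _; rewrite /comp_sum big_ord0 expR0.
by rewrite Rintegral_cst // mul1r -lee_fin -mu_fin // probability_le1.
Qed.

Lemma exponential_bound n (a : R) : (mu [set x | (a <= comp_sum n x)%R] <= (expR (- a))%:E)%E.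
Proof.
have mB : measurable [set x | (a <= comp_sum n x)%R].
  by apply: dm_measurable; apply: (@dm_comp _ _ _ _ (fun r : R => is_true (a <= r))); exact: dm_comp_sum.
rewrite (mu_fin _ mB) lee_fin expRN -[leRHS]mul1r ler_pdivlMr ?expR_gt0 // mulrC.
apply: le_trans (expR_comp_sum n); rewrite -Rintegral_cst //.
have i1 D : measurable D -> mu.-integrable D (EFin \o (fun x => expR (comp_sum n x))).
  move=> mD; apply: (@dm_integrable _ _ _ _ _ _ (expR n%:R)) => //.
    by apply: dm_comp; exact: dm_comp_sum.
  by move=> x; rewrite ger0_norm ?expR_ge0 // ler_expR comp_sum_le.
apply: (@le_trans _ _ (\int[mu]_(x in [set x | (a <= comp_sum n x)%R]) expR (comp_sum n x))).
  apply: le_Rintegral => //; last by move=> x; rewrite /= ler_expR.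
    by apply: (@dm_integrable _ _ _ _ (fun=> expR a) _ `|expR a|) => //; exact: dm_cst.
  exact: i1.
rewrite /Rintegral fine_le //; [exact: integrable_fin_num (i1 _ mB)|exact: integrable_fin_num (i1 _ _)|].
apply: ge0_subset_integral => //.
by case/integrableP : (i1 _ measurableT).
Qed.

End Supermartingale.

Section Bounds.
Context (R : realType).

(** The term of order k + 1 of the exponential series, with dl (k + 1) >= 6, dominates n^6, while (n
    + 1)^5 <= 32 n^5 is needed. The 1 in the maximum serves n = 0, where the power is 0. *)
Lemma exp_decay (dl b : R) : 0 < dl -> 0 < b -> exists C : R, forall n : nat,
  n.+1%:R ^+ 3 * expR (- (b * n%:R `^ dl)) <= C / n.+1%:R ^+ 2.
Proof.
move=> d0 b0; pose k := (Num.bound (6 / dl)).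
have kd : 6 <= dl * k.+1%:R.
  rewrite mulrC -ler_pdivrMr //; apply: ltW; apply: (lt_trans (archi_boundP _)).
    by rewrite divr_ge0 // ltW.
  by rewrite ltr_nat.
pose K := (k.+1)`!%:R / b ^+ k.+1.
have K0 : 0 < K by rewrite divr_gt0 ?exprn_gt0 // ltr0n fact_gt0.
exists (Num.max 1 (32 * K)) => n.
have n1 : (0 : R) < n.+1%:R by rewrite ltr0n.
rewrite ler_pdivlMr ?exprn_gt0 // mulrAC -exprD.
case: n n1 => [|n] n1.
  by rewrite powR0 ?gt_eqF // mulr0 oppr0 expR0 expr1n mulr1 le_max lexx.
rewrite le_max; apply/orP; right; rewrite expRN -[X in X <= _]/(_ / _).
set N : R := n.+1%:R; have N0 : 0 < N by rewrite ltr0n.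
have N1 : 1 <= N by rewrite ler1n.
have -> : n.+2%:R = N + 1 by rewrite -natr1.
have Nd : 0 <= b * N `^ dl by rewrite mulr_ge0 ?powR_ge0 // ltW.
have h1 := expR_ge1Dxn k Nd; rewrite ler_pdivrMr ?expR_gt0 //.
have h2 : N ^+ 6 <= (N `^ dl) ^+ k.+1.
  rewrite -[_ ^+ k.+1]powR_mulrn ?powR_ge0 // -powRrM -[leLHS]powR_mulrn ?(ltW N0) //.
  exact: ler_powR.
have h3 : (b * N `^ dl) ^+ k.+1 / (k.+1)`!%:R <= expR (b * N `^ dl) by lra.
apply: (@le_trans _ _ (32 * N ^+ 6)); last first.
  rewrite -mulrA ler_wpM2l //; apply: le_trans (ler_wpM2l (ltW K0) h3).
  have -> : K * ((b * N `^ dl) ^+ k.+1 / (k.+1)`!%:R) = (N `^ dl) ^+ k.+1.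
    rewrite exprMn /K; field.
    by rewrite pnatr_eq0 -lt0n fact_gt0 expf_neq0 ?gt_eqF.
  exact: h2.
apply: (@le_trans _ _ ((2 * N) ^+ 5)).
  by apply: lerXn2r; rewrite ?nnegrE; lra.
rewrite exprMn; have -> : 2 ^+ 5 = 32 :> R by ring.
by rewrite ler_wpM2l // ler_weXn2l.
Qed.

Lemma union_bound d (T : measurableType d) (mu : probability T R) (F : nat -> set T) (c : R) n :
  (forall i, measurable (F i)) -> (forall i, (mu (F i) <= c%:E)%E) ->
  measurable [set x | exists i, (i < n)%N /\ F i x] /\
  (mu [set x | exists i, (i < n)%N /\ F i x] <= (n%:R * c)%:E)%E.
Proof.
move=> mF h; elim: n => [|n [ih1 ih2]].
  rewrite (_ : mkset _ = set0) ?measure0 ?mul0r //; by apply/seteqP; split=> x //= -[i []].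
have -> : [set x | exists i, (i < n.+1)%N /\ F i x] =
    [set x | exists i, (i < n)%N /\ F i x] `|` F n.
  apply/seteqP; split=> x /= => [[i [+ Fi]]|[[i [im Fi]]|Fn]].
  - by rewrite ltnS leq_eqVlt => /orP[/eqP e|im]; [right; rewrite -e|left; exists i].
  - by exists i; split=> //; exact: leqW.
  - by exists n.
split; first exact: measurableU.
apply: le_trans (measureU2 _ ih1 (mF n)) _.
by rewrite -natr1 mulrDl mul1r EFinD; apply: leeD; [exact: ih2|exact: h].
Qed.

End Bounds.

Lemma count_index_iota (R : realType) (Q : pred nat) (a n : nat) :
  (count Q (index_iota a n))%:R = \sum_(t < n) ((a <= t)%N && Q t)%:R :> R.
Proof.
elim: n => [|n ih]; first by rewrite big_ord0 /index_iota sub0n.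
rewrite big_ord_recr /= -ih /index_iota; case: (leqP a n) => an.
  rewrite subSn // -addn1 iotaD count_cat natrD /= addn0 subnKC //.
have -> : (n.+1 - a)%N = 0%N by lia.
have -> : (n - a)%N = 0%N by lia.
by rewrite addr0.
Qed.

(** * Concentration of the frequencies after memory words *)

Section ConditionalLaw.
Context (A : countType) (a0 : A) (R : realType).
Notation path := (pathT int A a0).
Context (mu : probability path R).
Hypothesis stat : forall B : set path, measurable B -> mu (shiftz 1 @^-1` B) = mu B.
Notation pm := (pm mu).

Lemma block_rcons h y (t : int) : (block (rcons h y) (t + 1) : set path) =
  block h t `&` [set x | x (t + 1) = y].
Proof.
apply/seteqP; split=> x; rewrite /block /= size_rcons recent_pa_rcons; first by move/rcons_inj => [-> ->].
by move=> [-> ->].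
Qed.

Lemma measurable_next (t : int) y : measurable [set x : path | x t = y].
Proof. exact: (dm_coord a0 t [set y]). Qed.

Lemma Rintegral_indic (B D : set path) (c : R) : measurable B -> measurable D ->
  \int[mu]_(x in D) (c * \1_B x) = c * fine (mu (B `&` D)).
Proof.
move=> mB mD; have i1 : mu.-integrable D (EFin \o (\1_B : path -> R)).
  apply: (@dm_integrable _ _ _ _ _ _ 1) => //.
    apply: (@dm_ext _ _ _ (fun x : path => if `[< B x >] then 1 else 0)).
      by move=> x; rewrite indicE; case: asboolP => h; [rewrite mem_set|rewrite memNset].
    by apply: (@dm_comp _ _ _ _ (fun v : Prop => if `[< v >] then (1 : R) else 0)); exact/dm_Prop.
  by move=> x; rewrite indicE; case: (x \in B); rewrite ?normr1 ?normr0.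
by rewrite RintegralZl // /Rintegral integral_indic.
Qed.

Lemma dm_scaled_indic (B : set path) (c : R) : measurable B -> dm (fun x => c * \1_B x).
Proof.
move=> mB; apply: (@dm_ext _ _ _ (fun x : path => if `[< B x >] then c else 0)).
  by move=> x; rewrite indicE; case: asboolP => h; [rewrite mem_set // mulr1|rewrite memNset // mulr0].
by apply: (@dm_comp _ _ _ _ (fun v : Prop => if `[< v >] then c else 0)); exact/dm_Prop.
Qed.

Lemma pm_split h y : pm h = pm (rcons h y) + fine (mu (block h (-1) `&` ~` [set x | x 0 = y])).
Proof.
have mb := measurable_block a0 h (-1); have mn := measurable_next 0 y.
apply: EFin_inj; rewrite EFinD -(pmE_at stat h (-1)) -pmE -[0 : int](addNr 1) block_rcons.
rewrite -mu_fin; last by apply: measurableI => //; exact: measurableC.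
rewrite -measureU; last 3 first.
- exact: measurableI.
- by apply: measurableI => //; exact: measurableC.
- by apply/seteqP; split=> x //= -[[_ h1] [_ h2]].
by rewrite -setIUr setUv setIT.
Qed.

(* Letters that never follow z ++ w are harmless: their conditional probabilities given
   z ++ w are 0, and conditional probabilities sum to 1 on both sides. *)
Lemma memory_word_cond w : memory_word mu w -> forall z y,
  pm (rcons (z ++ w) y) = pm (rcons w y) / pm w * pm (z ++ w).
Proof.
move=> mw; have pos u : pm u != 0 -> 0 < pm u by rewrite lt0r pm_ge0 andbT.
have zero u y : pm u = 0 -> pm (rcons u y) = 0.
  by move=> e; apply/eqP; rewrite eq_le pm_ge0 andbT -e pm_rcons_le.
case=> [|b z] y.
  rewrite /=; case: (eqVneq (pm w) 0) => [e|ne]; last by rewrite divfK.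
  by rewrite e mulr0 zero.
set h := (b :: z) ++ w; case: (eqVneq (pm h) 0) => [e|ne]; first by rewrite e mulr0 zero.
have ph := pos _ ne; have pw : 0 < pm w by apply: lt_le_trans ph (pm_suffix _ _ _).
(* An equality if the letter a can follow h, and trivial otherwise. *)
have le1 a : pm w * pm (rcons h a) <= pm h * pm (rcons w a).
  case: (eqVneq (pm (rcons h a)) 0) => [->|ne']; first by rewrite mulr0 mulr_ge0 // pm_ge0.
  have := mw (b :: z) a isT (pos _ ne'); rewrite -/h => /eqP.
  rewrite eqr_div ?(gt_eqF ph) ?(gt_eqF pw) // => /eqP e.
  by rewrite [leLHS]mulrC -e mulrC.
pose Bc u : set path := block u (-1) `&` ~` [set x | x 0 = y].
have mBc u : measurable (Bc u).
  by apply: measurableI; [exact: measurable_block|apply: measurableC; exact: measurable_next].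
(* The same inequality summed over the letters other than y. Over all letters both sides have the
   total pm w * pm h, so neither inequality can be strict. *)
have le2 : pm w * fine (mu (Bc h)) <= pm h * fine (mu (Bc w)).
  rewrite -[Bc h]setIT -[Bc w]setIT -!Rintegral_indic //.
  have b01 (c : R) u : 0 <= c <= 1 -> forall x, 0 <= c * \1_(Bc u) x <= 1.
    move=> /andP[c0 c1] x; rewrite indicE; case: (x \in _); rewrite ?mulr1 ?mulr0 ?c0 ?c1 //.
    by rewrite lexx ler01.
  apply: (@le_Rintegral_fibers _ _ _ _ _ (fun x : path => x 0) _ _ 1).
  - exact: dm_coord.
  - exact: dm_scaled_indic.
  - exact: dm_scaled_indic.
  - by apply: b01; rewrite pm_ge0 pm_le1.
  - by apply: b01; rewrite pm_ge0 pm_le1.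
  move=> x0; have mD := measurable_next 0 (x0 0).
  rewrite !Rintegral_indic //.
  case: (eqVneq (x0 0) y) => [e|e].
    have E u : Bc u `&` [set x | x 0 = x0 0] = set0.
      by apply/seteqP; split=> x //= -[[_ h1] h2]; apply: h1; exact: etrans h2 e.
    by rewrite !E measure0 /= !mulr0.
  have E u : Bc u `&` [set x | x 0 = x0 0] = block (rcons u (x0 0)) 0.
    rewrite -[0 : int](addNr 1) block_rcons addNr; apply/seteqP; split=> x /=; first by case=> -[].
    by move=> [h1 h2]; split=> //; split=> // h3; move/eqP: e; apply; exact: etrans (esym h2) h3.
  by rewrite !E; exact: le1.
have s1 := pm_split h y; have s2 := pm_split w y.
have := le1 y; rewrite -/(Bc h) in s1 *; rewrite -/(Bc w) in s2 *.
move=> le3; apply: (mulfI (negbT (gt_eqF pw))).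
have -> : pm w * (pm (rcons w y) / pm w * pm h) = pm h * pm (rcons w y).
  by field; rewrite gt_eqF.
by nra.
Qed.

End ConditionalLaw.

Section Concentration.
Context (A : countType) (a0 : A) (R : realType).
Notation path := (pathT int A a0).
Context (mu : probability path R).
Hypothesis stat : forall B : set path, measurable B -> mu (shiftz 1 @^-1` B) = mu B.
Notation pm := (pm mu).

Section OneWindow.
(* The word observed at times t0 - m, .., t0 is u y, where u has length m, and w is the
   suffix of u of length k. *)
Variables (n t0 m k : nat) (sg : bool) (c : R).
Hypotheses (t0n : (t0 < uphalf n)%N) (mt0 : (m <= t0)%N) (km : (k <= m)%N).
Hypothesis c01 : 0 <= c <= 1 / 2.

Definition win_u (x : path) := recent (pa x (t0%:Z - 1)) m.
Definition win_w (x : path) := recent (pa x (t0%:Z - 1)) k.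
Definition win_ratio (x : path) : R := pm (rcons (win_w x) (x t0)) / pm (win_w x).

(** When w is a memory word, the active times t < n are exactly those counted in the denominator of
    the frequency after u. *)
Definition win_active (t : nat) (x : path) : Prop :=
  [/\ memory_word mu (win_w x), ((uphalf n + m).-1 <= t)%N & recent (pa x t) m = win_u x].

(** The indicator that the next letter repeats the last letter of the window, minus its conditional
    probability; the sign [sg] gives both tails. *)
Definition win_psi (t : nat) (x : path) (a : A) : R :=
  if `[<win_active t x>] then (-1) ^+ sg * c * ((a == x t0)%:R - win_ratio x) else 0.

Definition win_V (t : nat) (x : path) : R := if `[<win_active t x>] then c else 0.

Lemma win_uE x : recent (pa x t0) m.+1 = rcons (win_u x) (x t0).
Proof. by rewrite -[t0%:Z](subrK 1) recent_pa_rcons /win_u subrK. Qed.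

(** The window lies in the first half of the data, hence in the past of every active time; this
    makes the increments adapted. *)
Lemma win_late t x : win_active t x -> (t0 <= t)%N.
Proof. by case=> _ h _; move: h t0n; lia. Qed.

Lemma win_adapted_aux t x x' : hist t x = hist t x' -> (t0 <= t)%N ->
  [/\ x t0 = x' t0, win_u x = win_u x', win_w x = win_w x' &
  recent (pa x t) m = recent (pa x' t) m].
Proof.
move=> /hist_agree h t0t.
have e : recent (pa x t0) m.+1 = recent (pa x' t0) m.+1.
  by apply: (agree_recent h) => //; rewrite ltnS.
have eu : win_u x = win_u x' by move: e; rewrite !win_uE => /rcons_inj[].
split=> //; first exact: h.
  exact: recent_leq km eu.
by apply: (agree_recent h) => //; apply: leqW; apply: leq_trans mt0 t0t.
Qed.

Lemma win_active_adapted t x x' : hist t x = hist t x' -> win_active t x -> win_active t x'.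
Proof.
move=> h ax; have [e1 e2 e3 e4] := win_adapted_aux h (win_late ax).
by case: ax => a1 a2 a3; split=> //; [rewrite -e3|rewrite -e4 -e2].
Qed.

Lemma win_adapted t x x' : hist t x = hist t x' ->
  win_psi t x = win_psi t x' /\ win_V t x = win_V t x'.
Proof.
move=> h; rewrite /win_psi /win_V.
case: (pselect (win_active t x)) => ax.
  have ax' := win_active_adapted h ax; rewrite !asboolT //.
  have [e1 e2 e3 e4] := win_adapted_aux h (win_late ax).
  by split=> //; apply/funext => a; rewrite /win_ratio e1 e3.
have ax' : ~ win_active t x' by move/(win_active_adapted (esym h)).
by rewrite !asboolF.
Qed.

Lemma win_ratio01 x : 0 <= win_ratio x <= 1.
Proof.
rewrite /win_ratio divr_ge0 ?pm_ge0 //=; case: (eqVneq (pm (win_w x)) 0) => [->|ne].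
  by rewrite invr0 mulr0.
by rewrite ler_pdivrMr ?mul1r ?pm_rcons_le // lt0r ne pm_ge0.
Qed.

Lemma win_bounded t x a : `|win_psi t x a| <= win_V t x.
Proof.
have /andP[c0 _] := c01; have /andP[r0 r1] := win_ratio01 x.
rewrite /win_psi /win_V; case: asboolP => _; last by rewrite normr0.
rewrite 2!normrM normrX normrN normr1 expr1n mul1r (ger0_norm c0) -[leRHS]mulr1 ler_wpM2l //.
by rewrite ler_norml; case: (a == _); rewrite ?mulr1n ?mulr0n; apply/andP; split; lra.
Qed.

Lemma win_small t x : win_V t x <= 1 / 2.
Proof. by rewrite /win_V; case: asboolP => _; [have /andP[] := c01|rewrite divr_ge0]. Qed.

(** At an active time the history ends with u, hence with the memory word w, and [memory_word_cond]
    gives the exact conditional probability of the next letter, however long the history. *)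
Lemma win_centered (t : nat) x0 :
  \int[mu]_(x in [set x | hist t x = hist t x0]) win_psi t x0 (x (t%:Z + 1)) = 0.
Proof.
pose D : set path := [set x | hist t x = hist t x0]; rewrite -/D.
have mD : measurable D by exact: (dm_hist a0 t [set hist t x0]).
case: (pselect (win_active t x0)) => ax; last first.
  rewrite (_ : \int[mu]_(x in D) _ = \int[mu]_(x in D) (fun=> 0) x).
    by rewrite Rintegral_cst // mul0r.
  by apply: eq_Rintegral => x _; rewrite /win_psi asboolF.
pose y := x0 t0; pose r := win_ratio x0; pose s : R := (-1) ^+ sg * c.
pose B := [set x : path | x (t%:Z + 1) = y].
have mB : measurable B by exact: measurable_next.
have DE : D = block (hist t x0) t by rewrite /block /D /hist size_recent.
have late := win_late ax; have [mw _ ew] := ax.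
have [z hz] : exists z, hist t x0 = z ++ win_w x0.
  have mt : (m <= t.+1)%N by apply: leqW; exact: leq_trans mt0 late.
  have kt : (k <= t.+1)%N := leq_trans km mt.
  have [z _ e] := recentD (pa x0 t) k (t.+1 - k)%N.
  exists z; rewrite /hist -(subnKC kt) e; congr cat.
  exact: recent_leq km ew.
have eP : fine (mu (B `&` D)) = r * fine (mu D).
  rewrite setIC DE -block_rcons (pmE_at stat) (pmE_at stat) /= hz.
  exact: memory_word_cond.
rewrite (_ : \int[mu]_(x in D) _ = \int[mu]_(x in D) (s * \1_B x + (- (s * r)) * \1_setT x)).
  have i1 (C : set path) q : measurable C -> mu.-integrable D (EFin \o (fun x => q * \1_C x)).
    move=> mC; apply: (@dm_integrable _ _ _ _ _ _ `|q|) => //; first exact: dm_scaled_indic.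
    by move=> x; rewrite indicE normrM; case: (x \in _); rewrite ?normr1 ?normr0 ?mulr1 ?mulr0.
  rewrite RintegralD //; try exact: i1.
  by rewrite !Rintegral_indic // setTI eP; ring.
apply: eq_Rintegral => x _; rewrite /win_psi asboolT // indicT mulr1 -/s -/y -/r.
rewrite mulrBr; congr (_ * _ - _); rewrite indicE; congr (nat_of_bool _)%:R.
by apply/eqP/idP; rewrite inE.
Qed.

Definition win_sum (x : path) : R := comp_sum win_psi win_V n x.

Lemma win_bound (b : R) : (mu [set x | (b <= win_sum x)%R] <= (expR (- b))%:E)%E.
Proof.
apply: exponential_bound; [exact: win_adapted|exact: win_bounded|exact: win_small|].
exact: win_centered.
Qed.

Lemma measurable_win (b : R) : measurable [set x : path | (b <= win_sum x)%R].
Proof.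
apply: dm_measurable; apply: (@dm_comp _ _ _ _ (fun r : R => is_true (b <= r))).
by apply: dm_comp_sum; exact: win_adapted.
Qed.

Lemma win_sumE x : memory_word mu (win_w x) ->
  let num : R := (occ x (uphalf n + m) n (rcons (win_u x) (x t0)))%:R in
  let den : R := (occ x (uphalf n + m).-1 n.-1 (win_u x))%:R in
  win_sum x = (-1) ^+ sg * c * (num - win_ratio x * den) - 2 * c ^+ 2 * den.
Proof.
move=> mw num den.
have n0 : (0 < n)%N by case: n t0n => [|//]; rewrite ltn0.
(* Numerator and denominator become sums over the same times t once the occurrences of u y are
   indexed by the end of u. *)
pose a := (uphalf n + m).-1; have ea : (uphalf n + m)%N = a.+1 by rewrite /a prednK //; lia.
have denE : den = \sum_(t < n) ((a <= t)%N && (recent (pa x t) m == win_u x))%:R.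
  rewrite /den -/a /occ prednK // -(count_index_iota R (fun t => recent (pa x t) m == win_u x)).
  congr _%:R; apply: eq_count => t; by rewrite str_recent size_recent.
have numE : num = \sum_(t < n) ((a <= t)%N && ((recent (pa x t) m == win_u x) &&
    (x (t%:Z + 1) == x t0)))%:R.
  rewrite /num ea /occ size_rcons size_recent.
  rewrite -(count_index_iota R (fun t => (recent (pa x t) m == win_u x) && (x (t%:Z + 1) == x t0))).
  congr _%:R; rewrite /index_iota subSS -[a.+1]add1n iotaDl count_map; apply: eq_count => t /=.
  have -> : (1 + t)%N%:Z = t%:Z + 1 by lia.
  by rewrite str_recent recent_pa_rcons eqseq_rcons.
rewrite numE denE /win_sum /comp_sum !mulr_sumr -!sumrB mulr_sumr -sumrB; apply: eq_bigr => t _.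
have bE : `[<win_active t x>] = (a <= t)%N && (recent (pa x t) m == win_u x).
  apply/asboolP/andP; first by case=> _ h1 h2; split=> //; exact/eqP.
  by move=> [h1 /eqP h2]; split.
rewrite /win_psi /win_V bE; case: (a <= t)%N => /=; last by ring.
by case: (recent _ _ == _) => /=; ring.
Qed.

End OneWindow.

Section AlmostSure.
Context (beta gamma : R).
Hypotheses (beta0 : 0 < beta) (gamma0 : 0 < gamma) (bg : 2 * beta + gamma < 1).

(** For a deviation q/2 with q = n^(-beta) the exponent per occurrence is c q/2 - 2 c^2; the choice
    c = q/8 maximizes it, with value q^2/32. *)
Definition win_c (n : nat) : R := n%:R `^ (- beta) / 8.

(** The exponent q^2/32 per occurrence times n^(1-gamma), which bounds the number of occurrences
    from below. *)
Definition win_level (n : nat) : R := n%:R `^ (1 - gamma - 2 * beta) / 32.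

Definition bad_window (n t0 m k : nat) (sg : bool) : set path :=
  if [&& (t0 < uphalf n)%N, (m <= t0)%N & (k <= m)%N] then
    [set x | (win_level n <= win_sum n t0 m k sg (win_c n) x)%R] else set0.

Lemma win_c01 n : (0 < n)%N -> 0 <= win_c n <= 1 / 2.
Proof.
move=> n0; rewrite /win_c divr_ge0 ?powR_ge0 //=.
have : n%:R `^ (- beta) <= n%:R `^ 0 :> R.
  by apply: ler_powR; [rewrite ler1n|rewrite oppr_le0 ltW].
by rewrite powRr0; lra.
Qed.

Lemma bad_window_bound n t0 m k sg :
  measurable (bad_window n t0 m k sg) /\
  (mu (bad_window n t0 m k sg) <= (expR (- win_level n))%:E)%E.
Proof.
rewrite /bad_window; case: ifP => [/and3P[h1 h2 h3]|_]; last first.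
  by split=> //; rewrite measure0 lee_fin expR_ge0.
have n0 : (0 < n)%N by case: n h1 => [|//]; rewrite ltn0.
split; [by apply: measurable_win => //; exact: win_c01|apply: win_bound => //; exact: win_c01].
Qed.

(** All positions, word lengths, suffix lengths and signs: 2 (n + 1)^3 events. *)
Definition bad_windows (n : nat) : set path := [set x | exists i, (i < n.+1)%N /\ exists j, (j < n.+1)%N /\
  exists k, (k < n.+1)%N /\ exists b, (b < 2)%N /\ bad_window n i j k (b == 1)%N x].

Lemma bad_windows_bound n : measurable (bad_windows n) /\
  (mu (bad_windows n) <= (n.+1%:R ^+ 3 * (2 * expR (- win_level n)))%:E)%E.
Proof.
have h3 i j k : measurable [set x | exists b, (b < 2)%N /\ bad_window n i j k (b == 1)%N x] /\
    (mu [set x | exists b, (b < 2)%N /\ bad_window n i j k (b == 1)%N x] <=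
      (2%:R * expR (- win_level n))%:E)%E.
  by apply: union_bound => b; have [] := bad_window_bound n i j k (b == 1)%N.
have h2 i j := union_bound n.+1 (fun k => (h3 i j k).1) (fun k => (h3 i j k).2).
have h1 i := union_bound n.+1 (fun j => (h2 i j).1) (fun j => (h2 i j).2).
have h0 := union_bound n.+1 (fun i => (h1 i).1) (fun i => (h1 i).2).
split; first exact: h0.1.
by apply: le_trans h0.2 _; rewrite lee_fin !mulrA -expr2 -exprSr.
Qed.

(** The occurrence of the word in the first half supplies the window, whose last letter is y; the
    sign of the deviation selects the tail. *)
Lemma not_bad_concentrated x N : (forall n, (N <= n)%N -> ~ bad_windows n x) ->
  concentrated mu beta gamma x.
Proof.
move=> hx; exists (maxn 1 N) => n; rewrite geq_max => /andP[n1 nN] z w y mw.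
set u := z ++ w; move=> [[_ [t0 /andP[mt0 t0n] et0]] [_ hocc]].
rewrite leNgt; apply/negP => hdev; apply: (hx n nN).
pose m := size u; pose k := size w.
have km : (k <= m)%N by rewrite /k /m size_cat leq_addl.
have t0u : (t0 < uphalf n)%N by move: t0n n1; lia.
have t0n1 : (t0 < n.+1)%N by move: t0u; lia.
have [eu ey] : win_u t0 m x = u /\ x t0 = y.
  by move: et0; rewrite str_recentS win_uE => /rcons_inj[].
have ew : win_w t0 k x = w.
  have em : m = (k + (m - k))%N by rewrite subnKC.
  apply/esym; apply: (@recent_suffix _ (pa x (t0%:Z - 1)) k (m - k)%N z).
    by rewrite -em.
  by rewrite /m /k size_cat addnK.
have rE : win_ratio t0 k x = pm (rcons w y) / pm w by rewrite /win_ratio ew ey.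
have n0 : (0 : R) < n%:R by rewrite ltr0n.
have key (sg : bool) : 0 < (-1) ^+ sg * (freq R x n u y - pm (rcons w y) / pm w) - n%:R `^ (- beta) / 2 ->
    bad_window n t0 m k sg x.
  move=> hs; rewrite /bad_window t0u mt0 km /=.
  rewrite (win_sumE _ _ (n := n)) //; last by rewrite ew.
  rewrite eu ey rE; move: hs hocc; rewrite /freq -/m.
  set num : R := (occ _ _ _ (rcons u y))%:R; set den : R := (occ _ _ _ u)%:R.
  set r := pm _ / pm _ => hs hocc.
  have den0 : 0 <= den by rewrite /den.
  (* Every occurrence of u y contains one of u, so the denominator exceeds n^(1-gamma) as well. *)
  have numden : num <= den.
    rewrite /num /den ler_nat /occ size_rcons -/m prednK //.
    have -> : (uphalf n + m)%N = (uphalf n + m).-1.+1 by rewrite prednK //; lia.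
    rewrite /index_iota subSS -[(uphalf n + m).-1.+1]add1n iotaDl count_map.
    have -> : (1 + (uphalf n + m).-1)%N = (uphalf n + m).-1.+1 by rewrite add1n.
    apply: sub_count => t /=; have -> : (1 + t)%N%:Z = t%:Z + 1 by lia.
    by rewrite !str_recent recent_pa_rcons eqseq_rcons => /andP[].
  have B0 : 0 < n%:R `^ (- beta) by exact: powR_gt0.
  have dpos : 0 < den by apply: lt_le_trans numden; apply: le_lt_trans hocc; exact: powR_ge0.
  have e1 : n%:R `^ (1 - gamma - 2 * beta) = n%:R `^ (1 - gamma) * (n%:R `^ (- beta)) ^+ 2 :> R.
    have pD (a b : R) : n%:R `^ (a + b) = n%:R `^ a * n%:R `^ b.
      by apply: powRD; rewrite (gt_eqF n0) implybT.
    have -> : 1 - gamma - 2 * beta = (1 - gamma) + ((- beta) + (- beta)) by ring.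
    by rewrite !pD expr2.
  rewrite /win_level /win_c /= e1; move: B0 hs; set q := n%:R `^ (- beta) => B0 hs.
  have h2 : n%:R `^ (1 - gamma) <= den by apply: ltW (lt_le_trans hocc numden).
  have h3 : q / 2 * den <= (-1) ^+ sg * (num - r * den).
    have -> : (-1) ^+ sg * (num - r * den) = (-1) ^+ sg * (num / den - r) * den.
      by field; rewrite gt_eqF.
    by rewrite ler_pM2r //; lra.
  have h4 : q / 8 * (q / 2 * den) <= q / 8 * ((-1) ^+ sg * (num - r * den)).
    by rewrite ler_wpM2l // divr_ge0 // ltW.
  have h5 : n%:R `^ (1 - gamma) * q ^+ 2 <= den * q ^+ 2 by rewrite ler_wpM2r ?sqr_ge0.
  have e2 : (-1) ^+ sg * (q / 8) * (num - r * den) = q / 8 * ((-1) ^+ sg * (num - r * den)) by ring.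
    rewrite e2; apply: (@le_trans _ _ (den * q ^+ 2 / 32)); first by lra.
    by lra.
  exact: win_c01.
exists t0; split=> //; exists m; split; first exact: leq_ltn_trans mt0 t0n1.
exists k; split; first exact: leq_ltn_trans (leq_trans km mt0) t0n1.
case: (lerP 0 (freq R x n u y - pm (rcons w y) / pm w)) => hsg.
  exists 0%N; split=> //; apply: (key false); rewrite expr0 mul1r subr_gt0.
  by move: hdev; rewrite ger0_norm.
exists 1%N; split=> //; apply: (key true); rewrite expr1 mulN1r subr_gt0.
by move: hdev; rewrite ltr0_norm.
Qed.

Lemma ae_concentrated : {ae mu, forall x, concentrated mu beta gamma x}.
Proof.
have d0 : 0 < 1 - gamma - 2 * beta.
  by move: bg; rewrite -subr_gt0; congr (_ < _); ring.
have b0 : (0 : R) < 32^-1 by rewrite invr_gt0.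
have [C hC] := exp_decay d0 b0.
have hb n : (mu (bad_windows n) <= ((2 * C) / n.+1%:R ^+ 2)%:E)%E.
  apply: le_trans (bad_windows_bound n).2 _; rewrite lee_fin mulrCA -mulrA ler_wpM2l //.
  by apply: le_trans (hC n); rewrite /win_level [_ / 32]mulrC.
apply: ae_imp (Borel_Cantelli_sq (fun n => (bad_windows_bound n).1) hb) => x [N hN].
exact: not_bad_concentrated hN.
Qed.

End AlmostSure.
End Concentration.

(** * Prediction *)

Section StationaryIntegrals.
Context (A : countType) (a0 : A) (R : realType).
Notation path := (pathT int A a0).
Context (mu : probability path R).
Hypothesis stat : forall B : set path, measurable B -> mu (shiftz 1 @^-1` B) = mu B.
Notation pm := (pm mu).

Lemma Rintegral_shiftz (n : int) (D : set path) (u : path -> R) (M : R) :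
  measurable D -> dm u -> (forall x, `|u x| <= M) ->
  \int[mu]_(x in shiftz n @^-1` D) u (shiftz n x) = \int[mu]_(x in D) u x.
Proof.
move=> mD du bu; rewrite /Rintegral; congr fine.
have ms := measurable_shiftz (a0 := a0) n.
have i1 : mu.-integrable (shiftz n @^-1` D : set path) ((EFin \o u) \o shiftz n).
  apply: (@dm_integrable _ _ _ _ (fun x : path => u (shiftz n x)) _ M) => //.
    exact: dm_shiftz.
  exact: measurable_shiftP.
have mu_ : measurable_fun setT (EFin \o u).
  by apply: (dm_measurable_fun (V := \bar R)); exact: (@dm_comp _ _ _ _ EFin).
rewrite -(@integral_pushforward _ _ path path R (shiftz n) ms mu D (EFin \o u)) //.
apply: eq_measure_integral => B mB _; exact: stat_int.
Qed.

Context (f : A -> R) (M : R).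
Hypothesis bf : forall a, `|f a| <= M.

Lemma dm_letter (t : int) : dm (fun x : path => f (x t)).
Proof. by apply: dm_comp; exact: dm_coord. Qed.

Definition next_integral (s : seq A) : R := \int[mu]_(x in block s 0) f (x 1).

(** The conditional mean of f(X_1) given that the past ends with s; it is 0 when s has probability
    0. *)
Definition next_mean (s : seq A) : R := next_integral s / pm s.

Lemma next_integral_at (s : seq A) (t : int) :
  \int[mu]_(x in block s t) f (x (t + 1)) = next_integral s.
Proof.
rewrite /next_integral -(@Rintegral_shiftz t (block s 0) (fun x => f (x 1)) M) //.
- rewrite -block_shift add0r; apply: eq_Rintegral => x _; rewrite /shiftz addrC //.
- exact: measurable_block.
- exact: dm_letter.
Qed.

Lemma integrable_letter (D : set path) (t : int) : measurable D ->
  mu.-integrable D (EFin \o (fun x => f (x t))).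
Proof. by apply: (@dm_integrable _ _ _ _ _ _ M) => //; exact: dm_letter. Qed.

Lemma integrable_const (D : set path) (c : R) : measurable D ->
  mu.-integrable D (EFin \o (fun=> c)).
Proof. by apply: (@dm_integrable _ _ _ _ _ _ `|c|) => //; exact: dm_cst. Qed.

Lemma Rintegral_const (D : set path) (c : R) : measurable D ->
  \int[mu]_(x in D) c = c * fine (mu D).
Proof. by move=> mD; exact: Rintegral_cst. Qed.

Lemma M_ge0 : 0 <= M.
Proof. by apply: le_trans (bf a0). Qed.

Lemma next_integral_le s : `|next_integral s| <= M * pm s.
Proof.
have mD := measurable_block a0 s 0.
apply: le_trans (le_normr_Rintegral mD (integrable_letter 1 mD)) _.
rewrite -[pm s]/(fine (mu (block s 0))) -Rintegral_cst //; apply: le_Rintegral => //.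
- by apply: (@dm_integrable _ _ _ _ _ _ M) => [|x|//]; [apply: dm_comp; exact: dm_letter|rewrite normr_id].
- exact: integrable_const.
Qed.

Lemma next_meanK s : next_mean s * pm s = next_integral s.
Proof.
rewrite /next_mean; case: (eqVneq (pm s) 0) => [e|ne]; last by rewrite divfK.
by apply/esym/eqP; rewrite e mulr0 -normr_le0; have := next_integral_le s; rewrite e mulr0.
Qed.

Lemma next_mean_le s : `|next_mean s| <= M.
Proof.
rewrite /next_mean; case: (eqVneq (pm s) 0) => [->|ne].
  by rewrite invr0 mulr0 normr0 M_ge0.
have p0 : 0 < pm s by rewrite lt0r ne pm_ge0.
by rewrite normrM normfV (gtr0_norm p0) ler_pdivrMr // next_integral_le.
Qed.

(** By [memory_word_cond] the next letter has the same law given z ++ w as given w. The sum over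
    letters is an integral over the fibres of the next letter, compared in both directions. *)
Lemma next_mean_memory w z : memory_word mu w -> 0 < pm (z ++ w) ->
  next_mean (z ++ w) = next_mean w.
Proof.
move=> mw pz; have pw : 0 < pm w := lt_le_trans pz (pm_suffix mu z w).
(* M is added to f because the comparison on fibres takes nonnegative integrands. *)
pose I (c : R) (s : seq A) := \int[mu]_x (c * (f (x 1) + M) * \1_(block s 0 : set path) x).
have mB s := measurable_block a0 s 0.
have g0 a : 0 <= f a + M by have := bf a; rewrite ler_norml => /andP[? _]; lra.
have g2 a : f a + M <= 2 * M by have := bf a; rewrite ler_norml => /andP[_ ?]; lra.
have dI c s : dm (fun x : path => c * (f (x 1) + M) * \1_(block s 0 : set path) x).
  apply: (@dm_comp2 _ _ A R R (fun a v => c * (f a + M) * v)); first exact: dm_coord.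
  apply: (@dm_ext _ _ _ (fun x => 1 * \1_(block s 0 : set path) x)); first by move=> x; rewrite mul1r.
  exact: dm_scaled_indic.
have bI c s : 0 <= c <= 1 -> forall x : path, 0 <= c * (f (x 1) + M) * \1_(block s 0 : set path) x <= 2 * M.
  move=> /andP[c0 c1] x; have h0 : 0 <= c * (f (x 1) + M) by rewrite mulr_ge0.
  have h1 : c * (f (x 1) + M) <= 2 * M by apply: le_trans (g2 (x 1)); rewrite ler_piMl.
  rewrite indicE; case: (x \in _); rewrite ?mulr1 ?mulr0 ?h0 ?h1 //.
  by rewrite lexx mulr_ge0 // M_ge0.
have IE c s : I c s = c * (next_integral s + M * pm s).
  have -> : I c s = \int[mu]_(x in block s 0) (c * (f (x 1) + M)).
    rewrite /I /Rintegral; congr fine; rewrite [RHS]integral_mkcond; apply: eq_integral => x _.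
    rewrite patchE indicE; case: (x \in _); by rewrite ?mulr1 ?mulr0.
  have i1 : mu.-integrable (block s 0 : set path) (EFin \o (fun x => f (x 1) + M)).
    apply: (@dm_integrable _ _ _ _ _ _ (2 * M)) => //.
      by apply: (@dm_comp _ _ _ _ (fun v => v + M)); exact: dm_letter.
    by move=> x; rewrite ger0_norm.
  rewrite RintegralZl // RintegralD //; [|exact: integrable_letter|exact: integrable_const].
  by rewrite Rintegral_cst.
have le c c' s s' : 0 <= c <= 1 -> 0 <= c' <= 1 ->
    (forall a, c * pm (rcons s a) = c' * pm (rcons s' a)) -> I c s <= I c' s'.
  move=> hc hc' h; apply: (@le_Rintegral_fibers _ _ _ _ _ (fun x : path => x 1) _ _ (2 * M)).
  - exact: dm_coord.
  - exact: dI.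
  - exact: dI.
  - exact: bI.
  - exact: bI.
  move=> x0; have mD := measurable_next a0 1 (x0 1).
  have E (k : R) u : \int[mu]_(x in [set x | x 1 = x0 1]) (k * (f (x 1) + M) * \1_(block u 0 : set path) x) =
      (f (x0 1) + M) * (k * pm (rcons u (x0 1))).
    have -> : pm (rcons u (x0 1)) = fine (mu (block u 0 `&` [set x | x 1 = x0 1])).
      have := pmE_at stat (rcons u (x0 1)) (0 + 1); rewrite block_rcons add0r => ->.
      by [].
    rewrite mulrA -Rintegral_indic //; apply: eq_Rintegral => x; rewrite inE /= => ->.
    by congr (_ * _); rewrite mulrC.
  by rewrite !E h.
have h01 s : 0 <= pm s <= 1 by rewrite pm_ge0 pm_le1.
have key a : pm w * pm (rcons (z ++ w) a) = pm (z ++ w) * pm (rcons w a).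
  by rewrite (memory_word_cond stat mw); field; rewrite gt_eqF.
have : I (pm w) (z ++ w) = I (pm (z ++ w)) w by apply/eqP; rewrite eq_le !le.
rewrite !IE => e; rewrite /next_mean; apply/eqP; rewrite eqr_div ?(gt_eqF pz) ?(gt_eqF pw) //; apply/eqP.
by move: e; move: (next_integral _) (next_integral _) (pm _) (pm _) => i j p q; lra.
Qed.

End StationaryIntegrals.

(** * Law of large numbers for the prediction errors *)

Section StrongLaw.
Context (A : countType) (a0 : A) (R : realType).
Notation path := (pathT int A a0).
Context (mu : probability path R).
Hypothesis stat : forall B : set path, measurable B -> mu (shiftz 1 @^-1` B) = mu B.
Context (l : nat -> nat) (beta gamma : R).
Hypothesis adm : admissible l.
Notation lambda := (lambda l beta gamma).
Notation pm := (pm mu).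

(** The exponential bound runs over deterministic times t, the estimator over the indices j. *)
Lemma sum_over_lambda (x : path) n T (F : nat -> R) : good l x -> (lambda x n <= T)%N ->
  \sum_(t < T) (if `[<exists j, (j < n)%N /\ lambda x j = t>] then F t else 0) =
  \sum_(j < n) F (lambda x j).
Proof.
move=> gx; elim: n T => [|n ih] T nT.
  by rewrite big_ord0 big1 // => t _; rewrite asboolF // => -[j []].
have nT' : (lambda x n < T)%N by apply: leq_trans nT; apply: lambda_lt.
rewrite big_ord_recr /= -(ih T (ltnW nT')).
have -> : F (lambda x n) = \sum_(t < T) (if t == Ordinal nT' then F t else 0).
  by rewrite -big_mkcond big_pred1_eq.
rewrite -big_split /=; apply: eq_bigr => t _.
case: (eqVneq t (Ordinal nT')) => [->|ne] /=.
  rewrite asboolT; last by exists n.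
  rewrite asboolF ?add0r // => -[j [jn e]].
  by have := lambda_lt beta gamma adm gx jn; rewrite e ltnn.
rewrite addr0; congr (if _ then _ else _); apply/asboolP/asboolP => -[j [jn e]].
  move: jn; rewrite ltnS leq_eqVlt => /orP[/eqP ej|jn]; last by exists j.
  by move/eqP: ne; case; apply: val_inj; rewrite /= -e ej.
by exists j; split=> //; exact: leqW.
Qed.

Lemma increasing_union_bound d (T : measurableType d) (P : probability T R) (C : (set T)^nat) (c : \bar R) :
  (forall n, measurable (C n)) -> (forall m n, (m <= n)%N -> C m `<=` C n) ->
  (forall n, (P (C n) <= c)%E) -> (P (\bigcup_n C n) <= c)%E.
Proof.
move=> mC inc h.
have := @nondecreasing_cvg_mu _ _ _ P C mC (bigcupT_measurable _ mC) _.
have hn : nondecreasing_seq C by move=> m n mn; apply/subsetPset; exact: inc.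
move=> /(_ hn) cv; rewrite -(cvg_lim _ cv) //; apply: lime_le; first exact: cvgP cv.
exact: nearW.
Qed.

Section OneSided.
Context (f : A -> R) (M : R).
Hypotheses (bf : forall a, `|f a| <= M) (M1 : 1 <= M).
Notation next_mean := (next_mean mu f).

Definition innovation (x : path) (j : nat) : R :=
  f (x ((lambda x j)%:Z + 1)) - next_mean (hist (lambda x j) x).

Section FixedLength.
Variables (e : R) (n : nat).
Hypothesis e01 : 0 < e <= 1.

(** The exponential bound requires that activity be decided by the history on every path, while
    [lambda_agree] compares good paths. Quantifying over good paths with the same history makes it
    adapted by construction. *)
Definition sl_active (t : nat) (x : path) : Prop := exists x' : path, [/\ good l x',
  hist t x' = hist t x & exists j, (j < n)%N /\ lambda x' j = t].

(** Maximizes c e - 8 c^2 M^2, the exponent per prediction when V = 2 c M; the maximum e^2/(32 M^2)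
    is the rate in [sl_level]. *)
Let c := e / (16 * M ^+ 2).

Definition sl_psi (t : nat) (x : path) (a : A) : R :=
  if `[<sl_active t x>] then c * (f a - next_mean (hist t x)) else 0.

Definition sl_V (t : nat) (x : path) : R := if `[<sl_active t x>] then c * (2 * M) else 0.

Lemma sl_active_hist t x x' : hist t x = hist t x' -> sl_active t x -> sl_active t x'.
Proof. by move=> h [y [h1 h2 h3]]; exists y; split=> //; rewrite h2. Qed.

Lemma sl_activeE t x : good l x -> sl_active t x <-> exists j, (j < n)%N /\ lambda x j = t.
Proof.
move=> gx; split; last by move=> h; exists x.
move=> [x' [gx' /hist_agree h [j [jn ej]]]]; exists j; split=> //.
exact: (lambda_agree adm gx' gx h ej).
Qed.

Lemma M_gt0 : 0 < M. Proof. exact: lt_le_trans ltr01 M1. Qed.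

Lemma c_gt0 : 0 < c.
Proof. by have /andP[e0 _] := e01; rewrite divr_gt0 // mulr_gt0 // exprn_gt0 // M_gt0. Qed.

Lemma sl_adapted t x x' : hist t x = hist t x' -> sl_psi t x = sl_psi t x' /\ sl_V t x = sl_V t x'.
Proof.
move=> h; have -> : sl_psi t x = sl_psi t x'.
  apply/funext => a; rewrite /sl_psi h; congr (if _ then _ else _).
  by apply/asboolP/asboolP; apply: sl_active_hist.
split=> //; rewrite /sl_V; congr (if _ then _ else _).
by apply/asboolP/asboolP; apply: sl_active_hist.
Qed.

Lemma sl_bounded t x a : `|sl_psi t x a| <= sl_V t x.
Proof.
rewrite /sl_psi /sl_V; case: asboolP => _; last by rewrite normr0.
rewrite normrM (gtr0_norm c_gt0) ler_pM2l ?c_gt0 //.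
apply: le_trans (ler_normB _ _) _; have := bf a; have := @next_mean_le _ _ _ mu _ _ bf (hist t x).
by lra.
Qed.

Lemma sl_small t x : sl_V t x <= 1 / 2.
Proof.
have /andP[e0 e1] := e01.
rewrite /sl_V; case: asboolP => _; last by rewrite divr_ge0.
have -> : c * (2 * M) = e / (8 * M) by rewrite /c; field; rewrite gt_eqF // M_gt0.
by have m0 := M_gt0; have m1 := M1; rewrite ler_pdivrMr; lra.
Qed.

Lemma sl_centered (t : nat) x0 :
  \int[mu]_(x in [set x | hist t x = hist t x0]) sl_psi t x0 (x (t%:Z + 1)) = 0.
Proof.
pose D : set path := [set x | hist t x = hist t x0]; rewrite -/D.
have mD : measurable D by exact: (dm_hist a0 t [set hist t x0]).
rewrite /sl_psi; case: asboolP => _; last by rewrite Rintegral_cst // mul0r.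
have DE : D = block (hist t x0) t by rewrite /block /D /hist size_recent.
have i1 := integrable_letter mu bf (t%:Z + 1) mD.
have i2 := integrable_const mu (- next_mean (hist t x0)) mD.
rewrite RintegralZl //; last first.
  apply: (@dm_integrable _ _ _ _ _ _ (M + M)) => //.
    by apply: (@dm_comp _ _ _ _ (fun v => v - next_mean (hist t x0))); exact: dm_letter.
  move=> x; apply: le_trans (ler_normB _ _) _; apply: lerD; [exact: bf|exact: next_mean_le].
rewrite RintegralD // (Rintegral_const mu) // DE (next_integral_at stat bf) mulNr (pmE_at stat) /=.
by rewrite (@next_meanK _ _ _ mu _ _ bf) subrr mulr0.
Qed.

Definition sl_level : R := e ^+ 2 / (32 * M ^+ 2) * n%:R.

(** The times [lambda x n] have no common bound over all paths, so no fixed number of steps contains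
    all n predictions. On a good path the sum is constant once T >= lambda x n, and the events for
    fixed T0 increase with T0, so the bound passes to their union. *)
Definition sl_event : set path := [set x | exists T0, forall T, (T0 <= T)%N ->
  sl_level <= comp_sum sl_psi sl_V T x].

Lemma sl_event_bound : measurable sl_event /\ (mu sl_event <= (expR (- sl_level))%:E)%E.
Proof.
have dS T : dm (fun x : path => is_true (sl_level <= comp_sum sl_psi sl_V T x)).
  apply: (@dm_comp _ _ _ _ (fun r : R => is_true (sl_level <= r))).
  by apply: dm_comp_sum; exact: sl_adapted.
pose C T0 : set path := [set x | forall T, (T0 <= T)%N -> sl_level <= comp_sum sl_psi sl_V T x].
have mC T0 : measurable (C T0).
  by apply: dm_measurable; apply: dm_all => T; apply: dm_imp; first exact: dm_cst.
have -> : sl_event = \bigcup_T0 C T0.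
  by apply/seteqP; split=> x /=; [move=> [T0 h]; exists T0|move=> [T0 _ h]; exists T0].
split; first exact: bigcupT_measurable.
apply: increasing_union_bound => // [m k mk x h T kT|T0].
  by apply: h; exact: leq_trans mk kT.
apply: (@le_trans _ _ (mu [set x | (sl_level <= comp_sum sl_psi sl_V T0 x)%R])).
  apply: le_mu => //; first exact: dm_measurable.
  by move=> x h; apply: h.
apply: exponential_bound; [exact: sl_adapted|exact: sl_bounded|exact: sl_small|exact: sl_centered].
Qed.

Lemma sl_deviation x : good l x -> e * n%:R <= \sum_(j < n) innovation x j -> sl_event x.
Proof.
move=> gx h; exists (lambda x n) => T nT.
have /andP[e0 e1] := e01.
have -> : comp_sum sl_psi sl_V T x =
    \sum_(j < n) (c * innovation x j - 2 * (c * (2 * M)) ^+ 2).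
  rewrite -(@sum_over_lambda x n T (fun t => c * (f (x (t%:Z + 1)) - next_mean (hist t x)) -
     2 * (c * (2 * M)) ^+ 2)) //.
  apply: eq_bigr => t _; rewrite /sl_psi /sl_V.
  have -> : `[<sl_active t x>] = `[<exists j, (j < n)%N /\ lambda x j = t>].
    by apply/asboolP/asboolP => /sl_activeE; apply.
  by case: ifP => _ //; rewrite expr0n /= mulr0 subrr.
rewrite sumrB -mulr_sumr sumr_const card_ord -mulr_natr.
have h1 : c * (e * n%:R) <= c * \sum_(j < n) innovation x j by rewrite ler_pM2l ?c_gt0.
apply: le_trans (lerB h1 (lexx _)); rewrite /sl_level le_eqVlt; apply/orP; left; apply/eqP.
by rewrite /c; field; rewrite gt_eqF // M_gt0.
Qed.

End FixedLength.

Lemma ae_innovation_upper (e : R) : 0 < e <= 1 ->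
  {ae mu, forall x, exists N, forall n, (N <= n)%N -> \sum_(j < n) innovation x j <= e * n%:R}.
Proof.
move=> e01; have /andP[e0 _] := e01.
have m0 := M_gt0.
have b0 : 0 < e ^+ 2 / (32 * M ^+ 2) by rewrite divr_gt0 ?mulr_gt0 ?exprn_gt0.
have [C hC] := exp_decay (@ltr01 R) b0.
have hb n : (mu (sl_event e n) <= (C / n.+1%:R ^+ 2)%:E)%E.
  apply: le_trans (sl_event_bound n e01).2 _; rewrite lee_fin; apply: le_trans (hC n).
  by rewrite powRr1 // ler_peMl ?expR_ge0 // exprn_ege1 // ler1n.
have bc := Borel_Cantelli_sq (fun n => (sl_event_bound n e01).1) hb.
apply: ae_imp (ae_and (ae_good stat l) bc) => x [gx [N hN]]; exists N => n nN.
rewrite leNgt; apply/negP => h; apply: (hN n nN); apply: sl_deviation => //; exact: ltW.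
Qed.

End OneSided.

Lemma ae_innovation (f : A -> R) (M : R) : (forall a, `|f a| <= M) ->
  {ae mu, forall x, (fun n => n%:R^-1 * \sum_(j < n) innovation f x j) @ \oo --> (0 : R)}.
Proof.
move=> bf; pose M' := Num.max 1 M.
have M1 : 1 <= M' by rewrite le_max lexx.
have bf' a : `|f a| <= M' by rewrite le_max bf orbT.
have bg a : `|(- f a)| <= M' by rewrite normrN.
have e01 q : 0 < (q.+1%:R^-1 : R) <= 1 by rewrite invr_gt0 ltr0n invf_le1 ?ler1n.
have h1 : {ae mu, forall x, forall q : nat, exists N, forall n, (N <= n)%N ->
    \sum_(j < n) innovation f x j <= q.+1%:R^-1 * n%:R}.
  by apply: ae_foralln => q; apply: (ae_innovation_upper bf').
have h2 : {ae mu, forall x, forall q : nat, exists N, forall n, (N <= n)%N ->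
    \sum_(j < n) innovation (fun a => - f a) x j <= q.+1%:R^-1 * n%:R}.
  by apply: ae_foralln => q; apply: (ae_innovation_upper bg).
apply: ae_imp (ae_and h1 h2) => x [hx1 hx2]; apply/cvgrPdist_le => e e0.
pose q := Num.bound e^-1.
have qe : q.+1%:R^-1 <= e.
  rewrite invf_ple ?posrE //; apply: le_trans (ltW (archi_boundP _)) _.
    by rewrite invr_ge0 ltW.
  by rewrite ler_nat.
have [N1 hN1] := hx1 q; have [N2 hN2] := hx2 q.
exists (maxn 1 (maxn N1 N2)) => // n /=; rewrite !geq_max => /and3P[n1 n2 n3].
have n0 : (0 : R) < n%:R by rewrite ltr0n.
have u := hN1 n n2; have := hN2 n n3.
have -> : \sum_(j < n) innovation (fun a => - f a) x j = - \sum_(j < n) innovation f x j.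
  rewrite -sumrN; apply: eq_bigr => j _; rewrite /innovation.
  have -> : next_mean mu (fun a => - f a) (hist (lambda x j) x) = - next_mean mu f (hist (lambda x j) x).
    rewrite /next_mean -mulNr; congr (_ / _); rewrite /next_integral -[RHS]mulN1r -RintegralZl //.
    - by apply: eq_Rintegral => y _; rewrite mulN1r.
    - exact: measurable_block.
    - by apply: (integrable_letter mu bf); exact: measurable_block.
  by ring.
move=> v; rewrite sub0r normrN normrM normfV (gtr0_norm n0) mulrC ler_pdivrMr //.
have kn := ler_wpM2r (ltW n0) qe; rewrite ler_norml.
by move: (q.+1%:R^-1 * n%:R) u v kn => k u v kn; apply/andP; split; lra.
Qed.

End StrongLaw.

(** * Limits along the times [lambda] *)

Section Prediction.
Context (A : countType) (a0 : A) (R : realType).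
Notation path := (pathT int A a0).
Context (mu : probability path R).
Hypothesis stat : forall B : set path, measurable B -> mu (shiftz 1 @^-1` B) = mu B.
Context (l : nat -> nat) (beta gamma : R).
Hypothesis adm : admissible l.
Hypotheses (beta0 : 0 < beta) (gamma0 : 0 < gamma).
Notation lambda := (lambda l beta gamma).
Notation chi := (chi l beta gamma).
Notation active := (active l beta gamma).
Notation Xt := (Xtilde l).
Notation pm := (pm mu).

Lemma ae_positive : {ae mu, forall x : path,
  (forall k, 0 < pm (recent (Xt x) k)) /\ (forall t, 0 < pm (hist t x))}.
Proof.
have h1 : {ae mu, forall x : path, forall k (s : seq A), recent (Xt x) k = s -> 0 < pm s}.
  apply: ae_foralln => k; apply: ae_countable => s.
  case: (ltP 0 (pm s)) => ps; first by apply: (@ae_null _ _ _ _ set0).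
  have e : pm s = 0 by apply/eqP; rewrite eq_le ps pm_ge0.
  have mB : measurable [set x : path | recent (Xt x) k = s].
    apply: dm_measurable; apply: (@dm_comp _ _ _ _ (fun u => u = s)).
    by apply: dm_recent => i; exact: dm_Xtilde.
  apply: (ae_null mB); last by move=> x /= h /h.
  rewrite (Xtilde_block stat adm); case: (eqVneq (size s) k) => [<-|ne].
    by have := pmE mu s; rewrite e.
  have -> : [set x : path | recent (pa x 0) k = s] = set0; last exact: measure0.
  by apply/seteqP; split=> x //= h; move: ne; rewrite -h size_recent eqxx.
have h2 : {ae mu, forall x : path, forall t (s : seq A), hist t x = s -> 0 < pm s}.
  apply: ae_foralln => t; apply: ae_countable => s.
  case: (ltP 0 (pm s)) => ps; first by apply: (@ae_null _ _ _ _ set0).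
  have e : pm s = 0 by apply/eqP; rewrite eq_le ps pm_ge0.
  apply: (ae_null (measurable_block a0 s t)).
    by have := pmE_at stat s t; rewrite e.
  by move=> x h e'; case: h; rewrite /block /= -e' /hist size_recent.
by apply: ae_imp (ae_and h1 h2) => x [g1 g2]; split=> [k|t]; [exact: (g1 k)|exact: (g2 t)].
Qed.

Lemma least_memory (y : nat -> A) : (exists k, memory_word mu (recent y k)) ->
  exists K, memory_word mu (recent y K) /\ forall k, (k < K)%N -> ~ memory_word mu (recent y k).
Proof.
move=> /(minN_spec (S := fun k => memory_word mu (recent y k)))[h1 h2].
exists (minN (fun k => memory_word mu (recent y k))); split=> // k kK /h2.
by rewrite leqNgt kK.
Qed.

Variable x : path.
Hypotheses (gx : good l x) (tx : typical mu x) (cx : concentrated mu beta gamma x).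
Hypothesis posX : forall k, 0 < pm (recent (Xt x) k).

Lemma lambda_active n : active x (lambda x n.+1).
Proof. by have [] := lambda_spec beta gamma adm gx n. Qed.

(** As [chi] at a positive time t is less than t, the tested block lies inside the data segment. *)
Lemma lambda_word K N n : (forall t, (N <= t)%N -> (K <= chi x t)%N) -> (N <= n)%N -> (0 < n)%N ->
  exists z, hist (lambda x n) x = z ++ recent (Xt x) K.
Proof.
move=> hN Nn; case: n Nn => // n Nn _; set t := lambda x n.+1.
have tn : (n < t)%N by exact: lambda_ge.
have Kc : (K <= chi x t)%N by apply: hN; exact: leq_trans Nn tn.
have ct : (chi x t < t)%N.
  by case: t tn Kc => // t _ _; have [] := chi_spec l beta gamma x t.
have Kt : (K <= t.+1)%N by apply: leq_trans Kc (ltnW (leqW ct)).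
have [z _ e] := recentD (pa x t) K (t.+1 - K)%N.
exists z; rewrite /hist -(subnKC Kt) e; congr cat.
exact: recent_leq Kc (lambda_active n).
Qed.

Section Limit.
Context (f : A -> R) (M : R).
Hypothesis bf : forall a, `|f a| <= M.
Notation next_mean := (next_mean mu f).

(** The form in which continuity of F at y enters, free of the metric and of null sets: a bound on
    conditional means given words of positive probability that end like y. *)
Definition predicts (y : nat -> A) (c : R) : Prop := forall e : R, 0 < e -> exists k0,
  forall z, 0 < pm (z ++ recent y k0) -> `|next_mean (z ++ recent y k0) - c| <= e.

Hypothesis posh : forall t, 0 < pm (hist t x).

Lemma next_mean_cvg c : predicts (Xt x) c ->
  (fun n => next_mean (hist (lambda x n) x)) @ \oo --> c.
Proof.
move=> hc; apply/cvgrPdist_le => e e0.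
case: (pselect (exists k, memory_word mu (recent (Xt x) k))) => hm.
  have [K [mK hK]] := least_memory hm.
  (* The value c must be the mean given the memory word: compare the last K with the last k0 letters
     of Xtilde, the longer string being an extension of the shorter. *)
  have cE : c = next_mean (recent (Xt x) K).
    apply/eqP; rewrite -subr_eq0 -normr_le0; apply/ler_addgt0Pr => d d0; rewrite add0r.
    have [k0 hk0] := hc d d0.
    case: (leqP K k0) => Kk.
      have [z _ ez] := recentD (Xt x) K (k0 - K)%N; rewrite subnKC // in ez.
      have := hk0 [::] (posX _); rewrite /= ez (next_mean_memory stat bf mK) -?ez //.
      by rewrite distrC.
    have [z _ ez] := recentD (Xt x) k0 (K - k0)%N; rewrite (subnKC (ltnW Kk)) in ez.
    by have := hk0 z; rewrite -ez distrC; apply.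
  have [N hN] := chi_eventually_eq stat beta0 gamma0 tx cx mK hK.
  exists (maxn 1 N) => // n /=; rewrite geq_max => /andP[n1 nN].
  have [z ez] := @lambda_word K N n (fun t h => eq_leq (esym (hN t h))) nN n1.
  by rewrite ez (next_mean_memory stat bf mK) -?ez // -cE subrr normr0 ltW.
(* Without a memory word [chi] is eventually at least k0, and [predicts] applies to the whole
   history. *)
have [k0 hk0] := hc e e0.
have [N hN] := chi_eventually_ge stat beta0 gamma0 tx (K := k0) (fun k _ mk => hm (ex_intro _ k mk)).
exists (maxn 1 N) => // n /=; rewrite geq_max => /andP[n1 nN].
have [z ez] := lambda_word hN nN n1.
by rewrite distrC; have := hk0 z; rewrite -ez; apply.
Qed.

Lemma festim_cvg c : predicts (Xt x) c ->
  (fun n => n%:R^-1 * \sum_(j < n) innovation mu l beta gamma f x j) @ \oo --> (0 : R) ->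
  (fun n => festim l beta gamma x f n) @ \oo --> c.
Proof.
move=> hc h0; have h1 := next_mean_cvg hc.
have h2 : (fun n => n%:R^-1 * \sum_(j < n) next_mean (hist (lambda x j) x)) @ \oo --> c.
  rewrite -cvg_shiftS; apply: cvg_trans (cesaro h1); apply: near_eq_cvg; apply: nearW => n.
  by rewrite /arithmetic_mean /series /= big_mkord.
rewrite -[c]add0r; apply: cvg_trans (cvgD h0 h2); apply: near_eq_cvg; apply: nearW => n.
rewrite /festim -[LHS]/(_ + _) -mulrDr -big_split /= big_mkord; congr (_ * _); apply: eq_bigr => j _.
by rewrite /innovation subrK -addn1 PoszD.
Qed.

End Limit.

Section MemoryCase.
Variable K : nat.
Hypotheses (mK : memory_word mu (recent (Xt x) K))
  (hK : forall k, (k < K)%N -> ~ memory_word mu (recent (Xt x) k)).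

Lemma active_eventually : exists N, forall t, (N <= t)%N ->
  active x t <-> recent (pa x t) K = recent (Xt x) K.
Proof.
have [N hN] := chi_eventually_eq stat beta0 gamma0 tx cx mK hK.
by exists N => t Nt; rewrite /active hN.
Qed.

Lemma block_at (t : nat) :
  block (recent (Xt x) K) 0 (shiftz t x : path) <-> recent (pa x t) K = recent (Xt x) K.
Proof. by rewrite /block /= pa_shiftz add0r size_recent. Qed.

(** Late active times are the visits to the memory word, so each late step of [lambda] adds exactly
    one visit; what happens before N stays as a constant offset. *)
Lemma visits_lambda : exists N, forall n, (N <= n)%N ->
  (visits (block (recent (Xt x) K) 0 : set path) x (lambda x n).+1 + N =
   n + visits (block (recent (Xt x) K) 0 : set path) x (lambda x N).+1)%N.
Proof.
have [N hN] := active_eventually; exists N; set w := recent (Xt x) K.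
elim=> [|n ih]; first by rewrite leqn0 => /eqP->; rewrite addnC.
rewrite leq_eqVlt => /orP[/eqP<-|]; first by rewrite addnC.
rewrite ltnS => Nn; have {}ih := ih Nn.
have [h1 h2 h3] := lambda_spec beta gamma adm gx n.
have Nl : (N <= lambda x n)%N := leq_trans Nn (lambda_ge beta gamma adm gx n).
have e : ((lambda x n.+1).+1 = (lambda x n).+1 + ((lambda x n.+1) - (lambda x n).+1) + 1)%N by lia.
rewrite e visitsD visitsD visits1 ?shiftzD.
have -> : visits (block w 0 : set path) (shiftz (lambda x n).+1 x : path) (lambda x n.+1 - (lambda x n).+1) = 0%N.
  apply/eqP; rewrite -leqn0 leqNgt -has_count; apply/hasPn => t; rewrite mem_iota => /andP[_ ht].
  apply/asboolPn; rewrite /block /= !pa_shiftz add0r /w size_recent.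
  have -> : t%:Z + (lambda x n).+1%:Z = ((lambda x n).+1 + t)%N%:Z by lia.
  move=> ew; have ht' : (lambda x n < (lambda x n).+1 + t < lambda x n.+1)%N by lia.
  apply: (h3 _ ht'); apply/hN => //; lia.
rewrite (subnKC h1) asboolT; last first.
  by apply/block_at/hN => //; apply: leq_trans Nl (ltnW h1).
by rewrite addn0 addnAC ih; lia.
Qed.

(** At time [lambda x n] the number of visits is n up to a constant, while typicality makes it
    asymptotically p times the elapsed time. *)
Lemma lambda_rate :
  (fun n => (lambda x n)%:R / n%:R : R) @ \oo --> (pm (recent (Xt x) K))^-1.
Proof.
set w := recent (Xt x) K; have [N hN] := visits_lambda; rewrite -/w in hN.
pose p := pm w; have p0 : 0 < p by exact: posX.
pose V n := visits (block w 0 : set path) x n.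
pose L n : nat := (lambda x n).+1.
have hL : L n @[n --> \oo] --> \oo.
  apply/cvgnyPge => m; exists m => // n /= mn.
  by apply: leq_trans mn (leqW (lambda_ge beta gamma adm gx n)).
have h1 : (fun n => (V (L n))%:R / (L n)%:R : R) @ \oo --> p.
  have := cvg_comp L (fun n => (V n)%:R / n%:R : R) hL (@tx w); exact.
have h2 : (fun n => (L n)%:R^-1 : R) @ \oo --> (0 : R).
  apply: (@squeeze_cvgr _ _ _ _ (fun=> 0) (@harmonic R)).
  - apply: nearW => n; rewrite invr_ge0 ler0n /= lef_pV2 ?posrE ?ltr0n // ler_nat ltnS.
    exact: lambda_ge.
  - exact: cvg_cst.
  - exact: cvg_harmonic.
have h3 : (fun n => n%:R / (L n)%:R : R) @ \oo --> p.
  have -> : p = p + (N%:R - (V (L N))%:R) * 0 by rewrite mulr0 addr0.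
  pose c : R := N%:R - (V (L N))%:R.
  have hs : (fun n => (V (L n))%:R / (L n)%:R + c * (L n)%:R^-1 : R) @ \oo --> p + c * 0.
    by apply: cvgD => //; apply: cvgM => //; exact: cvg_cst.
  apply: cvg_trans hs.
  apply: near_eq_cvg; exists N => // n /= Nn; rewrite -mulrDl; congr (_ / _).
  have e : (V (L n))%:R = n%:R + (V (L N))%:R - N%:R :> R.
    by rewrite -natrD -[V (L N)]/(visits _ _ _) -hN // natrD addrK.
  by rewrite e /c; ring.
have h4 : (fun n => (n%:R / (L n)%:R)^-1 * (1 - (L n)%:R^-1) : R) @ \oo --> p^-1 * (1 - 0).
  by apply: cvgM; [apply: cvgV => //; rewrite gt_eqF|apply: cvgB => //; exact: cvg_cst].
rewrite subr0 mulr1 in h4; apply: cvg_trans h4; apply: near_eq_cvg; exists 1%N => // n /= n1.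
have n0 : n%:R != 0 :> R by rewrite pnatr_eq0 -lt0n.
have l0 : (lambda x n)%:R + 1 != 0 :> R by rewrite natr1 pnatr_eq0.
by rewrite /L -natr1; field; rewrite n0 l0.
Qed.

End MemoryCase.

(** The empty word matches everywhere, so every late time is active. *)
Lemma lambda_step : memory_word mu [::] ->
  exists N, forall n, (N <= n)%N -> lambda x n.+1 = (lambda x n).+1.
Proof.
move=> m0; have [N hN] := @active_eventually 0%N m0 (fun k => fun h => match notF h with end).
exists N => n Nn; have [h1 h2 h3] := lambda_spec beta gamma adm gx n.
apply/eqP; rewrite eqn_leq h1 andbT leqNgt; apply/negP => h.
apply: (h3 (lambda x n).+1); first by rewrite ltnSn h.
by apply/hN => //; apply: leq_trans Nn (leqW (lambda_ge beta gamma adm gx n)).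
Qed.

End Prediction.

(** * Polynomial growth *)

(** The exponent 4 comes from [light_words]: the words of length k less likely than 2^(-2 k^4) have
    summable total probability, and for k = l_n and n >= 2 this threshold is at least n^(-2). The
    outer maximum secures l_n >= 1. *)
Definition slow_length (n : nat) : nat := maxn 1 (\max_(j < n.+1 | (2 ^ (j ^ 4) <= n)%N) j).

Lemma slow_length_admissible : admissible slow_length.
Proof.
rewrite /slow_length; split=> [k k0|j k /andP[j0 jk]|M].
- rewrite leq_maxl geq_max k0 /=; apply/bigmax_leqP => i _; by rewrite -ltnS ltn_ord.
- rewrite geq_max leq_maxl /=; apply: leq_trans (leq_maxr _ _); apply/bigmax_leqP => i hi.
  have ik : (i < k.+1)%N by apply: leq_trans (ltn_ord i) _; rewrite ltnS.
  by apply: (@leq_bigmax_cond _ _ (fun i : 'I_k.+1 => val i) (Ordinal ik)); exact: leq_trans hi jk.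
exists (2 ^ (M.+1 ^ 4))%N; first by rewrite expn_gt0.
have h : (M.+1 < (2 ^ (M.+1 ^ 4)).+1)%N.
  rewrite ltnS; apply: leq_trans (ltnW (ltn_expl _ (ltnSn 1))).
  by rewrite -[leqLHS]expn1 leq_pexp2l.
apply: leq_trans (leq_maxr _ _).
exact: (@leq_bigmax_cond _ _ (fun i : 'I__ => val i) (Ordinal h)).
Qed.

Lemma exp_slow_length n : (2 <= n)%N -> (2 ^ (slow_length n ^ 4) <= n)%N.
Proof.
move=> n2; rewrite /slow_length maxnC maxnE; set m := \max_(j < n.+1 | _) _.
have [-> //|m0 ]: m = 0%N \/ (0 < m)%N by case: m; auto.
rewrite (_ : (m + (1 - m))%N = m); last by lia.
apply: (big_ind (fun m => (2 ^ (m ^ 4) <= n)%N)) => //; first exact: ltnW.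
by move=> a b ha hb; rewrite /maxn; case: ifP.
Qed.

Section HeavyWords.
Context (A : countType) (a0 : A) (R : realType).
Notation path := (pathT int A a0).
Context (mu : probability path R).
Notation pm := (pm mu).

Lemma sum_pm_le1 k (L : seq (seq A)) : uniq L -> (forall s, s \in L -> size s = k) ->
  \sum_(s <- L) pm s <= 1.
Proof.
have mU (M : seq (seq A)) : measurable [set x : path | recent (pa x 0) k \in M].
  apply: dm_measurable; apply: (@dm_comp _ _ _ _ (fun u => is_true (u \in M))).
  exact: dm_recent_pa.
move=> uL hL; rewrite -lee_fin.
apply: le_trans (probability_le1 mu (mU L)).
elim: L uL hL => [|s L ih] /=; first by rewrite big_nil.
move=> /andP[sL uL] hL; rewrite big_cons EFinD -pmE.
have -> : [set x : path | recent (pa x 0) k \in s :: L] =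
    block s 0 `|` [set x : path | recent (pa x 0) k \in L].
  rewrite /block hL ?mem_head //; apply/seteqP; split=> x /=; rewrite inE.
    by move=> /orP[/eqP|]; auto.
  by move=> [->|->]; rewrite ?eqxx ?orbT.
rewrite measureU; last 3 first.
- exact: measurable_block.
- exact: mU.
- apply/seteqP; split=> x //= -[]; rewrite /block /= hL ?mem_head // => ->.
  by rewrite (negbTE sL).
apply: leeD => //; apply: ih => // t tL; apply: hL; by rewrite inE tL orbT.
Qed.

(** Words of probability at least del number at most 1/del. If no list exhausted them, every list
    could be enlarged until it is longer than that. *)
Lemma heavy_words k (del : R) : 0 < del -> exists L : seq (seq A),
  (forall s, size s = k -> del <= pm s -> s \in L) /\ (size L)%:R * del <= 1.
Proof.
move=> d0; pose ok L := [/\ uniq L, forall s, s \in L -> size s = k & forall s, s \in L -> del <= pm s].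
have bnd L : ok L -> (size L)%:R * del <= 1.
  move=> [uL sL hL]; apply: le_trans (sum_pm_le1 uL sL).
  rewrite -sum1_size natr_sum mulr_suml big_seq [leRHS]big_seq.
  by apply: ler_sum => s sL'; rewrite mul1r hL.
apply: contrapT => hn.
have grow n : exists2 L, ok L & size L = n.
  elim: n => [|n [L oL sL]]; first by exists [::].
  have [s [sk [ds ns]]] : exists s, size s = k /\ del <= pm s /\ s \notin L.
    apply: contrapT => h; apply: hn; exists L; split; last exact: bnd.
    move=> s sk ds; apply: contrapT => ns; apply: h; exists s; split=> //; split=> //; exact/negP.
  exists (s :: L); last by rewrite /= sL.
  case: oL => uL hs hd; split=> [|t|t]; first by rewrite /= ns.
  - by rewrite inE => /orP[/eqP->|/hs].
  - by rewrite inE => /orP[/eqP->|/hd].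
have [L oL sL] := grow (Num.truncn del^-1).+1.
have := bnd L oL; rewrite leNgt => /negP; apply.
by rewrite -ltr_pdivrMr // div1r sL; exact: truncnS_gt.
Qed.

(* -p log2 p >= j p as soon as p < 2^-j, hence Markov's inequality for -log2 p. *)
Lemma entropy_tail m (h : R) j :
  (\esum_(s in [set s : seq A | size s = m]) (- (pm s * log2 (pm s)))%:E <= h%:E)%E ->
  ((j%:R)%:E * mu [set x : path | (pm (recent (pa x 0) m) < (2 ^+ j)^-1)%R] <= h%:E)%E.
Proof.
move=> hh.
pose F i := [set x : path | pickle (recent (pa x 0) m) = i /\ pm (recent (pa x 0) m) < (2 ^+ j)^-1].
have mF i : measurable (F i).
  apply: dm_measurable.
  apply: (@dm_comp _ _ _ _ (fun u : seq A => pickle u = i /\ pm u < (2 ^+ j)^-1)).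
  exact: dm_recent_pa.
have tF : trivIset setT F.
  by apply/trivIsetP => i i' _ _ ne; apply/seteqP; split=> x //= -[[e _] [e' _]]; move: ne; rewrite -e -e' eqxx.
have -> : [set x : path | pm (recent (pa x 0) m) < (2 ^+ j)^-1] = \bigcup_i F i.
  by apply/seteqP; split=> x /= => [h0|[i _ []//]]; eexists.
rewrite mu_bigcup // -nneseriesZl; last by move=> i _; exact: measure_ge0.
rewrite nneseries_esumT; last by move=> i; apply: mule_ge0; [rewrite lee_fin|exact: measure_ge0].
apply: le_trans hh; pose S := [set s : seq A | size s = m].
(* Indices that do not code a word of length m contribute nothing. *)
have -> : \esum_(i in [set: nat]) (j%:R%:E * mu (F i))%E =
    \esum_(i in [set pickle s | s in S]) (j%:R%:E * mu (F i))%E.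
  rewrite [RHS]esum_mkcond; apply: eq_esum => i _; case: ifPn => // hi.
  have -> : F i = set0; last by rewrite measure0 mule0.
  apply/seteqP; split=> x //= -[e _].
  move/negP: hi; apply; apply/mem_set; exists (recent (pa x 0) m) => //; exact: size_recent.
rewrite esum_image; last by move=> s s' _ _; exact: (pcan_inj pickleK).
apply: le_esum => s /= sm.
have [ps|ps] := ltP (pm s) (2 ^+ j)^-1; last first.
  have -> : F (pickle s) = set0.
    by apply/seteqP; split=> x //= -[/(pcan_inj pickleK) ->]; rewrite ltNge ps.
  rewrite measure0 mule0.
  rewrite lee_fin oppr_ge0 mulr_ge0_le0 ?pm_ge0 // /log2 mulr_le0_ge0 //; last first.
    by rewrite invr_ge0 ln_ge0 // ler1n.
  by rewrite ln_le0 // pm_le1.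
apply: (@le_trans _ _ ((j%:R)%:E * (pm s)%:E)%E).
  apply: lee_wpmul2l; first by rewrite lee_fin.
  rewrite -pmE; apply: le_mu => //; first exact: measurable_block.
  by move=> x /= [/(pcan_inj pickleK) e _]; rewrite /block /= sm.
rewrite -EFinM lee_fin; have [p0|p0] := ltP 0 (pm s); last first.
  have -> : pm s = 0 by apply/eqP; rewrite eq_le p0 pm_ge0.
  by rewrite mulr0 mul0r oppr0.
rewrite mulrC -mulrN; apply: ler_wpM2l; first exact: pm_ge0.
have l2 : 0 < ln 2%:R :> R by rewrite ln_gt0 // ltr1n.
rewrite /log2 -mulNr ler_pdivlMr // -lnV ?posrE // mulr_natl -lnXn //.
rewrite ler_ln ?posrE ?exprn_gt0 ?invr_gt0 //.
by rewrite -[leLHS]invrK lef_pV2 ?posrE ??invr_gt0 ?exprn_gt0 // ltW.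
Qed.

End HeavyWords.
Section Words.
Variable A : eqType.

Fixpoint words (L : seq (seq A)) (k : nat) : seq (seq A) :=
  if k is k'.+1 then [seq s ++ w | s <- L, w <- words L k'] else [:: [::]].

Lemma size_words L k : size (words L k) = (size L ^ k)%N.
Proof. by elim: k => [//|k ih]; rewrite /= size_allpairs ih expnS. Qed.

Lemma recent_words L (y : nat -> A) k : (forall i, (i < k)%N -> [:: y i] \in L) ->
  recent y k \in words L k.
Proof.
elim: k => [//|k ih] h; rewrite recentS; apply/allpairsP; exists ([:: y k], recent y k).
by split=> //=; [exact: h|apply: ih => i ik; apply: h; exact: leqW].
Qed.

End Words.

Section PolynomialGrowth.
Context (A : countType) (a0 : A) (R : realType).
Notation path := (pathT int A a0).
Context (mu : probability path R).
Hypothesis stat : forall B : set path, measurable B -> mu (shiftz 1 @^-1` B) = mu B.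
Notation pm := (pm mu).

Lemma dm_pm_lt (k : nat) (t : int) (c : R) : dm (fun x : path => pm (recent (pa x t) k) < c : Prop).
Proof. apply: (@dm_comp _ _ _ _ (fun u : seq A => is_true (pm u < c))); exact: dm_recent_pa. Qed.

(* A word of small probability either contains one of the rare letters or is one of
   at most 2^(k^4) words over the frequent letters. *)
Lemma light_words (m : nat) (h : R) k : (0 < k)%N ->
  (\esum_(s in [set s : seq A | size s = m.+1]) (- (pm s * log2 (pm s)))%:E <= h%:E)%E ->
  (mu [set x : path | (pm (recent (pa x 0) k) < (2 ^+ (2 * k ^ 4))^-1)%R] <=
   ((h + 1) / k%:R ^+ 2)%:E)%E.
Proof.
(* Meeting a letter rarer than 2^(-J) has probability at most h/k^3 by [entropy_tail], and k
   positions give h/k^2; the at most 2^J other letters form at most 2^(k^4) words. *)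
move=> k0 hh; pose J := (k ^ 3)%N.
have kR : 0 < k%:R :> R by rewrite ltr0n.
have e0 j : 0 < (2 ^+ j)^-1 :> R by rewrite invr_gt0 exprn_gt0.
have [L [hL sL]] := heavy_words mu 1 (e0 J).
pose c : R := (2 ^+ (2 * k ^ 4))^-1.
pose F (i : nat) := [set x : path | pm (recent (pa x (- i%:Z)) 1) < (2 ^+ J)^-1].
pose G (i : nat) := [set x : path | recent (pa x 0) k = nth [::] (words L k) i /\
  pm (nth [::] (words L k) i) < c].
have mF i : measurable (F i) by apply: dm_measurable; exact: dm_pm_lt.
have mG i : measurable (G i).
  by apply: dm_measurable; apply: dm_and; [exact: dm_recent_eq|exact: dm_cst].
have hF i : (mu (F i) <= (h / k%:R ^+ 3)%:E)%E.
  pose F0 := [set x : path | pm (recent (pa x 0) 1) < (2 ^+ J)^-1].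
  have -> : F i = shiftz (- i%:Z) @^-1` F0.
    by apply/seteqP; split=> x; rewrite /F /F0 /= pa_shiftz add0r.
  rewrite (stat_int stat); last by apply: dm_measurable; exact: dm_pm_lt.
  (* The last letter is at least as likely as the block of m + 1 letters that it ends, so the block
     entropy controls single letters. *)
  apply: (@le_trans _ _ (mu [set x : path | (pm (recent (pa x 0) m.+1) < (2 ^+ J)^-1)%R])).
    apply: le_mu; try by apply: dm_measurable; exact: dm_pm_lt.
    move=> x /= hx; apply: le_lt_trans hx.
    have [z _ e] := recentD (pa x 0) 1 m; rewrite add1n in e.
    by rewrite e; exact: pm_suffix.
  have := entropy_tail J hh; rewrite mu_fin; last by apply: dm_measurable; exact: dm_pm_lt.
  rewrite -EFinM !lee_fin ler_pdivlMr ?exprn_gt0 // /J natrX => hm.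
  by rewrite mulrC.
have hG i : (mu (G i) <= c%:E)%E.
  case: (ltP (pm (nth [::] (words L k) i)) c) => hc; last first.
    have -> : G i = set0 by apply/seteqP; split=> x //= -[_]; rewrite ltNge hc.
    by rewrite measure0 lee_fin ltW // e0.
  apply: (@le_trans _ _ (pm (nth [::] (words L k) i))%:E); last by rewrite lee_fin ltW.
  rewrite -pmE; apply: le_mu => //; first exact: measurable_block.
  by move=> x [e _]; rewrite /block /= -e size_recent.
have [mU1 hU1] := union_bound k mF hF.
have [mU2 hU2] := union_bound (size (words L k)) mG hG.
(* At most 2^(k^4) words, each of probability below 2^(-2 k^4), have total 2^(-k^4), which is at
   most 1/k^2. *)
have kk : ((size (words L k))%:R * c <= 1 / k%:R ^+ 2)%R.
  apply: (@le_trans _ _ (2 ^+ (k ^ 4) * c)).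
    apply: ler_wpM2r; first exact: ltW (e0 _).
    rewrite size_words natrX (_ : 2 ^+ (k ^ 4) = (2 ^+ J) ^+ k :> R); last by rewrite -exprM /J -expnSr.
    rewrite lerXn2r ?nnegrE ?ler0n ?exprn_ge0 //.
    by have := sL; rewrite -ler_pdivlMr ?e0 // div1r invrK.
  rewrite /c mul2n -addnn exprD invfM mulrA mulfV ?mul1r ?expf_neq0 ?pnatr_eq0 //.
  rewrite lef_pV2 ?posrE ?exprn_gt0 // -!natrX ler_nat.
  apply: leq_trans (ltnW (ltn_expl _ (ltnSn 1))).
  by rewrite leq_pexp2l.
apply: (@le_trans _ _ (mu ([set x | exists i, (i < k)%N /\ F i x] `|`
   [set x | exists i, (i < size (words L k))%N /\ G i x]))).
  apply: le_mu; [by apply: dm_measurable; exact: dm_pm_lt|exact: measurableU|move=> x /= hx].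
  case: (pselect (exists i, (i < k)%N /\ F i x)) => hi; first by left.
  right; have hw : recent (pa x 0) k \in words L k.
    apply: recent_words => i ik; apply: hL => //; rewrite leNgt; apply/negP => hc.
    by apply: hi; exists i; split=> //; move: hc; rewrite /F /= recentS /pa subr0 sub0r.
  exists (index (recent (pa x 0) k) (words L k)); rewrite index_mem; split=> //.
  by rewrite /G /= nth_index.
apply: le_trans (measureU2 _ mU1 mU2) _.
apply: le_trans (leeD hU1 hU2) _; rewrite -EFinD lee_fin mulrDl; apply: lerD => //.
by rewrite le_eqVlt; apply/orP; left; apply/eqP; field; rewrite gt_eqF.
Qed.

(** Kac's inequality summed over the at most 1/del words of probability del or more. *)
Lemma return_tail k (T : nat) (del : R) : 0 < del ->
  measurable [set x : path | del <= pm (recent (pa x 0) k) /\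
    forall t : nat, (0 < t <= T)%N -> recent (pa x t) k <> recent (pa x 0) k] /\
  (mu [set x : path | (del <= pm (recent (pa x 0) k))%R /\
    forall t : nat, (0 < t <= T)%N -> recent (pa x t) k <> recent (pa x 0) k] <=
   ((del * T.+1%:R)^-1)%:E)%E.
Proof.
move=> d0; have [L [hL sL]] := heavy_words mu k d0.
pose F (i : nat) := [set x : path | let s := nth [::] L i in
  recent (pa x 0) (size s) = s /\ forall t : nat, (0 < t <= T)%N -> recent (pa x t) (size s) <> s].
have mF i : measurable (F i).
  apply: dm_measurable; apply: dm_and; first exact: dm_recent_eq.
  apply: dm_all => t; apply: dm_imp; first exact: dm_cst.
  apply: dm_not; exact: dm_recent_eq.
have hF i : (mu (F i) <= (T.+1%:R^-1)%:E)%E.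
  have := first_return_tail stat (nth [::] L i) T; rewrite -/(F i) (mu_fin mu (mF i)).
  by rewrite -EFinM !lee_fin -[T.+1%:R^-1]div1r ler_pdivlMr ?ltr0n // mulrC.
have [mU hU] := union_bound (size L) mF hF.
have mS : measurable [set x : path | del <= pm (recent (pa x 0) k) /\
    forall t : nat, (0 < t <= T)%N -> recent (pa x t) k <> recent (pa x 0) k].
  apply: dm_measurable; apply: dm_and.
    apply: (@dm_comp _ _ _ _ (fun u : seq A => is_true (del <= pm u))); exact: dm_recent_pa.
  apply: dm_all => t; apply: dm_imp; first exact: dm_cst.
  apply: dm_not; apply: (@dm_comp2 _ _ _ _ _ (fun u v : seq A => u = v)); exact: dm_recent_pa.
split=> //; apply: (@le_trans _ _ ((size L)%:R * T.+1%:R^-1)%:E); last first.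
  by rewrite lee_fin invfM; apply: ler_wpM2r; rewrite ?invr_ge0 // -div1r ler_pdivlMr.
apply: le_trans hU; apply: le_mu => // x /= [h1 h2].
have hs := hL _ (size_recent _ _) h1.
exists (index (recent (pa x 0) k) L); rewrite index_mem; split=> //.
by rewrite /F /= nth_index // size_recent.
Qed.

Section SlowLength.
Context (m : nat) (h : R).
Hypothesis ent :
  (\esum_(s in [set s : seq A | size s = m.+1]) (- (pm s * log2 (pm s)))%:E <= h%:E)%E.
Notation l := slow_length.
Notation adm := slow_length_admissible.

Lemma ae_Xtilde_heavy : {ae mu, forall x : path, exists N, forall n, (N <= n)%N ->
  ~ pm (recent (Xtilde l x) n.+1) < (2 ^+ (2 * n.+1 ^ 4))^-1}.
Proof.
pose B n := [set y : pathT nat A a0 | pm (recent y n.+1) < (2 ^+ (2 * n.+1 ^ 4))^-1].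
have mB n : measurable (B n).
  apply: dm_measurable.
  apply: (@dm_comp _ _ _ _ (fun u : seq A => is_true (pm u < (2 ^+ (2 * n.+1 ^ 4))^-1))).
  apply: dm_recent => i; exact: dm_coord.
apply: (Borel_Cantelli_sq (F := fun n => Xtilde l @^-1` B n : set path) (C := h + 1)) => n.
  by have [] := Xtilde_law stat adm (mB n).
have [_ _ ->] := Xtilde_law stat adm (mB n).
exact: (@light_words m h n.+1 _ ent).
Qed.

(** With del = (n + 1)^(-2) and T = (n + 1)^4 in [return_tail] the exceptional probability is below
    (n + 1)^(-2); the path seen from [zeta l x n] has law [mu]. *)
Lemma ae_return_time : {ae mu, forall x : path, exists N, forall n, (N <= n)%N ->
  ~ ((n.+1%:R ^+ 2)^-1 <= pm (recent (pa x (zeta l x n)) (l n.+1)) /\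
    forall t : nat, (0 < t <= n.+1 ^ 4)%N ->
      recent (pa x (zeta l x n + t)%N) (l n.+1) <> recent (pa x (zeta l x n)) (l n.+1))}.
Proof.
have d0 n : 0 < (n.+1%:R ^+ 2)^-1 :> R by rewrite invr_gt0 exprn_gt0 ?ltr0n.
have hn n := return_tail (l n.+1) (n.+1 ^ 4) (d0 n).
pose B n := [set x : path | (n.+1%:R ^+ 2)^-1 <= pm (recent (pa x 0) (l n.+1)) /\
  forall t : nat, (0 < t <= n.+1 ^ 4)%N -> recent (pa x t) (l n.+1) <> recent (pa x 0) (l n.+1)].
have := @Borel_Cantelli_sq _ _ _ mu (fun n => zeta_map l n @^-1` B n) 1; set P := (X in _ -> _ -> X) => hP.
have : P.
  apply: hP => n; have [mB hB] := hn n.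
    by have [] := zeta_map_preserves stat l n mB.
  have [_ ->] := zeta_map_preserves stat l n mB; apply: le_trans hB _.
  rewrite lee_fin div1r lef_pV2 ?posrE ?exprn_gt0 ?mulr_gt0 ?ltr0n //.
  rewrite mulrC ler_pdivlMr ?exprn_gt0 ?ltr0n // -exprD -natrX ler_nat; exact: leqnSn.
move=> {hP}; rewrite /P; apply: ae_imp => x [N hN]; exists N => n Nn [h1 h2]; apply: (hN n Nn).
rewrite /B /zeta_map /= !pa_shiftz add0r; split=> // t /h2; rewrite pa_shiftz.
by have -> : t%:Z + (zeta l x n)%:Z = (zeta l x n + t)%N%:Z by lia.
Qed.

Lemma ae_zeta_polynomial : {ae mu, forall x : path, exists N, forall n, (N <= n)%N ->
  (zeta l x n <= n ^ 5 + n)%N}.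
Proof.
apply: ae_imp (ae_and (ae_good stat l) (ae_and ae_Xtilde_heavy ae_return_time)) => x [gx [[N1 h1] [N2 h2]]].
have [N3 N30 hN3] : exists2 N3, (0 < N3)%N & (N1 < l N3)%N by have [_ _] := adm; exact.
pose N := maxn 2 (maxn N2 N3).
have step n : (N <= n)%N -> (zeta l x n.+1 <= zeta l x n + n.+1 ^ 4)%N.
  rewrite !geq_max => /and3P[n2 nN2 nN3].
  have ln : (N1 < l n.+1)%N.
    apply: leq_trans hN3 _; have [_ mono _] := adm; apply: mono; by rewrite N30 leqW.
  have e : recent (pa x (zeta l x n)) (l n.+1) = recent (Xtilde l x) (l n.+1).
    by apply/recent_eqP => i il; have := zeta_Xt adm gx il.
  have heavy : (n.+1%:R ^+ 2)^-1 <= pm (recent (pa x (zeta l x n)) (l n.+1)).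
    have := h1 (l n.+1).-1; rewrite prednK; last exact: leq_ltn_trans ln.
    have pl : (N1 <= (l n.+1).-1)%N by rewrite -ltnS prednK //; exact: leq_ltn_trans ln.
    move=> /(_ pl) /negP; rewrite -leNgt -e; apply: le_trans.
    (* The square of [exp_slow_length]: 2^(2 l^4) <= (n + 1)^2. *)
    rewrite lef_pV2 ?posrE ?exprn_gt0 ?ltr0n // mulnC exprM lerXn2r ?nnegrE ?ler0n ?exprn_ge0 //.
    by rewrite -natrX ler_nat; apply: exp_slow_length; exact: leqW.
  apply: contrapT => hz; apply: (h2 n nN2); split=> // t /andP[t0 tT] et; apply: hz.
  rewrite zetaS leq_add2l; have [_ _ hr] := ret_spec gx n.
  by apply: leq_trans tT; exact: hr.
(* For such n the starting value [zeta l x N] is absorbed by the summand n. *)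
exists (maxn N (zeta l x N)) => n; rewrite geq_max => /andP[Nn zn].
suff : (zeta l x n <= zeta l x N + n * n ^ 4)%N.
  by move=> /leq_trans; apply; rewrite addnC -expnS leq_add2l.
elim: n Nn {zn} => [|n ih]; first by rewrite leqn0 => /eqP ->; exact: leq_addr.
rewrite leq_eqVlt => /orP[/eqP<-|]; first exact: leq_addr.
rewrite ltnS => Nn; apply: leq_trans (step n Nn) _.
rewrite mulSn [X in (_ <= _ + X)%N]addnC addnA leq_add2r.
apply: leq_trans (ih Nn) _; rewrite leq_add2l leq_mul2l; apply/orP; right.
by rewrite leq_exp2r.
Qed.

End SlowLength.

End PolynomialGrowth.

(** * Transfer to the process *)

Section Law.
Context (R : realType) (A : countType) (a0 : A) (d : measure_display).
Context (Omega : measurableType d) (P : probability Omega R) (X : int -> Omega -> A).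
Notation path := (pathT int A a0).
Notation xp := (path_of X : Omega -> path).
Hypothesis procX : process X.

Lemma dm_process n : dm (X n).
Proof. by apply: dm_fibers => a; exact: procX. Qed.

Lemma measurable_path_of : measurable_fun setT (path_of X : Omega -> path).
Proof.
apply: (@measurability _ _ Omega path _ _
  [set B : set (int -> A) | exists i a, B = [set x | x i = a]]) => // _ [_ [i [a ->]] <-].
by rewrite setTI; exact: (dm_process i [set a]).
Qed.

Lemma measurable_past (C : set (nat -> A)) : cylinders C ->
  measurable [set w | C (past (path_of X w))].
Proof.
have m : measurable_fun setT ((fun w => past (path_of X w)) : Omega -> pathT nat A a0).
  apply: (@measurability _ _ Omega (pathT nat A a0) _ _
    [set B : set (nat -> A) | exists i a, B = [set y | y i = a]]) => // _ [_ [i [a ->]] <-].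
  by rewrite setTI; exact: (dm_process (- i%:Z) [set a]).
move=> mC; have mC' : measurable (C : set (pathT nat A a0)) by exact: mC.
by have := m measurableT _ mC'; rewrite setTI.
Qed.

Lemma law_exists : exists mu : probability path R, forall B : set path, measurable B ->
  measurable (xp @^-1` B) /\ P (xp @^-1` B) = mu B.
Proof.
pose g : {mfun Omega >-> path} := mfun_Sub (mem_set measurable_path_of).
exists (distribution P g) => B mB; split=> //.
by have := measurable_path_of measurableT mB; rewrite setTI.
Qed.

Context (mu : probability path R).
Hypothesis law : forall B : set path, measurable B ->
  measurable (xp @^-1` B) /\ P (xp @^-1` B) = mu B.

Lemma dm_path_of (V : Type) (v : path -> V) : dm v -> dm (fun w => v (path_of X w)).
Proof. by move=> hv B; have [h _] := law (hv B). Qed.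

Lemma law_stationary : stationary P X ->
  forall B : set path, measurable B -> mu (shiftz 1 @^-1` B) = mu B.
Proof.
move=> st B mB; have [_ <-] := law mB; have [_ <-] := law (measurable_shiftP 1 mB).
exact: st.
Qed.

Lemma law_ergodic : ergodic P X ->
  forall B : set path, measurable B -> shiftz 1 @^-1` B = B -> mu B = 0%E \/ mu B = 1%E.
Proof. by move=> er B mB hB; have [_ <-] := law mB; exact: er. Qed.

Lemma law_ae (Q : path -> Prop) : {ae mu, forall x, Q x} -> {ae P, forall w, Q (path_of X w)}.
Proof. exact: ae_preserving. Qed.

Lemma law_integral (h : path -> R) (M : R) (D : set path) : dm h -> (forall x, `|h x| <= M) ->
  measurable D ->
  (\int[P]_(w in path_of X @^-1` D) (h (path_of X w))%:E = \int[mu]_(x in D) (h x)%:E)%E.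
Proof.
move=> hh hM mD; have [mPD _] := law mD.
have mh : measurable_fun setT (EFin \o h : path -> \bar R).
  by apply: dm_measurable_fun; exact: (@dm_comp _ _ _ _ EFin).
have ih : P.-integrable (path_of X @^-1` D) ((EFin \o h : path -> \bar R) \o path_of X).
  by apply: (@dm_integrable _ _ _ P (fun w => h (path_of X w)) _ M) => //; exact: dm_path_of.
rewrite -[LHS](integral_pushforward measurable_path_of mh ih mD).
apply: (eq_measure_integral mu
  (m1 := measure_function_pushforward__canonical__measure_function_Measure P measurable_path_of)) => B mB _.
by have [_] := law mB.
Qed.

Lemma pstr_pm s : pstr P X s = pm mu s.
Proof.
have [_ e] := law (measurable_block a0 s 0).
rewrite /pstr /pm -e; congr (fine (P _)); apply/seteqP; split=> w /=; rewrite str_recent1 //.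
Qed.

Hypothesis stat : forall B : set path, measurable B -> mu (shiftz 1 @^-1` B) = mu B.

Lemma pcond_pm s y : pcond P X y s = pm mu (rcons s y) / pm mu s.
Proof.
rewrite /pcond pstr_pm; congr (_ / _).
have [_ e] := law (measurable_block a0 (rcons s y) 1).
have e1 := pmE_at stat (rcons s y) 1.
rewrite -[RHS]/(fine (pm mu (rcons s y))%:E) -e1 -e; congr (fine (P _)).
have -> : (block (rcons s y) 1 : set path) = block s 0 `&` [set x | x 1 = y].
  by have := block_rcons a0 s y 0; rewrite add0r.
by apply/seteqP; split=> w /=; rewrite str_recent1.
Qed.

Lemma memory_okE y K : memory_ok P X y K <-> memory_word mu (recent y K).
Proof.
split=> [h z a z0|h i i1 a z zi]; rewrite ?pstr_pm ?pcond_pm => p0.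
  by have := h (size z) z0 a z erefl; rewrite pstr_pm !pcond_pm; apply.
by apply: h; rewrite ?zi.
Qed.

Lemma memory_length_least y K : memory_word mu (recent y K) ->
  (forall k, (k < K)%N -> ~ memory_word mu (recent y k)) -> memory_length P X y = Some K.
Proof.
move=> h1 h2; rewrite /memory_length asboolT; last by exists K; apply/memory_okE.
congr Some; apply: minN_eq; first exact/memory_okE.
by move=> m /memory_okE hm; rewrite leqNgt; apply/negP => /h2.
Qed.

Lemma memory_length_finite y : memory_length P X y <> None -> exists K, memory_word mu (recent y K).
Proof.
by rewrite /memory_length; case: asboolP => // -[K /memory_okE hK] _; exists K.
Qed.

(** Words have product probabilities, so a longer past changes no conditional probability. *)
Lemma iid_memory : iid P X -> memory_word mu [::].
Proof.
move=> [ind idd].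
pose q a := pm mu [:: a].
have qE (j : int) a : P [set w | X j w = a] = (q a)%:E.
  rewrite (idd j 0 [set a]) /q -pmE -(law (measurable_block a0 [:: a] 0)).2; congr (P _).
  apply/seteqP; split=> w; rewrite /block /= recentS recent0 /pa /path_of subr0; first by move=> ->.
  by case.
have prod s : pm mu s = \prod_(a <- s) q a.
  apply: EFin_inj; rewrite -pmE -(law (measurable_block a0 s 0)).2.
  (* Time -j carries the letter of s at distance j from its end. *)
  pose E (i : int) := [set nth a0 (rev s) `|i|].
  pose idx : seq int := [seq - (j : nat)%:Z | j <- iota 0 (size s)].
  have -> : xp @^-1` (block s 0) = [set w | forall i, i \in idx -> E i (X i w)].
    apply/seteqP; split=> w /=.
      rewrite /block /= => e i /mapP[j]; rewrite mem_iota add0n => /andP[_ js] ->.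
      rewrite /E /= -e /recent revK nth_mkseq ?abszN ?absz_nat //.
      by rewrite /pa sub0r.
    move=> h; rewrite /block /= /recent -[RHS]revK; congr rev.
    apply: (@eq_from_nth _ a0); rewrite size_mkseq ?size_rev // => j js.
    rewrite nth_mkseq // /pa sub0r.
    have := h (- j%:Z); rewrite /E /= abszN absz_nat; apply.
    by apply: map_f; rewrite mem_iota.
  rewrite ind; last first.
    by rewrite map_inj_uniq ?iota_uniq // => i j /oppr_inj [].
  rewrite big_map (eq_bigr (fun j => (q (nth a0 (rev s) j))%:E)); last first.
    by move=> j _; rewrite /E abszN absz_nat /= qE.
  rewrite prodEFin; congr EFin.
  rewrite [RHS](perm_big (rev s)) /=; last by rewrite perm_sym perm_rev.
  by rewrite [RHS](big_nth a0) size_rev /index_iota subn0.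
move=> z y _; rewrite cats0 /= pm_nil divr1.
have -> : pm mu (rcons z y) = pm mu z * pm mu [:: y] by rewrite !prod -cats1 big_cat.
move=> p0; rewrite mulrC mulKf //; apply/eqP => e; move: p0.
by rewrite e mul0r ltxx.
Qed.

End Law.

Lemma dstar_agree (R : realType) (A : countType) (x y : nat -> A) k :
  (forall i, (i < k)%N -> x i = y i) -> dstar R x y <= (2 ^+ k)^-1.
Proof.
move=> h; pose S n : R := \sum_(0 <= i < n) 2%:R^-1 ^+ i.+1 * (x i != y i)%:R.
have SS n : S n.+1 = S n + 2%:R^-1 ^+ n.+1 * (x n != y n)%:R by rewrite /S big_nat_recr.
have t0 n : 0 <= 2%:R^-1 ^+ n.+1 * (x n != y n)%:R :> R.
  by rewrite mulr_ge0 // exprn_ge0 // invr_ge0.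
have mono : nondecreasing_seq S.
  by apply/nondecreasing_seqP => n; rewrite SS lerDl.
have Sk : S k = 0.
  by rewrite /S big_nat big1 // => i /andP[_ ik]; rewrite h // eqxx mulr0.
have Sj j : S (k + j)%N <= 2%:R^-1 ^+ k - 2%:R^-1 ^+ (k + j).
  elim: j => [|j ih]; first by rewrite addn0 Sk subrr.
  rewrite addnS SS; apply: (@le_trans _ _ (2%:R^-1 ^+ k - 2%:R^-1 ^+ (k + j) + 2%:R^-1 ^+ (k + j).+1)).
    apply: lerD => //; rewrite -[leRHS]mulr1; apply: ler_wpM2l; first by rewrite exprn_ge0 // invr_ge0.
    by case: (_ != _).
  by rewrite le_eqVlt; apply/orP; left; apply/eqP; rewrite exprS; field.
have Sn n : S n <= (2 ^+ k)^-1.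
  apply: le_trans (mono _ _ (leq_addl k n)) _; apply: le_trans (Sj n) _.
  by rewrite -exprVn gerBl exprn_ge0 // invr_ge0.
have cS : cvgn S by apply: (nondecreasing_is_cvgn mono); exists (2 ^+ k)^-1 => _ [n _ <-].
by apply: (limr_le cS); exact: nearW.
Qed.

Lemma small_exp2V (R : realType) (del : R) : 0 < del -> exists k, (2 ^+ k)^-1 < del.
Proof.
move=> d0; exists (Num.truncn del^-1).+1.
rewrite -[ltRHS]invrK ltf_pV2 ?posrE ?invr_gt0 ?exprn_gt0 //.
apply: lt_le_trans (truncnS_gt _) _; rewrite -natrX ler_nat; exact: ltnW (ltn_expl _ _).
Qed.

Lemma integral_near d (T : measurableType d) (R : realType) (P : probability T R) (D : set T)
  (g : T -> R) (c e : R) : measurable D -> P.-integrable D (EFin \o g) ->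
  (forall w, D w -> `|g w - c| <= e) ->
  `|fine (\int[P]_(w in D) (g w)%:E)%E - c * fine (P D)| <= e * fine (P D).
Proof.
move=> mD ig hg.
have ic (r : R) : P.-integrable D (EFin \o (fun=> r)).
  by apply: (@dm_integrable _ _ _ P _ _ `|r|) => //; exact: dm_cst.
have vc (r : R) : (\int[P]_(w in D) r%:E = (r * fine (P D))%:E)%E.
  by rewrite integral_cst // EFinM fineK // fin_num_measure.
have gfin : (\int[P]_(w in D) (g w)%:E)%E \is a fin_num by exact: integrable_fin_num ig.
have h1 : ((c - e) * fine (P D) <= fine (\int[P]_(w in D) (g w)%:E)%E)%R.
  rewrite -lee_fin fineK // -vc; apply: le_integral => //; first exact: ic.
  by move=> w /set_mem /hg; rewrite lee_fin ler_norml; lra.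
have h2 : (fine (\int[P]_(w in D) (g w)%:E)%E <= (c + e) * fine (P D))%R.
  rewrite -lee_fin fineK // -vc; apply: le_integral => //; first exact: ic.
  by move=> w /set_mem /hg; rewrite lee_fin ler_norml; lra.
by rewrite ler_norml; lra.
Qed.

(** * Conditional expectations given the past or a data segment *)

Section Conditioning.
Context (R : realType) (A : countType) (a0 : A) (d : measure_display).
Context (Omega : measurableType d) (P : probability Omega R) (X : int -> Omega -> A).
Notation path := (pathT int A a0).
Notation xp := (path_of X : Omega -> path).
Context (mu : probability path R).
Hypothesis law : forall B : set path, measurable B ->
  measurable (xp @^-1` B) /\ P (xp @^-1` B) = mu B.
Hypothesis procX : process X.
Hypothesis stat : forall B : set path, measurable B -> mu (shiftz 1 @^-1` B) = mu B.
Context (f : A -> R) (M : R).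
Hypothesis bf : forall a, `|f a| <= M.
Notation pm := (pm mu).

Lemma next_integral_E (s : seq A) (t : int) :
  (\int[P]_(w in xp @^-1` (block s t)) (f (X (t + 1) w))%:E = (next_integral mu f s)%:E)%E.
Proof.
have hf : dm (fun x : path => f (x (t + 1))).
  by apply: (@dm_comp _ _ _ _ f); exact: dm_coord.
have mb := measurable_block a0 s t.
rewrite (law_integral procX law hf (fun x => bf _) mb).
rewrite -(next_integral_at stat bf s t) /Rintegral fineK //.
by apply: integrable_fin_num => //; exact: (integrable_letter mu bf (t + 1) mb).
Qed.

Lemma ae_Xtilde (l : nat -> nat) (C : set (nat -> A)) : admissible l -> cylinders C -> P [set w | C (past (path_of X w))] = 1%E ->
  {ae P, forall w, C (Xtilde l (path_of X w))}.
Proof.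
move=> adm mC h; have [m1 m2 e] := Xtilde_law stat adm (B := (C : set (pathT nat A a0))) mC.
apply: (law_ae law (Q := fun x => C (Xtilde l x))); apply/(ae_prob1 mu m1); rewrite e.
by have [_ <-] := law m2; rewrite -h; congr (P _); apply/seteqP; split=> w /=; rewrite pastE.
Qed.

(** The mean given a word s of positive probability is the average of F over the pasts ending in s.
    Almost all of these lie in C and within 2^(-k) of y, so the average is within e of F(y). *)
Lemma regression_predicts (F : (nat -> A) -> R) (C : set (nat -> A)) (y : nat -> A) :
  regression_version P X f F -> cylinders C -> P [set w | C (past (path_of X w))] = 1%E ->
  dstar_continuous_on C F -> C y -> predicts mu f y (F y).
Proof.
move=> [mF [_ iF hF]] mC PC cF Cy e e0.
have [del del0 hdel] := cF y Cy e e0.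
have [k hk] := small_exp2V del0; exists k => z; set s := z ++ recent y k => ps.
pose D : set Omega := xp @^-1` (block s 0).
have [mD PD] := law (measurable_block a0 s 0); rewrite pmE in PD.
have mPC := measurable_past a0 procX mC.
pose N := ~` [set w | C (past (path_of X w))].
have mN : measurable N by exact: measurableC.
have PN : P N = 0%E by rewrite probability_setC // PC subee.
have hD : (\int[P]_(w in D) (F (past (path_of X w)))%:E = (next_integral mu f s)%:E)%E.
  rewrite hF; first by have := next_integral_E s 0; rewrite add0r; exact.
  exists [set y : nat -> A | recent y (size s) = s].
    pose T := pathT nat A a0; suff : measurable [set y : T | recent y (size s) = s] by [].
    apply: dm_measurable; apply: (@dm_comp _ _ _ _ (fun u => u = s)).
    by apply: dm_recent => i; exact: dm_coord.
  by apply/seteqP; split=> w /=; rewrite pastE; [case|].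
have iD : P.-integrable D (EFin \o (fun w => F (past (path_of X w)))).
  exact: integrableS iF.
rewrite (negligible_integral mN mD iD PN) in hD.
have mDN : measurable (D `\` N) by exact: measurableD.
have PDN : P (D `\` N) = (pm s)%:E.
  rewrite -PD; apply: mu_ae_eq => //; apply: (ae_null mN PN) => w nN.
  by split=> [[]|Dw] //; split.
have := @integral_near _ _ _ P (D `\` N) (fun w => F (past (path_of X w))) (F y) e mDN.
rewrite hD PDN /=; rewrite -(next_meanK mu bf s) -mulrBl normrM (ger0_norm (ltW ps)).
rewrite ler_pM2r //; apply.
  by apply: integrableS iD => //; exact: subDsetl.
move=> w [Dw nN]; apply/ltW/hdel; first by apply: contrapT.
apply: le_lt_trans hk; apply: dstar_agree; apply/recent_eqP.
have [z' _ e'] := recentD (past (path_of X w)) k (size z).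
have := Dw; rewrite /D /block /= -pastE /s size_cat size_recent addnC e'.
by rewrite -e' => h; exact: recent_suffix h erefl.
Qed.

Lemma dm_segment (T : Omega -> nat) : dm T -> dm (fun w => hist (T w) (path_of X w : path)).
Proof.
move=> hT; apply: (@dm_bind _ _ _ _ T (fun t w => hist t (path_of X w : path))) => // t.
by apply: (dm_path_of law (v := fun x : path => hist t x)); exact: dm_hist.
Qed.

(* T need only be a stopping time off a null set. *)
Lemma cond_expectation_segment (T : Omega -> nat) (Q : Omega -> Prop) (G : Omega -> R) (s : seq A) :
  dm T -> {ae P, forall w, Q w} ->
  (forall w w', Q w -> Q w' -> agree (path_of X w) (path_of X w') (T w) -> T w' = T w) ->
  cond_expectation P (segment_events X T) (fun w => f (X (T w + 1)%N%:Z w)) G ->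
  {ae P, forall w, hist (T w) (path_of X w : path) = s -> G w = next_mean mu f s}.
Proof.
move=> dT aQ hT [mG iG hG].
pose seg w := hist (T w) (path_of X w : path).
case: (pselect (exists w0, Q w0 /\ seg w0 = s)); last first.
  by move=> h; apply: ae_imp aQ => w gw es; exfalso; apply: h; exists w.
move=> [w0 [g0 s0]]; pose t := T w0.
have st : size s = t.+1 by rewrite -s0 /seg /hist size_recent.
have [N [mN PN hN]] := ae_null_inv aQ.
pose E := [set w | seg w = s]; pose B : set Omega := xp @^-1` (block s t).
have mE : measurable E by exact: (dm_segment dT [set s]).
have [mB PB] := law (measurable_block a0 s t); rewrite (pmE_at stat) in PB.
have lE w : E w -> T w = t.
  move=> Ew; have e : size (seg w) = (T w).+1 by exact: size_recent.
  by apply: succn_inj; rewrite -e (Ew : seg w = s).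
(* Off the null set, the event that the segment equals s is the block event at the fixed time t, by
   the stopping-time property. *)
have EB : E `\` N = B `\` N.
  apply/seteqP; split=> w [h nN]; refine (conj _ nN).
    by have := h; rewrite /E /= /seg (lE w h) /B /block /= st.
  have hw : hist t (path_of X w : path) = s by move: h; rewrite /B /block /= st.
  have lw : T w = t by apply: (hT w0 w g0 (hN w nN)); apply/(hist_agree (a0 := a0)); rewrite hw.
  by rewrite /E /= /seg lw.
have iY D : measurable D -> P.-integrable D (EFin \o (fun w => f (X (t%:Z + 1) w))).
  move=> mD; apply: (@dm_integrable _ _ _ P _ _ M) => //.
  by apply: (@dm_comp _ _ _ _ f); exact: dm_process.
have SE : segment_events X T E.
  exists [set s] => //; apply/seteqP; split=> w /=; rewrite str_recent0; first by case.
  by move=> e; split.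
(* G is measurable for the segment, hence constant where the segment is s. *)
have cG w : E w -> G w = G w0.
  move=> Ew; have [Z _ eZ] := mG _ (measurable_set1 (G w0)).
  have hZ v : (G v = G w0) <-> Z (seg v).
    by have := congr1 (fun U => U v) eZ; rewrite /= str_recent0 => <-; split=> [[]|].
  by apply/hZ; rewrite Ew -s0; apply/hZ.
have : ((G w0)%:E * P E = (next_integral mu f s)%:E)%E.
  rewrite -(integral_cst P mE) -(next_integral_E s t).
  rewrite (negligible_integral mN mB (iY _ mB) PN) -EB -(negligible_integral mN mE (iY _ mE) PN).
  transitivity (\int[P]_(w in E) (G w)%:E)%E.
    by apply: eq_integral => w /set_mem Ew; rewrite /= cG.
  rewrite (hG E SE); apply: eq_integral => w /set_mem Ew.
  by rewrite (lE w Ew) PoszD.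
have PE : P E = (pm s)%:E.
  rewrite -PB; apply: mu_ae_eq => //; apply: (ae_null mN PN) => w nN.
  split=> hw; have : (E `\` N) w by [split|rewrite EB; split].
    by rewrite EB => -[].
  by case.
rewrite PE => -[e]; case: (eqVneq (pm s) 0) => p0.
  by apply: (ae_null mE) => [|w nE /nE //]; rewrite PE p0.
apply: nearW => w Ew; rewrite (cG w Ew); apply: (mulIf p0).
by rewrite e (next_meanK mu bf).
Qed.

End Conditioning.

(** If no block entropy were finite, every term of the sequence would be infinite, and so would its
    limit. *)
Lemma finite_block_entropy (R : realType) (A : countType) (d : measure_display)
  (Omega : measurableType d) (P : probability Omega R) (X : int -> Omega -> A) :
  (entropy_rate P X < +oo)%E -> exists m h,
  (\esum_(s in [set s : seq A | size s = m.+1]) (- (pstr P X s * log2 (pstr P X s)))%:E <= h%:E)%E.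
Proof.
move=> hlim; apply: contrapT => hn.
have infty m : (\esum_(s in [set s : seq A | size s = m.+1]) (- (pstr P X s * log2 (pstr P X s)))%:E = +oo)%E.
  move: hn; case e: (\esum_(s in [set s : seq A | size s = m.+1]) _)%E => [h| |] hn //.
    by exfalso; apply: hn; exists m, h; rewrite e.
  by exfalso; apply: hn; exists m, 0; rewrite e leNye.
move: hlim; rewrite /entropy_rate.
have -> : (fun n => (n.+1%:R^-1)%:E * \esum_(s in [set s : seq A | size s = n.+1])
    (- (pstr P X s * log2 (pstr P X s)))%:E)%E = (fun=> +oo%E : \bar R).
  by apply/funext => n; rewrite infty mulry gtr0_sg ?mul1e // invr_gt0.
by rewrite lim_cst // ltxx.
Qed.

Section Process.
Context (R : realType) (A : countType) (a0 : A) (d : measure_display).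
Context (Omega : measurableType d) (P : probability Omega R) (X : int -> Omega -> A).
Notation path := (pathT int A a0).
Notation xp := (path_of X : Omega -> path).
Context (mu : probability path R).
Hypothesis law : forall B : set path, measurable B ->
  measurable (xp @^-1` B) /\ P (xp @^-1` B) = mu B.
Hypothesis se : stationary_ergodic P X.

Let procX : process X. Proof. by case: se. Qed.

Let stat (B : set path) : measurable B -> mu (shiftz 1 @^-1` B) = mu B.
Proof. by case: se => _ st _; exact: (law_stationary law st). Qed.

Let erg (B : set path) : measurable B -> shiftz 1 @^-1` B = B -> mu B = 0%E \/ mu B = 1%E.
Proof. by case: se => _ _ er; exact: (law_ergodic law er). Qed.

Context (l : nat -> nat) (beta gamma : R).
Hypotheses (adm : admissible l) (beta0 : 0 < beta) (gamma0 : 0 < gamma).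
Hypothesis bg : 2 * beta + gamma < 1.
Notation lambda := (lambda l beta gamma).

Lemma ae_regular : {ae P, forall w, let x := path_of X w : path in
  [/\ good l x, typical mu x, concentrated mu beta gamma x,
      (forall k, 0 < pm mu (recent (Xtilde l x) k)) & forall t, 0 < pm mu (hist t x)]}.
Proof.
apply: (law_ae law (Q := fun x : path => [/\ good l x, typical mu x, concentrated mu beta gamma x,
  (forall k, 0 < pm mu (recent (Xtilde l x) k)) & forall t, 0 < pm mu (hist t x)])).
have h1 := ae_good stat l; have h2 := ae_typical stat erg.
have h3 := ae_concentrated stat beta0 gamma0 bg; have h4 := ae_positive stat adm.
by apply: ae_imp (ae_and h1 (ae_and h2 (ae_and h3 h4))) => x [g1 [g2 [g3 [g4 g5]]]]; split.
Qed.

Section Regression.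
Context (f : A -> R) (M : R).
Hypothesis bf : forall a, `|f a| <= M.
Context (F : (nat -> A) -> R).
Hypotheses (rF : regression_version P X f F) (cF : as_continuous P X F).

Lemma ae_predicts : {ae P, forall w, predicts mu f (Xtilde l (path_of X w)) (F (Xtilde l (path_of X w)))}.
Proof.
have [C [mC PC hC]] := cF; apply: ae_imp (ae_Xtilde law stat adm mC PC) => w Cw.
exact: (regression_predicts law procX stat bf rF mC PC hC Cw).
Qed.

Lemma ae_festim_cvg : {ae P, forall w,
  (fun n => festim l beta gamma (path_of X w) f n) @ \oo --> F (Xtilde l (path_of X w))}.
Proof.
have hi := law_ae law (ae_innovation stat beta gamma adm bf).
apply: ae_imp (ae_and ae_regular (ae_and ae_predicts hi)) => w [[gx tx cx px ph] [hp hw]].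
exact: (festim_cvg stat adm beta0 gamma0 gx tx cx px bf ph hp hw).
Qed.

Lemma ae_prediction_error (G : nat -> Omega -> R) :
  (forall n, cond_expectation P (segment_events X (fun w => lambda (path_of X w) n))
     (fun w => f (X (lambda (path_of X w) n + 1)%N%:Z w)) (G n)) ->
  {ae P, forall w, (fun n => `|festim l beta gamma (path_of X w) f n - G n w|) @ \oo --> (0 : R)}.
Proof.
move=> hG.
have hn : {ae P, forall w, forall n s,
    hist (lambda (path_of X w) n) (path_of X w : path) = s -> G n w = next_mean mu f s}.
  apply: ae_foralln => n; apply: ae_countable => s.
  have dl : dm (fun w => lambda (path_of X w) n).
    by apply: (dm_path_of law (v := fun x : path => lambda x n)); exact: dm_lambda.
  apply: (cond_expectation_segment law procX stat bf s dl (law_ae law (ae_good stat l)) _ (hG n)).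
  by move=> w w' gw gw' ag; exact: (lambda_agree adm gw gw' ag erefl).
apply: ae_imp (ae_and ae_regular (ae_and ae_predicts (ae_and ae_festim_cvg hn))) => w.
move=> [[gx tx cx px ph] [hp [hf hw]]].
have hg : (fun n => G n w) @ \oo --> F (Xtilde l (path_of X w)).
  apply: cvg_trans (next_mean_cvg stat adm beta0 gamma0 gx tx cx px bf ph hp).
  by apply: near_eq_cvg; apply: nearW => n; rewrite (hw n _ erefl).
have h0 : (fun n => festim l beta gamma (path_of X w) f n - G n w) @ \oo --> (0 : R).
  by rewrite -(subrr (F (Xtilde l (path_of X w)))); exact: cvgB.
exact/norm_cvg0P.
Qed.

End Regression.

Lemma ae_lambda_rate : finitarily_markovian P X -> {ae P, forall w, let y := Xtilde l (path_of X w) in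
  exists K : nat, [/\ memory_length P X y = Some K, 0 < pstr P X (recent y K) &
    (fun n => (lambda (path_of X w) n)%:R / n%:R : R) @ \oo --> (pstr P X (recent y K))^-1]}.
Proof.
(* Ending in a memory word is an event about a left-infinite sequence, so it passes from the past to
   Xtilde by equality of their laws. *)
move=> fm; pose D := [set y : pathT nat A a0 | exists K, memory_word mu (recent y K)].
have mD : measurable D.
  apply: dm_measurable; apply: dm_ex => K; apply: (@dm_comp _ _ _ _ (memory_word mu)).
  by apply: dm_recent => i; exact: dm_coord.
have hD : {ae P, forall w, D (past (path_of X w))}.
  by apply: ae_imp fm => w; exact: (memory_length_finite law stat).
have mP := measurable_past a0 procX mD.
have PD : P [set w | D (past (path_of X w))] = 1%E by apply/(ae_prob1 P mP).
apply: ae_imp (ae_and ae_regular (ae_Xtilde law stat adm mD PD)) => w.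
move=> [[gx tx cx px ph] hK]; have [K [mK hKm]] := least_memory hK; exists K.
rewrite (pstr_pm law); split=> //.
  exact: (memory_length_least law stat).
exact: (lambda_rate stat adm beta0 gamma0 gx tx cx px mK hKm).
Qed.

Lemma ae_lambda_step : iid P X -> {ae P, forall w, \forall n \near \oo,
  lambda (path_of X w) n.+1 = (lambda (path_of X w) n).+1}.
Proof.
move=> hiid; have m0 := iid_memory law hiid.
apply: ae_imp ae_regular => w [gx tx cx px ph].
have [N hN] := lambda_step stat adm beta0 gamma0 gx tx cx m0.
by exists N.
Qed.

End Process.

Lemma ae_lambda_polynomial (R : realType) (A : countType) (a0 : A) (d : measure_display)
  (Omega : measurableType d) (P : probability Omega R) (X : int -> Omega -> A)
  (mu : probability (pathT int A a0) R) (beta gamma : R) :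
  (forall B : set (pathT int A a0), measurable B ->
    measurable ((path_of X : Omega -> pathT int A a0) @^-1` B) /\
    P ((path_of X : Omega -> pathT int A a0) @^-1` B) = mu B) ->
  stationary_ergodic P X -> (entropy_rate P X < +oo)%E ->
  {ae P, forall w, \forall n \near \oo,
    (lambda slow_length beta gamma (path_of X w) n)%:R <= ('X^5 + 'X : {poly R}).[n%:R]}.
Proof.
move=> law [procX st _] /finite_block_entropy[m [h hm]].
have stat : forall B : set (pathT int A a0), measurable B -> mu (shiftz 1 @^-1` B) = mu B.
  exact: (law_stationary law st).
have ent : (\esum_(s in [set s : seq A | size s = m.+1]) (- (pm mu s * log2 (pm mu s)))%:E <= h%:E)%E.
  by apply: le_trans hm; apply: le_esum => s _; rewrite (pstr_pm law).
have hz := law_ae law (ae_zeta_polynomial stat ent).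
have hg := law_ae law (ae_good stat slow_length).
apply: ae_imp (ae_and hz hg) => w [[N hN] gx]; exists N => // n /= Nn.
rewrite hornerD hornerXn hornerX -natrX -natrD ler_nat.
exact: leq_trans (lambda_le_zeta beta gamma slow_length_admissible gx n) (hN n Nn).
Qed.

(** A probability space is nonempty, which yields the letter [a0]. *)
Lemma stationary_ergodic_law (R : realType) (A : countType) (d : measure_display)
  (Omega : measurableType d) (P : probability Omega R) (X : int -> Omega -> A) :
  stationary_ergodic P X -> exists (a0 : A) (mu : probability (pathT int A a0) R),
  forall B : set (pathT int A a0), measurable B ->
    measurable ((path_of X : Omega -> pathT int A a0) @^-1` B) /\
    P ((path_of X : Omega -> pathT int A a0) @^-1` B) = mu B.
Proof.
move=> [procX _ _].
have [w _] : exists w : Omega, True.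
  by apply: (ae_nonempty (mu := P)); apply: nearW.
by exists (X 0 w); exact: law_exists.
Qed.

Theorem mainTheorem1 (R : realType) (A : countType) (beta gamma : R)
    (f : A -> R)
    (hbeta : 0 < beta < 1) (hgamma : 0 < gamma < 1)
    (hbg : 2 * beta + gamma < 1)
    (hf : exists M : R, forall a, `|f a| <= M) :
  [/\ (* (1) *)
      forall (l : nat -> nat), admissible l ->
      forall (d : measure_display) (Omega : measurableType d)
        (P : probability Omega R) (X : int -> Omega -> A),
      stationary_ergodic P X ->
      forall F : (nat -> A) -> R,
      regression_version P X f F -> as_continuous P X F ->
      {ae P, forall w,
        (fun n => festim l beta gamma (path_of X w) f n) @ \oo
          --> F (Xtilde l (path_of X w))} /\
      (forall G : nat -> Omega -> R,
        (forall n, cond_expectation P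
           (segment_events X (fun w => lambda l beta gamma (path_of X w) n))
           (fun w => f (X (lambda l beta gamma (path_of X w) n + 1)%N%:Z w))
           (G n)) ->
        {ae P, forall w,
          (fun n => `|festim l beta gamma (path_of X w) f n - G n w|) @ \oo
            --> (0 : R)}),
      (* (2) *)
      exists l : nat -> nat, admissible l /\
      forall (d : measure_display) (Omega : measurableType d)
        (P : probability Omega R) (X : int -> Omega -> A),
      stationary_ergodic P X -> (entropy_rate P X < +oo)%E ->
      exists Q : {poly R}, {ae P, forall w, \forall n \near \oo,
        (lambda l beta gamma (path_of X w) n)%:R <= Q.[n%:R]},
      (* (3) *)
      forall (l : nat -> nat), admissible l ->
      forall (d : measure_display) (Omega : measurableType d)
        (P : probability Omega R) (X : int -> Omega -> A),
      stationary_ergodic P X -> finitarily_markovian P X ->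
      {ae P, forall w, let y := Xtilde l (path_of X w) in
        exists K : nat,
          [/\ memory_length P X y = Some K, 0 < pstr P X (recent y K) &
              (fun n => (lambda l beta gamma (path_of X w) n)%:R / n%:R : R)
                @ \oo --> (pstr P X (recent y K))^-1]} &
      (* (4) *)
      forall (l : nat -> nat), admissible l ->
      forall (d : measure_display) (Omega : measurableType d)
        (P : probability Omega R) (X : int -> Omega -> A),
      stationary_ergodic P X -> iid P X ->
      {ae P, forall w, \forall n \near \oo,
        lambda l beta gamma (path_of X w) n.+1 =
        (lambda l beta gamma (path_of X w) n).+1}].
Proof.
have [b0 _] := andP hbeta; have [g0 _] := andP hgamma; have [M bf] := hf; split.
- move=> l adm d Omega P X se F rF cF; have [a0 [mu law]] := stationary_ergodic_law se.
  split; first exact: (ae_festim_cvg law se adm b0 g0 hbg bf rF cF).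
  exact: (ae_prediction_error law se adm b0 g0 hbg bf rF cF).
- exists slow_length; split; first exact: slow_length_admissible.
  move=> d Omega P X se ent; have [a0 [mu law]] := stationary_ergodic_law se.
  by exists ('X^5 + 'X); exact: (ae_lambda_polynomial beta gamma law se ent).
- move=> l adm d Omega P X se fm; have [a0 [mu law]] := stationary_ergodic_law se.
  exact: (ae_lambda_rate law se adm b0 g0 hbg fm).
- move=> l adm d Omega P X se hiid; have [a0 [mu law]] := stationary_ergodic_law se.
  exact: (ae_lambda_step law se adm b0 g0 hbg hiid).
Qed.
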